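(* Let $\Gamma$ be a connected Coxeter graph with exactly $4$ vertices all of whose edge labels equal a single integer $n\ge 2$, where $n\neq 4k+2$ for every $k\geq 1$. Then every Coxeter group $W$ with $\widehat W\cong\widehat{W_\Gamma}$ is isomorphic to $W_\Gamma$.
   Context: For a finite simplicial graph $\Gamma$ with edge labels $m\colon E(\Gamma)\to\mathbb{N}_{\ge2}$, $W_\Gamma=\langle V(\Gamma)\mid v^2,\ (vw)^{m(\{v,w\})}\text{ for }\{v,w\}\in E(\Gamma)\rangle$. $\widehat{G}$ is profinite completion. *)

(* Defs.v *)
From Stdlib Require List.
From mathcomp Require Import all_boot.

Set Implicit Arguments.
Unset Strict Implicit.
Unset Printing Implicit Defensive.

Record group := Group {
  gcar :> Type;
  gmul : gcar -> gcar -> gcar;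
  gone : gcar;
  ginv : gcar -> gcar;
  gmulA : forall x y z, gmul x (gmul y z) = gmul (gmul x y) z;
  gmul1g : forall x, gmul gone x = x;
  gmulVg : forall x, gmul (ginv x) x = gone
}.

Fixpoint gpow (G : group) (x : G) (k : nat) : G :=
  match k with 0 => gone G | k'.+1 => gmul x (gpow x k') end.

Definition is_hom (G H : group) (f : G -> H) : Prop :=
  forall x y, f (gmul x y) = gmul (f x) (f y).

Definition group_iso (G H : group) : Prop :=
  exists f : G -> H, is_hom f /\
    exists g : H -> G, (forall x, g (f x) = x) /\ (forall y, f (g y) = y).

(* A finite simplicial graph with edge labels >= 2; non-edges carry no
   relation (label "infinity"). *)
Record coxgraph := CoxGraph {
  cv : finType;
  cedge : rel cv;
  clab : cv -> cv -> nat;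
  cedge_sym : symmetric cedge;
  cedge_irr : irreflexive cedge;
  clab_sym : forall v w, clab v w = clab w v;
  clab_ge2 : forall v w, cedge v w -> 2 <= clab v w
}.

Definition cox_rels (D : coxgraph) (G : group) (s : cv D -> G) : Prop :=
  (forall v, gmul (s v) (s v) = gone G) /\
  (forall v w, cedge v w -> gpow (gmul (s v) (s w)) (clab v w) = gone G).

(* G is (isomorphic to) W_D: G with generators s is presented by
   < V | v^2, (vw)^m(v,w) for edges >, expressed by the universal property
   of the presentation. *)
Definition is_coxeter_group_of (D : coxgraph) (G : group) : Prop :=
  exists s : cv D -> G, cox_rels s /\
    forall (H : group) (t : cv D -> H), cox_rels t ->
      exists! f : G -> H, is_hom f /\ forall v, f (s v) = t v.

Definition coxeter_group (G : group) : Prop :=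
  exists D : coxgraph, is_coxeter_group_of D G.

Definition fi_normal (G : group) (N : G -> Prop) : Prop :=
  [/\ N (gone G),
      (forall x y, N x -> N y -> N (gmul x y)),
      (forall x, N x -> N (ginv x)),
      (forall g x, N x -> N (gmul (ginv g) (gmul x g)))
    & exists l : list G, forall g, exists2 h, List.In h l & N (gmul (ginv h) g)].

Definition finorm (G : group) := {N : G -> Prop | fi_normal N}.

Definition coset (G : group) (N : G -> Prop) (g : G) : G -> Prop :=
  fun h => N (gmul (ginv g) h).

(* Elements of the profinite completion \hat G = lim G/N: compatible families
   of cosets x_N of N, one for each finite-index normal N. *)
Definition compat (G : group) (x : finorm G -> G -> Prop) : Prop :=
  (forall N : finorm G, exists g, forall h, x N h <-> coset (sval N) g h) /\
  (forall M N : finorm G, (forall h, sval M h -> sval N h) ->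
      forall h, x M h -> x N h).

Definition completion (G : group) := {x : finorm G -> G -> Prop | compat x}.

Definition cproj (G : group) (x : completion G) (N : finorm G) : G -> Prop :=
  sval x N.

Definition cmul_rel (G : group) (x y z : completion G) : Prop :=
  forall N h, cproj z N h <->
     exists a b, cproj x N a /\ cproj y N b /\ h = gmul a b.

(* continuity for the profinite topology (inverse-limit topology of the
   discrete finite quotients) *)
Definition ccontinuous (G H : group) (f : completion G -> completion H) : Prop :=
  forall (x : completion G) (N' : finorm H), exists N : finorm G,
    forall y : completion G, (forall g, cproj x N g <-> cproj y N g) ->
      forall h, cproj (f x) N' h <-> cproj (f y) N' h.

Definition profinite_iso (G H : group) : Prop :=
  exists f : completion G -> completion H,
    (forall x y z, cmul_rel x y z -> cmul_rel (f x) (f y) (f z)) /\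
    ccontinuous f /\
    exists g : completion H -> completion G,
      (forall x, g (f x) = x) /\ (forall y, f (g y) = y) /\ ccontinuous g.

Definition connected_cox (D : coxgraph) : Prop :=
  forall v w : cv D, connect (@cedge D) v w.

(* Main.v *)
From HB Require Import structures.
From Stdlib Require Import ClassicalEpsilon FunctionalExtensionality.
From Stdlib Require Import PropExtensionality ProofIrrelevance.
From mathcomp Require Import all_boot all_fingroup all_algebra all_solvable all_field.
From mathcomp Require Import ring.
Require Import Defs.

(** A homomorphism from a Coxeter group to a finite group Q is a tuple of
    elements of Q satisfying the Coxeter relations, and an isomorphism of
    profinite completions gives, naturally in Q, a bijection between the tuples
    for W and those for W_Gamma. It suffices to find a map of the diagram D of W
    onto a four-vertex diagram Gamma' presenting W_Gamma that collapses edges or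
    sends them to edges whose label n divides theirs. Pulling tuples back along
    it is injective, hence bijective by counting, so every finite quotient of W
    factors through W_Gamma; the reflection representation of W over finite
    fields then forces the map to be an isomorphism of diagrams.

    For n even the vertices of D fall into four classes under edges with odd
    labels. If 4 divides n, quotients onto the dihedral group of order 8 match
    these classes with the vertices of Gamma, and dihedral quotients determine
    the labels between classes. If n = 2, counting maps that lift to the
    dihedral group of order 8 determines Gamma.

    For n odd and p a prime divisor of n, quotients onto dihedral groups of order
    2p^k give four classes under edges with labels prime to p, and quotients onto
    (Z/r)^(Z/p) x| D_p show that the classes are the same for all primes r | n.
    Let p^b be the exact power of p dividing n. Quotients onto
    (Z/p^b)^(Z/p) x| D_p, in which the product of two reflections has order
    dividing n exactly when they agree in one of two coordinates, determine the
    graph of the pairs of classes joined by a label not divisible by p^(b+1), up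
    to replacing a tree by another; a diagram twist shows that all trees give
    the same group. Edges with other labels are excluded by groups of
    triangular matrices over F_p, in which the products of an involution with
    two others have order p, while the product of these two has large order. *)

Set Implicit Arguments.
Unset Strict Implicit.
Unset Printing Implicit Defensive.

(** * Homomorphisms to finite groups and the profinite completion *)

Local Open Scope group_scope.

(** A profinite isomorphism does not say where the standard generators go, so every step has to be a
    count that is natural in the finite group: of tuples, of tuples that lift along a homomorphism,
    or of lifts of one tuple.

    The parity of n decides how a pair of vertices can be tested. For n even the other vertices may
    be sent to 1, so dihedral groups test one pair at a time. For n odd the odd labels connect the
    diagram, so in a group with a sign all entries of a tuple have the same sign and no vertex can
    be switched off. Hence the larger groups: a reflection there carries an axis and a sum, and one
    chosen pair can differ in both while every other pair agrees in one.

    When p^b is the exact power of p in n, groups with p-part of exponent p^(b+1) cannot see a label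
    divisible by p^(b+1). Excluding it needs unbounded exponent, while a common neighbour still has
    products of order p with both ends. Rotations of a dihedral group commute, which rules this out
    there and leads to unipotent matrices.

    If n = 4k + 2 with k >= 1, the dihedral group of order 2n is Z/2 times a dihedral group of order
    n and has a second Coxeter diagram. *)

Section Group.
Variable G : group.
Implicit Types x y z : G.

Lemma gmulgV x : gmul x (ginv x) = gone G.
Proof.
have e : gmul (ginv (ginv x)) (gmul (ginv x) (gmul x (ginv x))) = gone G.
  by rewrite (gmulA (ginv x)) gmulVg gmul1g gmulVg.
by rewrite -e gmulA gmulVg gmul1g.
Qed.

Lemma gmulg1 x : gmul x (gone G) = x.
Proof. by rewrite -(gmulVg x) gmulA gmulgV gmul1g. Qed.

Lemma gmulKg x y : gmul (ginv x) (gmul x y) = y.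
Proof. by rewrite gmulA gmulVg gmul1g. Qed.

Lemma gmulKVg x y : gmul x (gmul (ginv x) y) = y.
Proof. by rewrite gmulA gmulgV gmul1g. Qed.

Lemma ginv_uniq x y : gmul x y = gone G -> y = ginv x.
Proof. by move=> e; rewrite -(gmulKg x y) e gmulg1. Qed.

Lemma ginvMg x y : ginv (gmul x y) = gmul (ginv y) (ginv x).
Proof.
by apply: esym; apply: ginv_uniq; rewrite -gmulA (gmulA y) gmulgV gmul1g gmulgV.
Qed.

Lemma ginvK x : ginv (ginv x) = x.
Proof. by apply: esym; apply: ginv_uniq; exact: gmulVg. Qed.

End Group.

Definition fgroup (Q : finGroupType) : group :=
  @Group Q (@mulg Q) 1 (@invg Q) (@mulgA Q) (@mul1g Q) (@mulVg Q).

Section Completion.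
Variable G : group.

Lemma completion_ext (x y : completion G) :
  (forall N h, cproj x N h <-> cproj y N h) -> x = y.
Proof.
case: x y => [x Hx] [y Hy]; rewrite /cproj /= => e.
have exy : x = y.
  apply: functional_extensionality => N; apply: functional_extensionality => h.
  exact: propositional_extensionality.
by subst y; rewrite (proof_irrelevance _ Hx Hy).
Qed.

Lemma fi_normalC (N : finorm G) : [/\ sval N (gone G),
  (forall x y, sval N x -> sval N y -> sval N (gmul x y)),
  (forall x, sval N x -> sval N (ginv x)) &
  (forall g x, sval N x -> sval N (gmul (ginv g) (gmul x g)))].
Proof. by case: N => N [? ? ? ? ?]. Qed.

Lemma iota_compat (g : G) : compat (fun N : finorm G => coset (sval N) g).
Proof. by split=> [N|M N sMN h]; [exists g | apply: sMN]. Qed.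

Definition ciota (g : G) : completion G := exist _ _ (iota_compat g).

Lemma cproj_coset (x : completion G) N g h : cproj x N g ->
  cproj x N h <-> sval N (gmul (ginv g) h).
Proof.
have [N1 NM NV NJ] := fi_normalC N.
have [Hc _] := proj2_sig x; rewrite /cproj; have [k Hk] := Hc N.
rewrite !Hk /coset => Ng; split=> Nh.
  have -> : gmul (ginv g) h = gmul (ginv (gmul (ginv k) g)) (gmul (ginv k) h).
    by rewrite ginvMg ginvK -gmulA gmulKVg.
  exact/NM/Nh/NV.
have -> : gmul (ginv k) h = gmul (gmul (ginv k) g) (gmul (ginv g) h).
  by rewrite -gmulA gmulKVg.
exact: NM.
Qed.

Lemma cproj_ex (x : completion G) N : exists g, cproj x N g.
Proof.
have [Hc _] := proj2_sig x; have [k Hk] := Hc N; exists k; rewrite /cproj Hk /coset.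
by rewrite gmulVg; case: (fi_normalC N).
Qed.

Lemma cproj_ciota g N h : cproj (ciota g) N h <-> sval N (gmul (ginv g) h).
Proof. by []. Qed.

Lemma cmul_compat (x y : completion G) : compat (fun (N : finorm G) h =>
  exists a b, cproj x N a /\ cproj y N b /\ h = gmul a b).
Proof.
split=> [N|M N sMN h [a [b [xa [yb ->]]]]]; last first.
  have [_ Hx] := proj2_sig x; have [_ Hy] := proj2_sig y; exists a, b.
  by split; [apply: Hx xa | split=> //; apply: Hy yb].
have [N1 NM NV NJ] := fi_normalC N.
have [g xg] := cproj_ex x N; have [k yk] := cproj_ex y N.
exists (gmul g k) => h; rewrite /coset; split.
  case=> [a [b [xa [yb ->]]]].
  have {}xa := (cproj_coset a xg).1 xa; have {}yb := (cproj_coset b yk).1 yb.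
  have -> : gmul (ginv (gmul g k)) (gmul a b) =
    gmul (gmul (ginv k) (gmul (gmul (ginv g) a) k)) (gmul (ginv k) b).
    by rewrite ginvMg -!gmulA gmulKVg.
  exact/NM/yb/NJ.
move=> Nh; exists g, (gmul (ginv g) h); split=> //; split; last by rewrite gmulKVg.
by apply/(cproj_coset _ yk); rewrite gmulA -ginvMg.
Qed.

Definition cmul (x y : completion G) : completion G := exist _ _ (cmul_compat x y).

Lemma cmulP x y z : cmul_rel x y z <-> z = cmul x y.
Proof.
split=> [H|-> N h //]; apply: completion_ext => N h; exact: H.
Qed.

Lemma ciotaM a b : ciota (gmul a b) = cmul (ciota a) (ciota b).
Proof.
apply: completion_ext => N h.
have [N1 NM NV NJ] := fi_normalC N.
have Nc c : cproj (ciota c) N c by rewrite cproj_ciota gmulVg.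
have Nab : cproj (cmul (ciota a) (ciota b)) N (gmul a b) by exists a, b.
by rewrite (cproj_coset h Nab) cproj_ciota.
Qed.

Section Ext.
Variables (Q : finGroupType).

Definition homQ (f : G -> Q) := forall x y, f (gmul x y) = f x * f y.

Lemma homQ1 f : homQ f -> f (gone G) = 1.
Proof. by move=> Hf; apply: (mulIg (f (gone G))); rewrite -Hf gmul1g mul1g. Qed.

Lemma homQV f x : homQ f -> f (ginv x) = (f x)^-1.
Proof. by move=> Hf; apply: (mulgI (f x)); rewrite -Hf gmulgV mulgV homQ1. Qed.

Lemma homQ_pow f x k : homQ f -> f (gpow x k) = f x ^+ k.
Proof. by move=> Hf; elim: k => [|k IH] /=; rewrite ?homQ1 // Hf IH expgS. Qed.

Lemma ker_fi_normal f : homQ f -> fi_normal (fun g => f g = 1).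
Proof.
move=> Hf; split.
- exact: homQ1.
- by move=> x y ex ey; rewrite Hf ex ey mulg1.
- by move=> x ex; rewrite homQV // ex invg1.
- by move=> g x ex; rewrite !Hf ex mul1g homQV // mulVg.
(* Coset representatives come from running through the finite group [Q] and keeping one preimage of
   each element that has one. *)
have H (s : seq Q) : exists l : list G, forall g, f g \in s ->
    exists2 h, List.In h l & f h = f g.
  elim: s => [|q s [l Hl]]; first by exists nil.
  case: (excluded_middle_informative (exists g, f g = q)) => [[g0 e]|ne].
    exists (cons g0 l) => g; rewrite inE => /orP[/eqP eg|/Hl[h lh e']].
      by exists g0; [left | rewrite e eg].
    by exists h => //; right.
  exists l => g; rewrite inE => /orP[/eqP eg|/Hl //].
  by case: ne; exists g.
have [l Hl] := H (enum Q); exists l => g.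
have [|h lh e] := Hl g; first by rewrite mem_enum.
by exists h => //; rewrite Hf homQV // e mulVg.
Qed.

Definition kerQ f (Hf : homQ f) : finorm G := exist _ _ (ker_fi_normal Hf).

(** Extension of [f] by continuity: any finite-index normal subgroup inside the kernel may be used
    to read off the value, and [cextE] shows that the choice does not matter. *)
Definition cext (f : G -> Q) (x : completion G) : Q :=
  epsilon (inhabits 1) (fun q => exists N : finorm G,
    (forall h, sval N h -> f h = 1) /\ exists g, cproj x N g /\ f g = q).

Lemma cextE f (Hf : homQ f) x (N : finorm G) g :
  (forall h, sval N h -> f h = 1) -> cproj x N g -> cext f x = f g.
Proof.
move=> kN xg.
have key (N' : finorm G) : (forall h, sval N' h -> f h = 1) ->
    forall g', cproj x N' g' -> cproj x (kerQ Hf) g'.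
  by move=> kN' g'; have [_ Hx] := proj2_sig x; apply: Hx.
have ex : exists q, exists N : finorm G,
    (forall h, sval N h -> f h = 1) /\ exists g, cproj x N g /\ f g = q.
  by exists (f g), N; split=> //; exists g.
rewrite /cext; have [N' [kN' [g' [xg' <-]]]] := epsilon_spec (inhabits 1) _ ex.
have /(cproj_coset g (key _ kN' _ xg')) := key _ kN _ xg.
by rewrite /= Hf homQV // => e; apply: (mulgI (f g')^-1); rewrite mulVg.
Qed.

Lemma cext_iota f g : homQ f -> cext f (ciota g) = f g.
Proof.
move=> Hf; apply: (@cextE _ Hf _ (kerQ Hf)) => //.
by rewrite cproj_ciota gmulVg; apply: homQ1.
Qed.

Lemma cextM f x y : homQ f -> cext f (cmul x y) = cext f x * cext f y.
Proof.
move=> Hf; have [a xa] := cproj_ex x (kerQ Hf); have [b yb] := cproj_ex y (kerQ Hf).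
rewrite (@cextE _ Hf x (kerQ Hf) a) // (@cextE _ Hf y (kerQ Hf) b) // -Hf.
by apply: (@cextE _ Hf _ (kerQ Hf)) => //; exists a, b.
Qed.

Lemma cext_cont f x y : forall Hf : homQ f,
  (forall g, cproj x (kerQ Hf) g <-> cproj y (kerQ Hf) g) -> cext f x = cext f y.
Proof.
move=> Hf e; have [a xa] := cproj_ex x (kerQ Hf).
by rewrite !(@cextE _ Hf _ (kerQ Hf) a) //; apply/e.
Qed.

(** Density of [G] in its completion: near [x] the map [k] depends on one coset only, and this coset
    contains an element of [G]. Continuity at the single point [x] is enough. *)
Lemma cext_uniq (k : completion G -> Q) x :
  homQ (fun g => k (ciota g)) ->
  (exists N : finorm G, forall y,
    (forall g, cproj x N g <-> cproj y N g) -> k x = k y) ->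
  cext (fun g => k (ciota g)) x = k x.
Proof.
move=> Hk [N HN]; have [N1 NM NV NJ] := fi_normalC N.
have [g xg] := cproj_ex x N.
have kxg h : cproj x N h -> k x = k (ciota h).
  move=> xh; apply: HN => g'.
  by rewrite (cproj_coset g' xh) cproj_ciota.
rewrite (kxg _ xg); apply: (cextE Hk _ xg) => h Nh.
have : k (ciota (gmul g h)) = k (ciota g).
  by rewrite -!kxg //; apply/(cproj_coset _ xg); rewrite gmulKg.
by rewrite Hk => e; apply: (mulgI (k (ciota g))); rewrite e mulg1.
Qed.

End Ext.
End Completion.

Section HomTransfer.
Variables (G H : group) (F : completion G -> completion H)
  (F' : completion H -> completion G).
Hypotheses (FM : forall x y z, cmul_rel x y z -> cmul_rel (F x) (F y) (F z))
  (FK : forall x, F' (F x) = x) (FK' : forall y, F (F' y) = y).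

Lemma F_mul x y : F (cmul x y) = cmul (F x) (F y).
Proof. by apply/cmulP/FM/cmulP. Qed.

Lemma F'_mul x y : F' (cmul x y) = cmul (F' x) (F' y).
Proof. by rewrite -(FK (cmul _ _)) F_mul !FK'. Qed.
End HomTransfer.

Definition hom_move (G H : group) (F' : completion H -> completion G)
  (Q : finGroupType) (f : G -> Q) : H -> Q := fun h => cext f (F' (ciota h)).

Lemma hom_moveM (G H : group) (F' : completion H -> completion G)
  (Q : finGroupType) (f : G -> Q) :
  (forall x y, F' (cmul x y) = cmul (F' x) (F' y)) -> homQ f ->
  homQ (hom_move F' f).
Proof.
by move=> FM Hf x y; rewrite /hom_move ciotaM FM cextM.
Qed.

(** The extension of [hom_move F' f] is [cext f] composed with [F'], by [cext_uniq]; composing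
    further with [F] cancels [F']. *)
Lemma hom_moveK (G H : group) F F' (Q : finGroupType) (f : G -> Q) :
  (forall x y, F' (cmul x y) = cmul (F' x) (F' y)) ->
  (forall x, F' (F x) = x) -> @ccontinuous H G F' -> homQ f ->
  hom_move F (hom_move F' f) = f.
Proof.
move=> FM FK Fc Hf; apply: functional_extensionality => g.
rewrite /hom_move.
rewrite (@cext_uniq _ _ (fun y => cext f (F' y))).
- by rewrite FK cext_iota.
- exact: hom_moveM.
have [N HN] := Fc (F (ciota g)) (kerQ Hf); exists N => y /HN e.
exact: (@cext_cont _ _ _ _ _ Hf).
Qed.

Lemma hom_move_nat (G H : group) (F' : completion H -> completion G)
  (Q Q' : finGroupType) (h : Q -> Q') (f : G -> Q) :
  {morph h : x y / x * y} -> homQ f ->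
  hom_move F' (fun x => h (f x)) = fun y => h (hom_move F' f y).
Proof.
move=> Hh Hf; apply: functional_extensionality => y; rewrite /hom_move.
have Hhf : homQ (fun x => h (f x)) by move=> a b; rewrite Hf Hh.
have [a xa] := cproj_ex (F' (ciota y)) (kerQ Hf).
rewrite !(@cextE _ _ _ _ _ (kerQ Hf) a) //= => b ->.
by apply: (mulgI (h 1)); rewrite -Hh !mulg1.
Qed.

(** * Coxeter tuples in finite groups and their natural bijections *)

Definition cox_tuple (D : coxgraph) (Q : finGroupType) (t : {ffun cv D -> Q}) :=
  [forall v, t v * t v == 1] &&
  [forall v, forall w, cedge v w ==> ((t v * t w) ^+ clab v w == 1)].

Lemma cox_tupleP (D : coxgraph) (Q : finGroupType) (t : {ffun cv D -> Q}) :
  reflect ((forall v, t v * t v = 1) /\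
           (forall v w, cedge v w -> (t v * t w) ^+ clab v w = 1)) (cox_tuple t).
Proof.
apply: (iffP andP) => [[/forallP H1 /forallP H2]|[H1 H2]].
  split=> [v|v w vw]; first exact/eqP.
  by have /forallP/(_ w)/implyP/(_ vw)/eqP := H2 v.
split; apply/forallP => v; first exact/eqP.
by apply/forallP => w; apply/implyP => vw; apply/eqP/H2.
Qed.

Lemma gpow_fgroup (Q : finGroupType) (x : fgroup Q) k : gpow x k = (x : Q) ^+ k.
Proof. by elim: k => //= k ->; rewrite expgS. Qed.

Lemma cox_tuple_rels (D : coxgraph) (Q : finGroupType) (t : {ffun cv D -> Q}) :
  cox_tuple t <-> @cox_rels D (fgroup Q) t.
Proof.
split=> [/cox_tupleP[H1 H2]|[H1 H2]]; last apply/cox_tupleP; split=> // v w /H2;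
 by rewrite gpow_fgroup.
Qed.

(** All that the rigidity argument retains of a profinite isomorphism. The topology is gone;
    naturality in [Q] is what makes liftings comparable. *)
Record tuple_equiv (D E : coxgraph) := TupleEquiv {
  tmap : forall Q : finGroupType, {ffun cv D -> Q} -> {ffun cv E -> Q};
  tinv : forall Q : finGroupType, {ffun cv E -> Q} -> {ffun cv D -> Q};
  tmapP : forall Q t, cox_tuple t -> cox_tuple (@tmap Q t);
  tinvP : forall Q t, cox_tuple t -> cox_tuple (@tinv Q t);
  tmapK : forall Q t, cox_tuple t -> tinv (@tmap Q t) = t;
  tinvK : forall Q t, cox_tuple t -> tmap (@tinv Q t) = t;
  tmap_nat : forall (Q Q' : finGroupType) (h : Q -> Q') (t : {ffun cv D -> Q}),
    {morph h : x y / x * y} -> cox_tuple t ->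
    tmap [ffun v => h (t v)] = [ffun v => h (tmap t v)]
}.

Section Present.
Variables (D : coxgraph) (G : group) (s : cv D -> G).
Hypotheses (Hs : cox_rels s) (Us : forall (H : group) (t : cv D -> H), cox_rels t ->
      exists! f : G -> H, is_hom f /\ forall v, f (s v) = t v).

Definition tuple_of_hom (Q : finGroupType) (f : G -> Q) : {ffun cv D -> Q} :=
  [ffun v => f (s v)].

Definition hom_of_tuple (Q : finGroupType) (t : {ffun cv D -> Q}) : G -> Q :=
  epsilon (inhabits (fun=> 1)) (fun f => homQ f /\ forall v, f (s v) = t v).

Lemma tuple_of_homP (Q : finGroupType) (f : G -> Q) : homQ f -> cox_tuple (tuple_of_hom f).
Proof.
move=> Hf; case: Hs => H1 H2; apply/cox_tupleP; split=> [v|v w /H2 e].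
  by rewrite ffunE -Hf H1 homQ1.
by rewrite !ffunE -Hf -homQ_pow // e homQ1.
Qed.

Lemma hom_of_tupleP (Q : finGroupType) (t : {ffun cv D -> Q}) : cox_tuple t ->
  homQ (hom_of_tuple t) /\ forall v, hom_of_tuple t (s v) = t v.
Proof.
move=> /cox_tuple_rels/Us[f [Hf _]].
by apply: (epsilon_spec _ (fun f => homQ f /\ forall v, f (s v) = t v)); exists f.
Qed.

Lemma hom_of_tupleK (Q : finGroupType) (t : {ffun cv D -> Q}) : cox_tuple t ->
  tuple_of_hom (hom_of_tuple t) = t.
Proof. by case/hom_of_tupleP=> _ e; apply/ffunP => v; rewrite ffunE e. Qed.

Lemma hom_eq (Q : finGroupType) (f f' : G -> Q) : homQ f -> homQ f' ->
  (forall v, f (s v) = f' (s v)) -> f = f'.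
Proof.
move=> Hf Hf' e.
have /cox_tuple_rels/Us[f0 [_ U]] := tuple_of_homP Hf.
by transitivity f0; [apply: esym|]; apply: U; split=> // v; rewrite ffunE.
Qed.

Lemma tuple_of_homK (Q : finGroupType) (f : G -> Q) : homQ f -> hom_of_tuple (tuple_of_hom f) = f.
Proof.
move=> Hf; have [Hh e] := hom_of_tupleP (tuple_of_homP Hf).
by apply: hom_eq => // v; rewrite e ffunE.
Qed.

End Present.

Lemma profinite_tuple_equiv (D E : coxgraph) (G H : group) :
  is_coxeter_group_of D G -> is_coxeter_group_of E H -> profinite_iso G H ->
  inhabited (tuple_equiv D E).
Proof.
case=> [s [Hs Us]] [u [Hu Uu]] [F [FM [Fc [F' [FK [FK' Fc']]]]]].
have F1 := F_mul FM; have F2 := F'_mul FM FK FK'.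
split; apply: (@TupleEquiv D E
  (fun Q t => tuple_of_hom u (hom_move F' (hom_of_tuple s t)))
  (fun Q t => tuple_of_hom s (hom_move F (hom_of_tuple u t)))).
- move=> Q t /(hom_of_tupleP Us)[Ht _].
  by apply: (tuple_of_homP Hu); apply: hom_moveM.
- move=> Q t /(hom_of_tupleP Uu)[Ht _].
  by apply: (tuple_of_homP Hs); apply: hom_moveM.
- move=> Q t Ht; have [Hf _] := hom_of_tupleP Us Ht.
  rewrite (tuple_of_homK Hu Uu) ?hom_moveK ?hom_of_tupleK //.
  exact: hom_moveM.
- move=> Q t Ht; have [Hf _] := hom_of_tupleP Uu Ht.
  rewrite (tuple_of_homK Hs Us) ?hom_moveK ?hom_of_tupleK //.
  exact: hom_moveM.
move=> Q Q' h t Hh Ht; have [Hf e] := hom_of_tupleP Us Ht.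
have Hhf : homQ (fun x => h (hom_of_tuple s t x)) by move=> a b; rewrite Hf Hh.
have -> : hom_of_tuple s [ffun v => h (t v)] = fun x => h (hom_of_tuple s t x).
  rewrite -(tuple_of_homK Hs Us Hhf); congr hom_of_tuple.
  by apply/ffunP => v; rewrite !ffunE e.
by rewrite hom_move_nat //; apply/ffunP => v; rewrite !ffunE.
Qed.

Definition fcomp (T : finType) (A B : Type) (h : A -> B) (t : {ffun T -> A}) :
  {ffun T -> B} := [ffun v => h (t v)].

Lemma leq_card_inj_on (T U : finType) (A : {pred T}) (B : {pred U}) (f : T -> U) :
  {in A, forall x, f x \in B} -> {in A &, injective f} -> #|A| <= #|B|.
Proof.
move=> fAB finj; rewrite -(card_in_image finj); apply/subset_leq_card/subsetP.
by move=> y /imageP[x xA ->]; apply: fAB.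
Qed.

Lemma morph1P (Q Q' : finGroupType) (h : Q -> Q') : {morph h : x y / x * y} -> h 1 = 1.
Proof. by move=> Hh; apply: (mulgI (h 1)); rewrite -Hh !mulg1. Qed.

Lemma morphXP (Q Q' : finGroupType) (h : Q -> Q') x k :
  {morph h : x y / x * y} -> h (x ^+ k) = h x ^+ k.
Proof.
by move=> Hh; elim: k => [|k IH]; rewrite ?morph1P // !expgS Hh IH.
Qed.

Lemma cox_tuple_fcomp (D : coxgraph) (Q Q' : finGroupType) (h : Q -> Q')
  (t : {ffun cv D -> Q}) : {morph h : x y / x * y} -> cox_tuple t ->
  cox_tuple (fcomp h t).
Proof.
move=> Hh /cox_tupleP[H1 H2]; apply/cox_tupleP; split=> [v|v w vw].
  by rewrite ffunE -Hh H1 morph1P.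
by rewrite !ffunE -Hh -morphXP // H2 // morph1P.
Qed.

Section TupleEquiv.
Variables (D E : coxgraph) (te : tuple_equiv D E).

Lemma tinv_nat (Q Q' : finGroupType) (h : Q -> Q') (t : {ffun cv E -> Q}) :
  {morph h : x y / x * y} -> cox_tuple t ->
  tinv te (fcomp h t) = fcomp h (tinv te t).
Proof.
move=> Hh Ht; rewrite -{1}(tinvK te Ht) /fcomp -tmap_nat ?tinvP //.
by rewrite tmapK //; apply: cox_tuple_fcomp => //; apply: tinvP.
Qed.

Definition tuple_equiv_sym : tuple_equiv E D :=
  TupleEquiv (@tinvP _ _ te) (@tmapP _ _ te) (@tinvK _ _ te) (@tmapK _ _ te) tinv_nat.

Lemma tmap_inj (Q : finGroupType) :
  {in [pred t : {ffun cv D -> Q} | cox_tuple t] &, injective (@tmap D E te Q)}.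
Proof. by move=> t t' Ht Ht' /(congr1 (@tinv _ _ te Q)); rewrite !tmapK. Qed.

Lemma leq_card_tuples (Q : finGroupType) :
  #|[pred t : {ffun cv D -> Q} | cox_tuple t]| <=
  #|[pred t : {ffun cv E -> Q} | cox_tuple t]|.
Proof.
by apply: (leq_card_inj_on (f := @tmap D E te Q)) (@tmap_inj Q) => t; apply: tmapP.
Qed.

Lemma leq_card_lifts (Q Q' : finGroupType) (h : Q -> Q') (phi : {ffun cv D -> Q'}) :
  {morph h : x y / x * y} ->
  #|[pred t : {ffun cv D -> Q} | cox_tuple t & fcomp h t == phi]| <=
  #|[pred t : {ffun cv E -> Q} | cox_tuple t & fcomp h t == tmap te phi]|.
Proof.
move=> Hh; apply: (leq_card_inj_on (f := @tmap D E te Q)) => [t|t t'].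
  by case/andP=> Ht /eqP <-; rewrite inE tmapP //= /fcomp tmap_nat.
by case/andP=> Ht _ /andP[Ht' _]; apply: tmap_inj.
Qed.

(** By naturality the bijection for [Q'] respects the tuples that come from [Q]. This count can
    separate diagrams with equally many tuples in [Q']. *)
Lemma leq_card_liftable (Q Q' : finGroupType) (h : Q -> Q') :
  {morph h : x y / x * y} ->
  #|[pred phi : {ffun cv D -> Q'} | [exists t, cox_tuple t && (fcomp h t == phi)]]| <=
  #|[pred phi : {ffun cv E -> Q'} | [exists t, cox_tuple t && (fcomp h t == phi)]]|.
Proof.
move=> Hh; apply: (leq_card_inj_on (f := @tmap D E te Q')).
  move=> phi /existsP[t /andP[Ht /eqP <-]]; apply/existsP; exists (tmap te t).
  by rewrite tmapP //= /fcomp tmap_nat.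
move=> phi phi' /existsP[t /andP[Ht /eqP <-]] /existsP[t' /andP[Ht' /eqP <-]].
by apply: tmap_inj; apply: cox_tuple_fcomp.
Qed.

End TupleEquiv.

Lemma card_tuples (D E : coxgraph) (te : tuple_equiv D E) (Q : finGroupType) :
  #|[pred t : {ffun cv D -> Q} | cox_tuple t]| =
  #|[pred t : {ffun cv E -> Q} | cox_tuple t]|.
Proof.
by apply/eqP; rewrite eqn_leq leq_card_tuples // (leq_card_tuples (tuple_equiv_sym te)).
Qed.

Lemma card_liftable (D E : coxgraph) (te : tuple_equiv D E) (Q Q' : finGroupType)
  (h : Q -> Q') : {morph h : x y / x * y} ->
  #|[pred phi : {ffun cv D -> Q'} | [exists t, cox_tuple t && (fcomp h t == phi)]]| =
  #|[pred phi : {ffun cv E -> Q'} | [exists t, cox_tuple t && (fcomp h t == phi)]]|.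
Proof.
move=> Hh; apply/eqP; rewrite eqn_leq leq_card_liftable //.
by rewrite (leq_card_liftable (tuple_equiv_sym te)).
Qed.

Lemma card_lifts (D E : coxgraph) (te : tuple_equiv D E) (Q Q' : finGroupType)
  (h : Q -> Q') (phi : {ffun cv D -> Q'}) : {morph h : x y / x * y} ->
  cox_tuple phi ->
  #|[pred t : {ffun cv D -> Q} | cox_tuple t & fcomp h t == phi]| =
  #|[pred t : {ffun cv E -> Q} | cox_tuple t & fcomp h t == tmap te phi]|.
Proof.
move=> Hh Hphi; apply/eqP; rewrite eqn_leq leq_card_lifts //=.
by have := leq_card_lifts (tuple_equiv_sym te) (tmap te phi) Hh; rewrite /= tmapK.
Qed.

(** * Diagram isomorphisms and changes of presentation *)

Definition cox_iso (D E : coxgraph) (k : cv D -> cv E) :=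
  [/\ bijective k, (forall u v, cedge (k u) (k v) = cedge u v) &
      (forall u v, cedge u v -> clab (k u) (k v) = clab u v)].

Lemma cox_iso_inv (D E : coxgraph) (k : cv D -> cv E) :
  cox_iso k -> exists k', @cox_iso E D k'.
Proof.
case=> [[k' kK kK'] ke kl]; exists k'; split; first by exists k.
  by move=> u v; rewrite -ke !kK'.
by move=> u v uv; rewrite -kl ?kK' // -ke !kK'.
Qed.

(** Mutually inverse substitutions between the generators of two presentations, natural in the group
    like words in the generators. Diagram twists have this form without being diagram
    isomorphisms. *)
Definition tuple_change (D E : coxgraph)
  (a : forall G : group, (cv D -> G) -> cv E -> G)
  (b : forall G : group, (cv E -> G) -> cv D -> G) :=
  [/\ (forall G t, cox_rels t -> cox_rels (a G t)),
      (forall G t, cox_rels t -> cox_rels (b G t)),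
      (forall G t, cox_rels t -> forall v, b G (a G t) v = t v),
      (forall G t, cox_rels t -> forall v, a G (b G t) v = t v) &
      (forall (G H : group) (f : G -> H) t, is_hom f -> cox_rels t ->
         forall v, a H (fun w => f (t w)) v = f (a G t v))].

Lemma is_hom1 (G H : group) (f : G -> H) : is_hom f -> f (gone G) = gone H.
Proof.
move=> Hf; have e := Hf (gone G) (gone G); rewrite gmul1g in e.
by rewrite -(gmulKg (f (gone G)) (f (gone G))) -e gmulVg.
Qed.

Lemma is_homV (G H : group) (f : G -> H) x : is_hom f -> f (ginv x) = ginv (f x).
Proof.
by move=> Hf; apply: ginv_uniq; rewrite -Hf gmulgV is_hom1.
Qed.

Lemma is_homX (G H : group) (f : G -> H) x k : is_hom f -> f (gpow x k) = gpow (f x) k.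
Proof.
by move=> Hf; elim: k => [|k IH] /=; rewrite ?is_hom1 // Hf IH.
Qed.

Lemma cox_rels_hom (D : coxgraph) (G H : group) (f : G -> H) (t : cv D -> G) :
  is_hom f -> cox_rels t -> cox_rels (fun v => f (t v)).
Proof.
move=> Hf [H1 H2]; split=> [v|v w vw]; first by rewrite -Hf H1 is_hom1.
by rewrite -Hf -is_homX // H2 // is_hom1.
Qed.

Lemma tuple_change_coxeter (D E : coxgraph) a b (G : group) : @tuple_change D E a b ->
  is_coxeter_group_of D G -> is_coxeter_group_of E G.
Proof.
case=> [aP bP baK abK anat] [s [Hs Us]]; exists (a G s); split=> [|H t Ht].
  exact: aP.
have [f [[Hf fs] U]] := Us H (b H t) (bP _ _ Ht).
have efs : (fun w => f (s w)) = b H t by apply: functional_extensionality.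
exists f; split.
  by split=> // v; rewrite -anat // efs abK.
move=> f' [Hf' fs']; apply: U; split=> // v.
have Hfs : cox_rels (fun w => f' (s w)) by apply: cox_rels_hom.
rewrite -(baK _ _ Hfs); congr (b H _ v).
by apply: functional_extensionality => w; rewrite anat.
Qed.

Lemma cox_iso_coxeter (D E : coxgraph) (k : cv D -> cv E) (G : group) : cox_iso k ->
  is_coxeter_group_of D G -> is_coxeter_group_of E G.
Proof.
move=> Hk; case: (Hk) => [[k' kK kK'] ke kl].
apply: (@tuple_change_coxeter _ _ (fun _ t v => t (k' v)) (fun _ t v => t (k v))).
split=> // {G}.
- move=> G t [H1 H2]; split=> // v w; rewrite -{1}(kK' v) -{1}(kK' w) ke => vw.
  by rewrite -(kK' v) -(kK' w) kl // !kK H2.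
- by move=> G t [H1 H2]; split=> // v w vw; rewrite -kl // H2 // ke.
- by move=> G t _ v; rewrite kK.
by move=> G t _ v; rewrite kK'.
Qed.

Lemma coxeter_group_uniq (D : coxgraph) (G H : group) :
  is_coxeter_group_of D G -> is_coxeter_group_of D H -> group_iso G H.
Proof.
case=> [s [Hs Us]] [u [Hu Uu]].
have [f [[Hf fs] _]] := Us H u Hu; have [g [[Hg gu] _]] := Uu G s Hs.
have idP (K : group) (r : cv D -> K) (k : K -> K) : cox_rels r ->
    (forall (L : group) (t : cv D -> L), cox_rels t ->
      exists! f : K -> L, is_hom f /\ forall v, f (r v) = t v) ->
    is_hom k -> (forall v, k (r v) = r v) -> forall x, k x = x.
  move=> Hr Ur Hk kr x; have [k0 [_ U]] := Ur _ _ Hr.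
  by rewrite -(U k) // (U (fun x => x)).
exists f; split=> //; exists g; split.
  apply: (idP G s (fun x => g (f x))) => //; first by move=> x y; rewrite Hf Hg.
  by move=> v; rewrite fs gu.
apply: (idP H u (fun x => f (g x))) => //; first by move=> x y; rewrite Hg Hf.
by move=> v; rewrite gu fs.
Qed.

Local Close Scope group_scope.
Import GRing.Theory.

(** * The reflection representation over a finite field *)

(** For a prime l > n, Euler's theorem gives n | l^phi(n) - 1, which is the order of the cyclic unit
    group of the field with l^phi(n) elements. *)
Lemma finField_prim_root (n : nat) : 0 < n ->
  exists (F : finFieldType) (z : F), n.-primitive_root%R z.
Proof.
move=> n_gt0; have [l l_gt l_pr] := prime_above n.
have cop : coprime l n.
  by rewrite prime_coprime // gtnNdvd.
have k_gt0 : 0 < totient n by rewrite totient_gt0.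
have [F _ cardF] := PrimePowerField l_pr k_gt0.
have F_gt0 : 0 < #|F| by rewrite cardF expn_gt0 prime_gt0.
have dvn : n %| #|F|.-1.
  have := Euler_exp_totient cop; rewrite -cardF => /eqP.
  rewrite -[X in X == _ %[mod _]](prednK F_gt0) -addn1 -[X in _ == X %[mod _]]add0n.
  by rewrite eqn_modDr mod0n.
have F_gt1 : 0 < #|F|.-1.
  rewrite -subn1 subn_gt0 cardF; apply: leq_trans (prime_gt1 l_pr) _.
  by rewrite -{1}(expn1 l) leq_exp2l ?prime_gt1.
pose rs := [seq x <- enum F | x != 0%R].
have : has (#|F|.-1).-primitive_root%R rs.
  apply: has_prim_root => //.
  - apply/allP => x; rewrite mem_filter => /andP[x0 _].
    rewrite unity_rootE; apply/eqP/(mulfI x0).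
    by rewrite -exprS prednK ?expf_card ?mulr1.
  - by rewrite filter_uniq // enum_uniq.
  rewrite -(cardC1 (0 : F)%R) cardE /rs; apply: eq_leq; congr size.
  by rewrite enumT /enum_mem; apply: eq_filter.
by case/hasP=> x _ px; exists F, (x ^+ (#|F|.-1 %/ n))%R; apply: dvdn_prim_root.
Qed.

Section Reflections.
Local Open Scope ring_scope.
Variables (F : finFieldType) (V : finType) (z : V -> V -> F).
Hypotheses (z_sym : forall u v, z u v = z v u) (z0 : forall u v, z u v != 0)
  (z2 : forall u v, z u v ^+ 2 != 1).

(** Finite-field form of the Tits form: for z = exp(i pi / m) the entry would be -2 cos(pi / m). *)
Let c (u v : V) : F := if u == v then 2 else - (z u v + (z u v)^-1).
Local Notation L := {ffun V -> F^o}.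
Let B (x : L) (w : V) : F := \sum_v x v * c v w.
Let e (w : V) : L := [ffun v => ((v == w)%:R : F^o)].
Let refl (w : V) (x : L) : L := x - B x w *: e w.

Let c_sym u v : c u v = c v u.
Proof. by rewrite /c eq_sym z_sym. Qed.

Let B_lin (a : F) (x y : L) w : B (a *: x + y) w = a * B x w + B y w.
Proof.
rewrite /B mulr_sumr -big_split; apply: eq_bigr => v _ /=.
by rewrite !ffunE mulrDl mulrA.
Qed.

Let B_e u w : B (e u) w = c u w.
Proof.
rewrite /B (bigD1 u) //= big1 ?addr0 => [|v /negPf vu].
  by rewrite ffunE eqxx mul1r.
by rewrite ffunE vu mul0r.
Qed.

Let B_sub x y w : B (x - y) w = B x w - B y w.
Proof. by rewrite -[x - y]addrC -scaleN1r B_lin mulN1r addrC. Qed.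

Let B_scale a x w : B (a *: x) w = a * B x w.
Proof.
have B0 : B 0 w = 0 by rewrite /B big1 // => v _; rewrite ffunE mul0r.
by rewrite -[a *: x]addr0 B_lin B0 addr0.
Qed.

Let refl_lin w a x y : refl w (a *: x + y) = a *: refl w x + refl w y.
Proof.
rewrite /refl B_lin scalerDl scalerBr scalerA opprD !addrA; congr (_ - _).
by rewrite addrAC.
Qed.

Let reflK w : involutive (refl w).
Proof.
move=> x; rewrite {1}/refl {2}/refl B_sub B_scale B_e /c eqxx.
rewrite /refl -addrA -opprD -scalerDl.
have -> : B x w + (B x w - B x w * 2) = 0 by ring.
by rewrite scale0r subr0.
Qed.

Let s (w : V) : {perm L} := perm (can_inj (reflK w)).

Let s2 w : (s w * s w = 1)%g.
Proof. by apply/permP => x; rewrite permM !permE reflK. Qed.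

Section Pair.
Variables (u v : V).
Hypothesis uv : u != v.
Let Z := z u v.
Let T (x : L) := refl v (refl u x).

Let T_lin a x y : T (a *: x + y) = a *: T x + T y.
Proof. by rewrite /T !refl_lin. Qed.

Let Tk_lin k a x y : iter k T (a *: x + y) = a *: iter k T x + iter k T y.
Proof. by elim: k => //= k ->; rewrite T_lin. Qed.

Let cuv : c u v = - (Z + Z^-1).
Proof. by rewrite /c (negPf uv). Qed.
Let cuu w : c w w = 2. Proof. by rewrite /c eqxx. Qed.

Let T_e a b : T (a *: e v + b *: e u) =
  ((c u v ^+ 2 - 1) * a + c u v * b) *: e v + (- c u v * a - b) *: e u.
Proof.
rewrite /T; set x := a *: e v + b *: e u.
have -> : refl u x = a *: e v + (- c u v * a - b) *: e u.
  rewrite /refl /x B_lin B_scale !B_e cuu (c_sym v u) -addrA -scalerBl.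
  by congr (_ + _ *: _); ring.
rewrite /refl B_lin B_scale !B_e cuu addrAC -scalerBl.
by congr (_ *: _ + _); ring.
Qed.

Let Zn0 : Z != 0. Proof. exact: z0. Qed.
Let Zd : Z - Z^-1 != 0.
Proof.
rewrite subr_eq0; apply: contra (z2 u v) => /eqP e'; apply/eqP.
by rewrite expr2 -/Z {2}e' divff.
Qed.

(** On the plane of [e u] and [e v] the map [T] has eigenvalues Z^2 and Z^-2; the coefficients are
    the quantum integers [2k+1] and [2k]. *)
Let Tk_ev k : iter k T (e v) =
  ((Z * Z ^+ k.*2 - Z^-1 * Z^-1 ^+ k.*2) / (Z - Z^-1)) *: e v +
  ((Z ^+ k.*2 - Z^-1 ^+ k.*2) / (Z - Z^-1)) *: e u.
Proof.
elim: k => [|k IH] /=.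
  by rewrite !expr0 !mulr1 divff // subrr mul0r scale1r scale0r addr0.
rewrite IH T_e cuv doubleS !exprS; move: (Z ^+ _) (_^-1 ^+ _) => P P'.
have Zd' : Z ^+ 2 - 1 != 0 by rewrite subr_eq0 z2.
by congr (_ *: _ + _ *: _); field; rewrite Zn0.
Qed.

Let Tk_eu k : iter k T (e u) =
  (- (Z ^+ k.*2 - Z^-1 ^+ k.*2) / (Z - Z^-1)) *: e v +
  ((Z * Z^-1 ^+ k.*2 - Z^-1 * Z ^+ k.*2) / (Z - Z^-1)) *: e u.
Proof.
elim: k => [|k IH] /=.
  by rewrite !expr0 !mulr1 divff // subrr oppr0 mul0r scale1r scale0r add0r.
rewrite IH T_e cuv doubleS !exprS; move: (Z ^+ _) (_^-1 ^+ _) => P P'.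
have Zd' : Z ^+ 2 - 1 != 0 by rewrite subr_eq0 z2.
by congr (_ *: _ + _ *: _); field; rewrite Zn0.
Qed.

Let s_iter k (x : L) : ((s u * s v) ^+ k)%g x = iter k T x.
Proof. by rewrite permX; apply: eq_iter => y; rewrite permM !permE. Qed.

(** The closed formulas settle the plane of [e u] and [e v]. The form is nondegenerate there, so
    every vector is the sum of one in the plane and one orthogonal to it, which both reflections
    fix. *)
Lemma refl_pair_order m : Z ^+ m.*2 = 1 -> ((s u * s v) ^+ m = 1)%g.
Proof.
move=> Zm; have Zm' : Z^-1 ^+ m.*2 = 1 by rewrite exprVn Zm invr1.
have ev : iter m T (e v) = e v.
  by rewrite Tk_ev Zm Zm' !mulr1 divff // subrr mul0r scale1r scale0r addr0.
have eu : iter m T (e u) = e u.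
  by rewrite Tk_eu Zm Zm' !mulr1 divff // subrr oppr0 mul0r scale1r scale0r add0r.
apply/permP => x; rewrite s_iter perm1.
(* Gram determinant of [e u], [e v] is [4 - c^2 = - (Z - Z^-1)^2] *)
pose d := - (Z - Z^-1) ^+ 2.
have d0 : d != 0 by rewrite oppr_eq0 expf_neq0.
pose b := (2 * B x u - c u v * B x v) / d.
pose a := (2 * B x v - c u v * B x u) / d.
pose x0 := x - (a *: e v + b *: e u).
have -> : x = a *: e v + (b *: e u + x0).
  by rewrite /x0 addrA addrC subrK.
rewrite !Tk_lin ev eu; congr (_ + (_ + _)).
have B0u : B x0 u = 0.
  rewrite /x0 B_sub B_lin B_scale !B_e (c_sym v u) cuu /a /b cuv /d.
  have Zd' : Z ^+ 2 - 1 != 0 by rewrite subr_eq0 z2.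
  by field; rewrite Zn0 oppr_eq0 expf_neq0.
have B0v : B x0 v = 0.
  rewrite /x0 B_sub B_lin B_scale !B_e cuu /a /b cuv /d.
  have Zd' : Z ^+ 2 - 1 != 0 by rewrite subr_eq0 z2.
  by field; rewrite Zn0 oppr_eq0 expf_neq0.
have Tx0 : T x0 = x0 by rewrite /T /refl B0u scale0r subr0 B0v scale0r subr0.
by elim: (m) => [|k /= ->].
Qed.

(** The coefficient of [e u] gives Z^(2n) = Z^(-2n), after which the coefficient of [e v] collapses
    to Z^(2n). *)
Lemma refl_pair_dvd n : ((s u * s v) ^+ n = 1)%g -> Z ^+ n.*2 = 1.
Proof.
move=> /permP/(_ (e v)); rewrite s_iter perm1 Tk_ev => E.
have Eu := congr1 (fun f : L => f u) E; have Ev := congr1 (fun f : L => f v) E.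
rewrite !ffunE ?eqxx (eq_sym v u) (negPf uv) in Eu Ev.
rewrite /GRing.scale /= !mulr1 !mulr0 add0r addr0 in Eu Ev.
have ZZ : Z ^+ n.*2 = Z^-1 ^+ n.*2.
  move/eqP: Eu; rewrite mulf_eq0 invr_eq0 (negPf Zd) orbF subr_eq0.
  by move/eqP.
by move: Ev; rewrite -ZZ -mulrBl mulrAC divff // mul1r.
Qed.

End Pair.

Lemma reflection_tuple : exists t : V -> {perm L},
  (forall w, (t w * t w = 1)%g) /\
  (forall u v m, u != v -> ((t u * t v) ^+ m == 1)%g = (z u v ^+ m.*2 == 1)).
Proof.
exists s; split=> // u v m uv; apply/eqP/eqP; first exact: refl_pair_dvd.
exact: refl_pair_order.
Qed.

End Reflections.

Lemma coxeter_tuple_faithful (D : coxgraph) (n : nat) :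
  exists (Q : finGroupType) (t : {ffun cv D -> Q}), cox_tuple t /\
    forall u v k, u != v -> 0 < k <= n -> ((t u * t v) ^+ k)%g = 1%g ->
      cedge u v /\ clab u v %| k.
Proof.
pose l u v := if @cedge D u v then clab u v else 1.
(* A common multiple of all labels, so that powers of one root of unity of order 2M serve every
   pair, and larger than [n], so that non-edges given order [M] show no relation up to exponent
   [n]. *)
pose M := (n.+2 * \prod_u \prod_v l u v)%N.
have l_gt0 u v : 0 < l u v.
  by rewrite /l; case: ifP => // /clab_ge2 /ltnW.
have P_gt0 : 0 < \prod_u \prod_v l u v.
  by apply: prodn_gt0 => u; apply: prodn_gt0.
have M_gt : n.+1 < M by rewrite -(muln1 n.+2) leq_mul2l P_gt0.
have M_gt0 : 0 < M by exact: leq_ltn_trans M_gt.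
pose m u v := if @cedge D u v then clab u v else M.
have m_dvd u v : m u v %| M.
  rewrite /m; case: ifP => // uv; rewrite /M (bigD1 u) //= (bigD1 v) //= {1}/l uv.
  by rewrite -mulnA dvdn_mull // dvdn_mulr.
have m_ge2 u v : 1 < m u v.
  by rewrite /m; case: ifP => [/clab_ge2 //|_]; apply: leq_trans M_gt.
have M2_gt0 : 0 < M.*2 by rewrite double_gt0.
have [F [x px]] := finField_prim_root M2_gt0.
pose z u v : F := (x ^+ (M.*2 %/ (m u v).*2))%R.
have pz u v : ((m u v).*2).-primitive_root%R (z u v).
  by apply: (dvdn_prim_root px); rewrite -!muln2 dvdn_pmul2r.
have z_sym u v : z u v = z v u by rewrite /z /m cedge_sym clab_sym.
have z0 u v : (z u v != 0)%R.
  by rewrite (prim_root_eq0 (pz u v)) double_eq0 -lt0n ltnW.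
have zX u v k : (z u v ^+ k.*2 == 1)%R = (m u v %| k).
  by rewrite -(prim_order_dvd (pz u v)) -!muln2 dvdn_pmul2r.
have z2 u v : (z u v ^+ 2 != 1)%R.
  by rewrite (zX u v 1) dvdn1 neq_ltn m_ge2 orbT.
have [t [t2 tX]] := reflection_tuple z_sym z0 z2.
exists {perm {ffun cv D -> F^o}}, (finfun t); split.
  apply/cox_tupleP; split=> [v|u v uv]; first by rewrite ffunE t2.
  have nuv : u != v by apply: contraL uv => /eqP ->; rewrite cedge_irr.
  by apply/eqP; rewrite !ffunE tX // zX /m uv.
move=> u v k uv /andP[k_gt0 k_le] /eqP; rewrite !ffunE tX // zX /m.
case: ifP => // _ /(dvdn_leq k_gt0) Mk.
by have := leq_trans M_gt (leq_trans Mk k_le); rewrite ltnNge leqnSn.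
Qed.

(** * Collapsing a diagram onto one with constant label *)

Lemma collapse_iso (D E : coxgraph) (te : tuple_equiv D E) (n : nat)
  (k : cv D -> cv E) :
  2 <= n -> (forall i j : cv E, cedge i j -> clab i j = n) ->
  (forall i, exists u, k u = i) ->
  (forall u v, cedge u v -> k u = k v \/ cedge (k u) (k v) /\ n %| clab u v) ->
  cox_iso k.
Proof.
move=> n_ge2 En k_surj kP.
pose pull (Q : finGroupType) (t : {ffun cv E -> Q}) : {ffun cv D -> Q} :=
  [ffun u => t (k u)].
have pullP (Q : finGroupType) (t : {ffun cv E -> Q}) : cox_tuple t -> cox_tuple (pull Q t).
  move=> /cox_tupleP[H1 H2]; apply/cox_tupleP; split=> [u|u v uv]; rewrite !ffunE //.
  have [->|[e /dvdnP[q ->]]] := kP _ _ uv; first by rewrite H1 expg1n.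
  by rewrite mulnC expgM -(En _ _ e) H2 // expg1n.
have pull_inj (Q : finGroupType) : injective (@pull Q).
  move=> t t' /ffunP e; apply/ffunP => i; have [u <-] := k_surj i.
  by have := e u; rewrite !ffunE.
have factor (Q : finGroupType) (t : {ffun cv D -> Q}) : cox_tuple t ->
    exists2 t', cox_tuple t' & t = pull Q t'.
  move=> Ht.
  have sub : [set pull Q t' | t' in [pred t' | cox_tuple t']] \subset
      [pred t : {ffun cv D -> Q} | cox_tuple t].
    by apply/subsetP => _ /imsetP[t' Ht' ->]; apply: pullP.
  have /subset_cardP/(_ sub)/(_ t) :
      #|[set pull Q t' | t' in [pred t' | cox_tuple t']]| =
      #|[pred t : {ffun cv D -> Q} | cox_tuple t]|.
    by rewrite (card_imset _ (@pull_inj Q)) (card_tuples te).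
  by rewrite [in RHS]inE Ht => /imsetP[t' Ht' ->]; exists t'.
(* One faithful tuple is tested twice: exponent 1 gives injectivity of [k], exponent [n] gives the
   edges and the divisibility of their labels. *)
have [Q [t [Ht tP]]] := coxeter_tuple_faithful D n.
have [t' Ht' tE] := factor Q t Ht; have /cox_tupleP[H1 H2] := Ht'.
have n_gt0 : 0 < n by exact: ltnW.
have k_inj : injective k.
  move=> u v kuv; apply/eqP; apply: contraT => uv.
  have [||e] := tP _ _ 1 uv; first by rewrite n_gt0.
    by rewrite expg1 tE !ffunE kuv H1.
  by rewrite dvdn1 => /eqP e1; have := clab_ge2 e; rewrite e1.
have kE u v : cedge (k u) (k v) -> cedge u v /\ clab u v %| n.
  move=> kuv; apply: tP; last by rewrite tE !ffunE -(En _ _ kuv) H2.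
    by apply: contraL kuv => /eqP ->; rewrite cedge_irr.
  by rewrite n_gt0 leqnn.
have kn u v : cedge u v -> cedge (k u) (k v) /\ n %| clab u v.
  move=> uv; case: (kP _ _ uv) => // /k_inj e.
  by move: uv; rewrite e cedge_irr.
split.
- have cE : #|cv E| <= #|cv D|.
    rewrite -(card_codom k_inj); apply/subset_leq_card/subsetP => i _.
    by have [u <-] := k_surj i; apply: codom_f.
  exact: inj_card_bij.
- by move=> u v; apply/idP/idP => [/kE[]|/kn[]].
move=> u v uv; have [kuv d1] := kn _ _ uv; have [_ d2] := kE _ _ kuv.
by rewrite (En _ _ kuv); apply/eqP; rewrite eqn_dvd d1 d2.
Qed.

(** * Functions constant on the classes of a relation *)

Section Invariant.
Variables (V : finType) (e : rel V).

Definition invariant_fun (A : finType) : {pred {ffun V -> A}} :=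
  [pred a : {ffun V -> A} | [forall u, forall v, e u v ==> (a u == a v)]].
Arguments invariant_fun : clear implicits.

Lemma invariant_funP (A : finType) (a : {ffun V -> A}) :
  reflect (forall u v, e u v -> a u = a v) (a \in invariant_fun A).
Proof.
apply: (iffP forallP) => [H u v uv|H u].
  by have /forallP/(_ v)/implyP/(_ uv)/eqP := H u.
by apply/forallP => v; apply/implyP => uv; apply/eqP/H.
Qed.

Lemma invariant_connect (A : finType) (a : {ffun V -> A}) u v :
  a \in invariant_fun A -> connect e u v -> a u = a v.
Proof.
move=> /invariant_funP H /connectP[p]; elim: p u => [|w p IH] u /=.
  by move=> _ ->.
by case/andP=> /H -> /IH.
Qed.

Hypothesis e_sym : symmetric e.

Lemma card_invariant_fun (A : finType) :
  #|invariant_fun A| = #|A| ^ n_comp e predT.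
Proof.
have cs := sym_connect_sym e_sym.
pose R := {v : V | roots e v}.
pose r v : R := exist _ (fingraph.root e v) (roots_root cs v).
pose F (g : {ffun R -> A}) : {ffun V -> A} := [ffun v => g (r v)].
have F_inj : injective F.
  move=> g g' /ffunP E; apply/ffunP => -[v Hv]; have := E v; rewrite !ffunE.
  suff -> : r v = exist _ v Hv by [].
  by apply: val_inj => /=; apply/eqP.
have -> : n_comp e predT = #|{: R}|.
  by rewrite card_sig; apply: eq_card => v; rewrite !inE /= andbT.
rewrite -card_ffun -(card_imset _ F_inj); apply: eq_card => a.
apply/idP/imsetP => [Ha|[g _ ->]].
  exists [ffun x : R => a (val x)] => //; apply/ffunP => v; rewrite !ffunE /=.
  by apply: (invariant_connect Ha); apply: connect_root.
apply/invariant_funP => u v uv; rewrite !ffunE; congr (g _).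
by apply: val_inj; apply/eqP; rewrite /= root_connect //; apply: connect1.
Qed.

Lemma class_map k : n_comp e predT = k -> exists c : V -> 'I_k,
  (forall i, exists v, c v = i) /\ (forall u v, c u = c v <-> connect e u v).
Proof.
have cs := sym_connect_sym e_sym.
pose R := {v : V | roots e v}.
pose r v : R := exist _ (fingraph.root e v) (roots_root cs v).
have -> : n_comp e predT = #|{: R}|.
  by rewrite card_sig; apply: eq_card => v; rewrite !inE /= andbT.
move=> <-; exists (fun v => enum_rank (r v)); split=> [i|u v].
  exists (val (enum_val i)); rewrite -[RHS]enum_valK; congr enum_rank.
  by apply: val_inj => /=; apply/eqP; apply: (valP (enum_val i)).
split=> [/enum_rank_inj/(congr1 val)/eqP|]; first by rewrite root_connect.
by rewrite -root_connect // => /eqP E; congr enum_rank; apply: val_inj.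
Qed.

End Invariant.
Arguments invariant_fun {V} e A.

Lemma invariant_class (V : finType) (e : rel V) k (c : V -> 'I_k) (A : finType)
  (f : 'I_k -> A) : (forall u v, c u = c v <-> connect e u v) ->
  [ffun v => f (c v)] \in invariant_fun e A.
Proof.
move=> cP; apply/invariant_funP => u v /connect1/cP uv.
by rewrite !ffunE uv.
Qed.

(** The device by which a count shows that additional edges join no new classes. *)
Lemma invariant_subset_eq (V : finType) (e e' : rel V) (A : finType) :
  (forall u v, e u v -> e' u v) ->
  #|invariant_fun e A| = #|invariant_fun e' A| ->
  invariant_fun e A =i invariant_fun e' A.
Proof.
move=> ee' E a; apply/esym; apply: (subset_cardP (esym E)).
apply/subsetP => b /invariant_funP Hb; apply/invariant_funP => u v /ee'.
exact: Hb.
Qed.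

Lemma invariant_const (V : finType) (e : rel V) (A : finType) :
  1 < #|A| -> #|invariant_fun e A| = #|A| ->
  forall a, a \in invariant_fun e A -> forall u v, a u = a v.
Proof.
move=> A1 E a Ha u v.
pose cst (x : A) : {ffun V -> A} := [ffun=> x].
have cst_inj : injective cst by move=> x y /ffunP/(_ u); rewrite !ffunE.
have sub : [set cst x | x in A] \subset invariant_fun e A.
  by apply/subsetP => _ /imsetP[x _ ->]; apply/invariant_funP => ? ?; rewrite !ffunE.
have /subset_cardP/(_ sub)/(_ a) : #|[set cst x | x in A]| = #|invariant_fun e A|.
  by rewrite card_imset // E; apply: eq_card.
by rewrite Ha => /imsetP[x _ ->]; rewrite !ffunE.
Qed.

Lemma card_invariant_connected (V : finType) (e : rel V) (A : finType) :
  0 < #|V| -> (forall u v, connect e u v) -> #|invariant_fun e A| = #|A|.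
Proof.
move=> /card_gt0P[u0 _] ce.
pose cst (x : A) : {ffun V -> A} := [ffun=> x].
have cst_inj : injective cst by move=> x y /ffunP/(_ u0); rewrite !ffunE.
rewrite -[RHS](card_imset _ cst_inj); apply: eq_card => a.
apply/idP/imsetP => [Ha|[x _ ->]]; last by apply/invariant_funP => ? ?; rewrite !ffunE.
exists (a u0) => //; apply/ffunP => u; rewrite !ffunE.
exact: (invariant_connect Ha).
Qed.

Lemma card_invariant_pred0 (V : finType) (e : rel V) (A : finType) :
  (forall u v, e u v = false) -> #|invariant_fun e A| = #|A| ^ #|V|.
Proof.
move=> e0; rewrite -card_ffun; apply: eq_card => a.
by apply/invariant_funP => u v; rewrite e0.
Qed.

Definition edges_with (D : coxgraph) (P : pred nat) : rel (cv D) :=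
  fun u v => cedge u v && P (clab u v).

Lemma edges_with_sym (D : coxgraph) (P : pred nat) : symmetric (@edges_with D P).
Proof. by move=> u v; rewrite /edges_with cedge_sym clab_sym. Qed.

(** * Generalised dihedral groups *)

Definition parity := bool.
HB.instance Definition _ := Finite.on parity.
Lemma addb_left_inverse : left_inverse false id addb. Proof. by case. Qed.
HB.instance Definition _ :=
  Finite_isGroup.Build parity addbA addFb addb_left_inverse.

Section Dihedral.
Variable A : finZmodType.
Local Open Scope ring_scope.

Definition dihedral : Type := (A * bool)%type.
HB.instance Definition _ := Finite.on dihedral.

Definition Rot (a : A) : dihedral := (a, false).
Definition Ref (a : A) : dihedral := (a, true).

Definition dih_mul (x y : dihedral) : dihedral :=
  (x.1 + (if x.2 then - y.1 else y.1), x.2 (+) y.2).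
Definition dih_inv (x : dihedral) : dihedral :=
  (if x.2 then x.1 else - x.1, x.2).

Lemma dih_mulA : associative dih_mul.
Proof.
move=> [a x] [b y] [c z]; rewrite /dih_mul /= addbA -addrA; congr (_ + _, _).
by case: x; case: y; rewrite //= ?opprD ?opprK.
Qed.
Lemma dih_mul1 : left_id (Rot 0) dih_mul.
Proof. by move=> [a x]; rewrite /dih_mul /= add0r. Qed.
Lemma dih_mulV : left_inverse (Rot 0) dih_inv dih_mul.
Proof. by move=> [a []]; rewrite /dih_mul /dih_inv /= ?subrr ?addNr. Qed.

HB.instance Definition _ := Finite_isGroup.Build dihedral dih_mulA dih_mul1 dih_mulV.

Lemma dih1 : 1%g = Rot 0. Proof. by []. Qed.
Lemma RotD a b : (Rot a * Rot b)%g = Rot (a + b). Proof. by []. Qed.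
Lemma RefB a b : (Ref a * Ref b)%g = Rot (a - b). Proof. by []. Qed.
Lemma RotX a k : (Rot a ^+ k)%g = Rot (a *+ k).
Proof. by elim: k => [|k IH]; rewrite ?expg0 ?mulr0n // expgS IH RotD mulrS. Qed.
Lemma Ref2 a : (Ref a * Ref a)%g = 1%g. Proof. by rewrite RefB subrr. Qed.

Lemma Rot_eq1 a : (Rot a == 1%g) = (a == 0).
Proof. by rewrite dih1 -pair_eqE /= eqxx andbT. Qed.

Definition dih_sign (x : dihedral) : parity := x.2.
Lemma dih_signM : {morph dih_sign : x y / (x * y)%g}.
Proof. by []. Qed.

Lemma dih_signF x : dih_sign x = false -> x = Rot x.1.
Proof. by case: x => a [] . Qed.
Lemma dih_signT x : dih_sign x = true -> x = Ref x.1.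
Proof. by case: x => a [] . Qed.

End Dihedral.

Section DihedralMap.
Variables (A B : finZmodType) (f : A -> B).
Hypothesis fB : forall x y, (f (x - y) = f x - f y)%R.
Local Open Scope ring_scope.

Definition dih_map (x : dihedral A) : dihedral B := (f x.1, x.2).

Lemma dih_mapM : {morph dih_map : x y / (x * y)%g}.
Proof.
have f0 : f 0 = 0 by rewrite -(subrr 0) fB subrr.
have fN x : f (- x) = - f x by rewrite -sub0r fB f0 sub0r.
have fD x y : f (x + y) = f x + f y by rewrite -{1}[y]opprK fB fN opprK.
move=> [a x] [b y]; rewrite /dih_map /mulg /=; congr (_, _).
by case: x; rewrite /= fD // fN.
Qed.

End DihedralMap.

Lemma parityM (x y : parity) : (x * y)%g = x (+) y. Proof. by []. Qed.
Lemma parity1 : 1%g = false :> parity. Proof. by []. Qed.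

(** In a group of order two, an even label imposes nothing and an odd label makes the two entries
    equal. *)
Lemma parity_tuple (D : coxgraph) (t : {ffun cv D -> parity}) :
  cox_tuple t = (t \in invariant_fun (edges_with odd) parity).
Proof.
have px (x : parity) k : (x ^+ k)%g = x && odd k.
  elim: k => [|k IH]; first by rewrite expg0 parity1 andbF.
  by rewrite expgS IH parityM /=; case: x {IH}; case: (odd k).
apply/cox_tupleP/invariant_funP => [[_ H] u v /andP[uv o]|H].
  by have := H _ _ uv; rewrite px o andbT parityM parity1; case: (t u) (t v) => [] [].
split=> [v|u v uv]; first by rewrite parityM addbb.
rewrite px parity1; case: (boolP (odd _)) => o; rewrite ?andbF //.
by rewrite (H u v) ?parityM ?addbb // /edges_with uv o.
Qed.

Lemma Zp_nat_eq0 (N m : nat) : 1 < N -> ((m%:R : 'Z_N)%R == 0%R) = (N %| m).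
Proof.
move=> N1; rewrite -(inj_eq val_inj) /= val_Zp_nat //.
Qed.

Lemma Zp_mulrn_eq0 (N m : nat) (x : 'Z_N) : 1 < N -> (x *+ m == 0)%R = (N %| x * m).
Proof.
move=> N1; rewrite -[x in LHS]natr_Zp -mulrnA; exact: Zp_nat_eq0.
Qed.

Lemma Zp_reduceB (N M : nat) : 1 < N -> M %| N -> 1 < M ->
  forall x y : 'Z_N, ((x - y)%R%:R = x%:R - y%:R :> 'Z_M)%R.
Proof.
move=> N1 MN M1 x y; apply: (addIr (y%:R)%R); rewrite subrK -natrD.
move: x y; case: N N1 MN => [|[|N]] // _ MN x y.
have /= {2}<- := congr1 val (subrK y x).
by apply: val_inj; rewrite /= !val_Zp_nat // modn_dvdm.
Qed.

(** * Labels divisible by 4 *)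

(** A chain below [A] maps to a strictly increasing chain, so [f] does not lower cardinalities. The
    same applied to the complementary map A |-> ~: f (~: A) gives the other inequality. *)
Lemma set_embedding_card (T U : finType) (f : {set T} -> {set U}) :
  #|T| = #|U| -> injective f ->
  (forall A B : {set T}, A \subset B -> f A \subset f B) ->
  forall A : {set T}, #|f A| = #|A|.
Proof.
have ge (g : {set T} -> {set U}) : injective g ->
    (forall A B : {set T}, A \subset B -> g A \subset g B) ->
    forall A : {set T}, #|A| <= #|g A|.
  move=> g_inj g_sub A; have [k kA] := ubnP #|A|; elim: k A kA => // k IH A kA.
  have [->|[x xA]] := set_0Vmem A; first by rewrite cards0.
  rewrite (cardsD1 x) xA ltnS in kA *; apply: leq_ltn_trans (IH _ _) _ => //.
  apply: proper_card; rewrite properEneq g_sub ?subD1set // andbT.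
  apply: contraTneq xA => /g_inj <-; by rewrite !inE eqxx.
move=> TU f_inj f_sub A; apply/eqP; rewrite eqn_leq ge // andbT.
pose g (B : {set T}) := ~: f (~: B).
have /(_ (~: A)) : forall B : {set T}, #|B| <= #|g B|.
  apply: ge => [B C /setC_inj/f_inj/setC_inj //|B C BC].
  by rewrite /g setCS f_sub // setCS.
rewrite /g setCK => le.
by rewrite -(leq_add2r #|~: A|) cardsC TU -(cardsC (f A)) leq_add2l.
Qed.

Definition pull (V U : finType) (A : Type) (k : V -> U) (t : {ffun U -> A}) :
  {ffun V -> A} := [ffun u => t (k u)].

Lemma pull_exists (V U : finType) (A : eqType) (k : V -> U) (t : {ffun V -> A}) :
  (forall i, exists u, k u = i) ->
  (forall u v, k u = k v -> t u = t v) -> exists t', t = pull k t'.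
Proof.
move=> k_surj tk; have /fin_all_exists[s sP] := k_surj.
by exists [ffun i => t (s i)]; apply/ffunP => u; rewrite !ffunE; apply: tk.
Qed.

Section Pull.
Variables (D E : coxgraph) (k : cv D -> cv E) (Q : finGroupType).

(** Converts descent into ascent: if every tuple of [D] comes from [E], equality of the counts
    forces every tuple of [E] to satisfy the relations of [D]. Labels of [D] are then bounded from
    below by well-chosen tuples of [E]. *)
Lemma pull_surjective : (forall i, exists u, k u = i) ->
  #|[pred t : {ffun cv D -> Q} | cox_tuple t]| =
  #|[pred t : {ffun cv E -> Q} | cox_tuple t]| ->
  (forall t : {ffun cv D -> Q}, cox_tuple t ->
    exists2 t' : {ffun cv E -> Q}, cox_tuple t' & t = pull k t') ->
  forall t : {ffun cv E -> Q}, cox_tuple t -> cox_tuple (pull k t).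
Proof.
move=> k_surj cDE tP t Ht.
have pull_inj : injective (@pull _ _ Q k).
  move=> t1 t2 /ffunP e; apply/ffunP => i; have [u <-] := k_surj i.
  by have := e u; rewrite !ffunE.
have sub : [pred t : {ffun cv D -> Q} | cox_tuple t] \subset
    [set pull k t' | t' in [pred t' : {ffun cv E -> Q} | cox_tuple t']].
  by apply/subsetP => t1 /tP[t2 Ht2 ->]; apply: imset_f.
have /subset_cardP/(_ sub)/(_ (pull k t)) : #|[pred t : {ffun cv D -> Q} | cox_tuple t]| =
    #|[set pull k t' | t' in [pred t' : {ffun cv E -> Q} | cox_tuple t']]|.
  by rewrite (card_imset _ pull_inj).
by rewrite imset_f.
Qed.

End Pull.

Lemma expg_coprime_eq1 (Q : finGroupType) (x : Q) a b :
  coprime a b -> (x ^+ a = 1 -> x ^+ b = 1 -> x = 1)%g.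
Proof.
move=> cab /eqP; rewrite -order_dvdn => xa /eqP; rewrite -order_dvdn => xb.
by apply/eqP; rewrite -order_eq1 -dvdn1 -(eqP cab) dvdn_gcd xa.
Qed.

Lemma inv_prod_eq1 (Q : finGroupType) (x y : Q) : (y * y = 1 -> x * y = 1 -> x = y)%g.
Proof. by move=> y2 xy; apply: (mulIg y); rewrite y2. Qed.

Lemma dihedral_2group (c : nat) (x : dihedral ('Z_(2 ^ c.+1))) :
  (x ^+ (2 ^ c.+1) = 1)%g.
Proof.
have N1 : 1 < 2 ^ c.+1 by rewrite -(expn0 2) ltn_exp2l.
case: x => a [].
  rewrite -[(a, true)]/(Ref a) [X in (_ ^+ X)%g]expnS expgM expgS expg1.
  by rewrite Ref2 expg1n.
rewrite -[(a, false)]/(Rot a) RotX; apply/eqP; rewrite Rot_eq1 Zp_mulrn_eq0 //.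
exact: dvdn_mull.
Qed.

Lemma odd_classes (D E : coxgraph) (te : tuple_equiv D E) (n : nat) :
  #|cv E| = 4 -> (forall i j : cv E, cedge i j -> clab i j = n) -> odd n = false ->
  exists c : cv D -> 'I_4, (forall i, exists v, c v = i) /\
    (forall u v, c u = c v <-> connect (edges_with odd) u v).
Proof.
move=> E4 En n_even.
have edge_even (i j : cv E) : edges_with odd i j = false.
  by apply/negbTE/negP => /andP[/En ->]; rewrite n_even.
apply: class_map; first exact: edges_with_sym.
have := card_tuples te parity.
have -> : #|[pred t : {ffun cv D -> parity} | cox_tuple t]| =
    #|invariant_fun (@edges_with D odd) parity|.
  by apply: eq_card => t; rewrite !inE parity_tuple.
have -> : #|[pred t : {ffun cv E -> parity} | cox_tuple t]| =
    #|invariant_fun (@edges_with E odd) parity|.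
  by apply: eq_card => t; rewrite !inE parity_tuple.
rewrite (card_invariant_fun (@edges_with_sym _ _)) (card_invariant_pred0 _ edge_even) E4.
by rewrite card_bool => /eqP; rewrite eqn_exp2l // => /eqP.
Qed.

Section Four.
Variables (D E : coxgraph) (te : tuple_equiv D E) (n : nat).
Hypotheses (E4 : #|cv E| = 4) (En : forall i j : cv E, cedge i j -> clab i j = n)
  (n_gt0 : 0 < n) (n4 : 4 %| n).

Let n_even : odd n = false.
Proof. by apply/negbTE; rewrite -dvdn2; apply: dvdn_trans n4. Qed.

Let chi (S : {set cv E}) : {ffun cv E -> parity} := [ffun v => v \in S].
Let psi (S : {set cv E}) := tinv te (chi S).

Let edge_even (i j : cv E) : edges_with odd i j = false.
Proof. by apply/negbTE/negP => /andP[/En ->]; rewrite n_even. Qed.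

Let chiP S : cox_tuple (chi S).
Proof. by rewrite parity_tuple; apply/invariant_funP => i j; rewrite edge_even. Qed.

Let psiP S : cox_tuple (psi S). Proof. exact: tinvP. Qed.

Let psi_inj : injective psi.
Proof.
move=> S S' /(congr1 (tmap te (Q := _))); rewrite !tinvK // => /ffunP e.
by apply/setP => i; have := e i; rewrite !ffunE.
Qed.

(* In a tuple of involutions of the dihedral group of order 8 the reflections
   with odd angle form a subset of all reflections. *)
Let psi_mono (S T : {set cv E}) u : S \subset T -> psi S u -> psi T u.
Proof.
move=> ST.
pose t : {ffun cv E -> dihedral 'Z_4} := [ffun v =>
  if v \in T then Ref (if v \in S then 1%R else 0%R) else 1%g].
have Ht : cox_tuple t.
  have X4 (x : dihedral 'Z_4) : (x ^+ n = 1)%g.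
    have x4 : (x ^+ 4 = 1)%g := @dihedral_2group 1 x.
    by case/dvdnP: n4 => q ->; rewrite mulnC expgM x4 expg1n.
  apply/cox_tupleP; split=> [v|v w /En ->]; last exact: X4.
  by rewrite ffunE; case: ifP => _; rewrite ?Ref2 ?mulg1.
pose al (x : dihedral 'Z_4) : parity := odd x.1.
have alM : {morph al : x y / (x * y)%g}.
  move=> [a x] [b y]; rewrite parityM /al /= /mulg /=.
  by case: x; case: a => [[|[|[|[|a]]]] // Ha]; case: b => [[|[|[|[|b]]]] // Hb].
have e1 : psi T = fcomp (@dih_sign _) (tinv te t).
  rewrite -tinv_nat //; congr tinv; apply/ffunP => v; rewrite !ffunE.
  by case: ifP.
have e2 : psi S = fcomp al (tinv te t).
  rewrite -tinv_nat //; congr tinv; apply/ffunP => v; rewrite !ffunE.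
  case: (boolP (v \in T)) => [vT|/(contra (subsetP ST v))/negPf -> //].
  by case: ifP.
rewrite e1 e2 !ffunE /dih_sign /al.
have /cox_tupleP[/(_ u) + _] := tinvP te Ht.
case: (tinv te t u) => a [] //=.
rewrite -[(a, false)]/(Rot a) RotD => /eqP; rewrite Rot_eq1.
by case: a => [[|[|[|[|a]]]] // Ha].
Qed.

(** [psi] induces a monotone injection from subsets of the four vertices to subsets of the four odd
    classes. It preserves cardinality, so it sends singletons to singletons and is induced by a
    bijection. *)
Lemma match_classes : exists k : cv D -> cv E,
  [/\ (forall i, exists u, k u = i),
      (forall u v, k u = k v <-> connect (edges_with odd) u v) &
      (forall S u, psi S u = (k u \in S))].
Proof.
have [c [c_surj cP]] := odd_classes te E4 En n_even.
have psi_c S u v : c u = c v -> psi S u = psi S v.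
  move/cP; apply: invariant_connect; rewrite -parity_tuple; exact: psiP.
pose th (S : {set cv E}) : {set 'I_4} := [set c u | u in [pred u | psi S u]].
have thE S u : (c u \in th S) = psi S u.
  apply/imsetP/idP => [[v]|Su]; first by rewrite inE => Sv /psi_c ->.
  by exists u.
have th_inj : injective th.
  move=> S S' /setP e; apply: psi_inj; apply/ffunP => u.
  by have := e (c u); rewrite !thE.
have th_mono (S S' : {set cv E}) : S \subset S' -> th S \subset th S'.
  move=> SS'; apply/subsetP => i; have [u <-] := c_surj i.
  by rewrite !thE; apply: psi_mono.
have th_card : forall S : {set cv E}, #|th S| = #|S|.
  by apply: set_embedding_card => //; rewrite E4 card_ord.
have /fin_all_exists[pi piE] i : exists j, th [set i] = [set j].
  by apply/cards1P; rewrite th_card cards1.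
have pi_inj : injective pi.
  by move=> i j e; apply: set1_inj; apply: th_inj; rewrite !piE e.
have thS S : th S = [set pi i | i in S].
  apply/esym/eqP; rewrite eqEcard card_imset // th_card leqnn andbT.
  apply/subsetP => _ /imsetP[i iS ->].
  have /subsetP : th [set i] \subset th S by rewrite th_mono // sub1set.
  by apply; rewrite piE set11.
have [pi' piK pi'K] : bijective pi by apply: inj_card_bij; rewrite // E4 card_ord.
exists (fun u => pi' (c u)); split=> [i|u v|S u].
- by have [u e] := c_surj (pi i); exists u; rewrite e piK.
- by rewrite -cP; split=> [/(can_inj pi'K)|->].
by rewrite -thE thS -{1}(pi'K (c u)) mem_imset.
Qed.

Lemma four_iso : exists k : cv D -> cv E, cox_iso k.
Proof.
have [k [k_surj kP psiE]] := match_classes.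
have odd_k u v : cedge u v -> k u <> k v -> odd (clab u v) = false.
  move=> uv kuv; apply/negP => o; apply: kuv; apply/kP/connect1.
  by rewrite /edges_with uv.
(* The exponent of this dihedral 2-group divides [n], so any involutions form a tuple of [E]. Pulled
   back to [D], the rotation by 1 must be killed by the label. *)
have class2 u v c : cedge u v -> k u <> k v -> 2 ^ c.+1 %| n -> 2 ^ c.+1 %| clab u v.
  move=> uv kuv cn; have N1 : 1 < 2 ^ c.+1 by rewrite -(expn0 2) ltn_exp2l.
  set Q : finGroupType := dihedral 'Z_(2 ^ c.+1).
  have Xn (x : Q) : (x ^+ n = 1)%g.
    by case/dvdnP: cn => q ->; rewrite mulnC expgM dihedral_2group expg1n.
  pose t : {ffun cv E -> Q} := [ffun i => Ref (if i == k u then 1%R else 0%R)].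
  have Ht : cox_tuple t.
    by apply/cox_tupleP; split=> [i|i j /En ->] //; rewrite !ffunE Ref2.
  have /cox_tupleP[_ /(_ _ _ uv)] : cox_tuple (pull k t).
    apply: pull_surjective => //; first exact: card_tuples.
    move=> s /cox_tupleP[s2 sX].
    have s_inv : s \in invariant_fun (edges_with odd) Q.
      apply/invariant_funP => w x /andP[wx o]; apply: inv_prod_eq1 => //.
      apply: (expg_coprime_eq1 _ (sX _ _ wx) (dihedral_2group _)).
      by rewrite coprimeXr // coprimen2.
    have [|s' e] := pull_exists (k := k) (t := s) k_surj.
      by move=> w x /kP; apply: invariant_connect.
    exists s'; last exact: e.
    apply/cox_tupleP; split=> [i|i j /En ->] //.
    by have [w <-] := k_surj i; have := s2 w; rewrite e !ffunE.
  rewrite !ffunE eqxx [k v == _](introF eqP (not_eq_sym kuv)) RefB subr0 RotX.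
  by move/eqP; rewrite Rot_eq1 Zp_nat_eq0.
have odd_tors N (b : 'Z_N) : 1 < N -> odd N -> (Rot b * Rot b = 1)%g -> b = 0%R.
  move=> N1 No; rewrite RotD -mulr2n => /eqP.
  rewrite Rot_eq1 Zp_mulrn_eq0 // Gauss_dvdl ?coprimen2 // => Nb.
  by apply/eqP; rewrite -[b]mulr1n Zp_mulrn_eq0 // muln1.
pose lifts N S := [pred t : {ffun cv D -> dihedral 'Z_N} |
  cox_tuple t & fcomp (@dih_sign _) t == psi S].
have cl N S : #|lifts N S| = #|[pred t : {ffun cv E -> dihedral 'Z_N} |
    cox_tuple t & fcomp (@dih_sign _) t == chi S]|.
  rewrite (card_lifts te (@dih_signM _) (psiP S)).
  by apply: eq_card => t; rewrite !inE tinvK.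
have liftsP N S t u : t \in lifts N S -> 1 < N -> odd N ->
    t u = if k u \in S then Ref (t u).1 else 1%g.
  case/andP=> /cox_tupleP[t2 _] /eqP/ffunP/(_ u); rewrite ffunE psiE => e N1 No.
  case: ifP e => _; first exact: dih_signT.
  by move/dih_signF => e; have := t2 u; rewrite e => /odd_tors ->.
(* On the side of [E] such a lift is determined by its angle at [i], so there are at most [N]. The
   lifts constant on the class of [i] already give [N] on the side of [D]. *)
have const N i t u v : 1 < N -> odd N -> t \in lifts N [set i] ->
    k u = i -> k v = i -> t u = t v.
  move=> N1 No Ht ku kv; have [u0 ku0] := k_surj i.
  pose cst (a : 'Z_N) : {ffun cv D -> dihedral 'Z_N} :=
    [ffun w => if k w == i then Ref a else 1%g].
  have cst_inj : injective cst.
    by move=> a b /ffunP/(_ u0); rewrite !ffunE ku0 eqxx => -[].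
  have sub : [set cst a | a in predT] \subset lifts N [set i].
    apply/subsetP => _ /imsetP[a _ ->]; rewrite !inE; apply/andP; split; last first.
      by apply/eqP/ffunP => w; rewrite !ffunE psiE inE; case: ifP.
    apply/cox_tupleP; split=> [w|w x wx]; rewrite !ffunE.
      by case: ifP => _; rewrite ?Ref2 ?mulg1.
    case: (k w =P k x) => [->|kwx].
      by case: ifP => _; rewrite ?Ref2 ?mulg1 expg1n.
    have := odd_double_half (clab w x); rewrite odd_k // add0n -mul2n => <-.
    rewrite expgM [X in (X ^+ _)%g](_ : _ = 1%g) ?expg1n // expgS expg1.
    by case: ifP => _; case: ifP => _; rewrite ?mulg1 ?mul1g ?Ref2 ?mulg1 ?Ref2.
  have le : #|lifts N [set i]| <= #|[set cst a | a in predT]|.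
    rewrite card_imset // cl.
    apply: (leq_card_inj_on (f := fun t : {ffun cv E -> dihedral 'Z_N} => (t i).1)) => //.
    have sP (s : {ffun cv E -> dihedral 'Z_N}) j : s \in [pred t | cox_tuple t &
        fcomp (@dih_sign _) t == chi [set i]] ->
        s j = if j == i then Ref (s j).1 else 1%g.
      case/andP=> /cox_tupleP[s2 _] /eqP/ffunP/(_ j); rewrite !ffunE inE => e.
      case: ifP e => _; first exact: dih_signT.
      by move/dih_signF => e; have := s2 j; rewrite e => /odd_tors ->.
    move=> s s' Hs Hs' e; apply/ffunP => j; rewrite (sP s) // (sP s') //.
    by case: eqP => // ->; rewrite e.
  have /subset_cardP/(_ sub)/(_ t) : #|[set cst a | a in predT]| = #|lifts N [set i]|.
    by apply/eqP; rewrite eqn_leq subset_leq_card.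
  by rewrite Ht => /imsetP[a _ ->]; rewrite !ffunE ku kv.
(* Under the hypothesis on [N], all N^2 pairs of angles occur on [E]. A lift on [D] is determined by
   its angles at [u] and [v], so all pairs occur there too, in particular (1, 0), whose rotation has
   order [N]. *)
have classodd N u v : 1 < N -> odd N -> cedge u v -> k u <> k v ->
    (cedge (k u) (k v) -> N %| n) -> N %| clab u v.
  move=> N1 No uv kuv Nn; set i := k u; set j := k v.
  have ij : (j == i) = false by apply/eqP => /esym.
  pose S := [set i; j].
  have tconst t w : t \in lifts N S -> t w =
      if k w == i then t u else if k w == j then t v else 1%g.
    move=> Ht; rewrite {1}(liftsP _ _ _ _ Ht) // !inE.
    have key l x : l \in S -> k x = l -> k w = l -> Ref (t w).1 = t x.
      move=> lS kx kw.
      (* Replacing the entries outside one class by 1 keeps the relations because labels between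
         distinct classes are even; this reduces to the case of a single vertex. *)
      pose t' : {ffun cv D -> dihedral 'Z_N} := [ffun x => if k x == l then t x else 1%g].
      have Ht' : t' \in lifts N [set l].
        have /andP[/cox_tupleP[t2 tX] _] := Ht.
        rewrite inE; apply/andP; split; last first.
          apply/eqP/ffunP => y; rewrite !ffunE psiE inE; case: eqP => // e.
          by rewrite (liftsP _ _ _ y Ht) // e lS.
        apply/cox_tupleP; split=> [y|y y' yy']; rewrite !ffunE.
          by case: ifP => _; rewrite ?mulg1.
        case: (k y =P k y') => [->|kyy'].
          by case: ifP => _; rewrite ?mulg1 ?expg1n ?tX.
        have := odd_double_half (clab y y'); rewrite odd_k // add0n -mul2n => <-.
        case: eqP => ey; case: eqP => ey'; rewrite ?mulg1 ?mul1g ?expg1n //.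
        - by case: kyy'; rewrite ey ey'.
        - by rewrite expgM expgS expg1 t2 expg1n.
        by rewrite expgM expgS expg1 t2 expg1n.
      have := const N l t' w x N1 No Ht' kw kx; rewrite !ffunE kw kx eqxx => <-.
      by rewrite [RHS](liftsP _ _ _ _ Ht) // kw lS.
    have iS : i \in S by rewrite !inE eqxx.
    have jS : j \in S by rewrite !inE eqxx orbT.
    case: eqP => [kw|_] /=; first exact: key kw.
    by case: eqP => [kw|] //=; exact: key kw.
  pose f (t : {ffun cv D -> dihedral 'Z_N}) := ((t u).1, (t v).1).
  have f_inj : {in lifts N S &, injective f}.
    move=> t t' Ht Ht' [e1 e2].
    have eu : t u = t' u.
      by rewrite (liftsP _ _ _ _ Ht) // (liftsP _ _ _ _ Ht') // !inE eqxx e1.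
    have ev : t v = t' v.
      by rewrite (liftsP _ _ _ _ Ht) // (liftsP _ _ _ _ Ht') // !inE eqxx orbT e2.
    by apply/ffunP => w; rewrite (tconst t) // (tconst t') // eu ev.
  have ge : #|{: 'Z_N * 'Z_N}| <= #|lifts N S|.
    rewrite cl.
    apply: (leq_card_inj_on (f := fun ab : 'Z_N * 'Z_N => [ffun w : cv E =>
      if w == i then Ref ab.1 else if w == j then Ref ab.2 else 1%g])); last first.
      move=> [a b] [a' b'] _ _ /ffunP e; have := e i; have := e j.
      by rewrite !ffunE !eqxx ij => -[->] [->].
    move=> [a b] _; rewrite inE; apply/andP; split; last first.
      apply/eqP/ffunP => w; rewrite !ffunE !inE.
      by case: (w == i) => //=; case: (w == j).
    have X2 (x : dihedral 'Z_N) : (x * x = 1)%g -> (x ^+ n = 1)%g.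
      move=> x2; rewrite -[n]odd_double_half n_even add0n -mul2n expgM.
      by rewrite expgS expg1 x2 expg1n.
    have Xn (a' b' : 'Z_N) : cedge i j -> ((Ref a' * Ref b') ^+ n = 1)%g.
      move=> /Nn Nn'; rewrite RefB RotX; apply/eqP; rewrite Rot_eq1 Zp_mulrn_eq0 //.
      exact: dvdn_mull.
    apply/cox_tupleP; split=> [w|w x wx]; rewrite !ffunE.
      by case: eqP => _; [|case: eqP => _]; rewrite ?Ref2 ?mulg1.
    rewrite (En wx); case: (w =P i) wx => [->|_].
      case: (x =P i) => [->|_] wx; first by rewrite cedge_irr in wx.
      by case: eqP wx => [->|_] wx; rewrite ?Xn // mulg1 X2 // Ref2.
    case: (w =P j) => [->|_] wx.
      case: (x =P i) wx => [->|_] wx; first by rewrite Xn // cedge_sym.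
      case: (x =P j) wx => [->|_] wx; first by rewrite cedge_irr in wx.
      by rewrite mulg1 X2 // Ref2.
    case: (x =P i) => _; first by rewrite mul1g X2 // Ref2.
    by case: (x =P j) => _; rewrite ?mul1g ?mulg1 ?expg1n // X2 // Ref2.
  have /subset_cardP : #|[set f t | t in lifts N S]| = #|{: 'Z_N * 'Z_N}|.
    by apply/eqP; rewrite eqn_leq max_card (card_in_imset f_inj).
  move/(_ (subset_predT _))/(_ (1%R, 0%R)).
  rewrite [RHS]inE => /imsetP[t Ht [e1 e2]].
  have /andP[/cox_tupleP[_ /(_ _ _ uv) e3] _] := Ht; move: e3.
  rewrite (liftsP _ _ _ u Ht) // (liftsP _ _ _ v Ht) // !inE !eqxx orbT /= -e1 -e2.
  by rewrite RefB subr0 RotX => /eqP; rewrite Rot_eq1 Zp_nat_eq0.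
exists k; apply: (collapse_iso te (n := n)) => //.
  by apply: leq_trans (dvdn_leq n_gt0 n4).
move=> u v uv; case: (k u =P k v) => [->|kuv]; [by left | right].
have m2 := clab_ge2 uv.
have adj : cedge (k u) (k v).
  apply: contraT => nadj.
  (* An odd modulus larger than the label, which therefore cannot divide it. *)
  have := classodd (clab u v).*2.+1 u v.
  rewrite ltnS double_gt0 ltnW //= odd_double => /(_ isT isT uv kuv).
  rewrite (negPf nadj) => /(_ (fun H => False_ind _ (notF H))).
  move/(dvdn_leq (ltnW m2)); by rewrite ltnNge -addnn leq_addr.
split=> //; rewrite -(partnC 2 n_gt0) Gauss_dvd ?coprime_partC //; apply/andP; split.
  rewrite p_part; case E2 : (logn 2 n) => [|c]; first by rewrite dvd1n.
  by apply: class2 => //; rewrite -E2 pfactor_dvdnn.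
have [->|N1] := eqVneq n`_2^'%N 1%N; first exact: dvd1n.
apply: classodd => //; last by move=> _; apply: dvdn_part.
  by rewrite ltn_neqAle eq_sym N1 part_gt0.
by rewrite -coprimen2 -[2]/(2 ^ 1) coprime_sym; apply: (@pnat_coprime 2); rewrite ?part_pnat // pnat_id.
Qed.

End Four.

(** * Graphs on four vertices *)

Fixpoint words (k n : nat) : seq (seq nat) :=
  if n is n'.+1 then [seq x :: w | x <- iota 0 k, w <- words k n'] else [:: [::]].

Lemma mem_words k n w : (w \in words k n) = (size w == n) && all (fun x => x < k) w.
Proof.
elim: n w => [|n IH] [|x w] //=.
  by apply/negbTE/negP => /allpairsP[[y z] /= [_ _ ]].
rewrite eqSS; apply/allpairsP/idP => [[[y z] /= []]|/and3P[sw xk wk]].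
  by rewrite mem_iota add0n IH /= => yk /andP[/eqP <- zk] [-> ->]; rewrite eqxx /= yk.
by exists (x, w); rewrite mem_iota IH sw wk.
Qed.

Lemma uniq_words k n : uniq (words k n).
Proof.
elim: n => //= n IH; apply: allpairs_uniq; rewrite ?iota_uniq //.
by move=> [x w] [y z] _ _ /= [-> ->].
Qed.

Definition ffun_word k n (f : {ffun 'I_n -> 'I_k}) : seq nat :=
  [seq val (f i) | i <- enum 'I_n].

Lemma nth_ffun_word k n (f : {ffun 'I_n -> 'I_k}) (i : 'I_n) :
  nth 0 (ffun_word f) i = f i.
Proof. by rewrite (nth_map i) ?size_enum_ord // nth_ord_enum. Qed.

Lemma ffun_word_mem k n (f : {ffun 'I_n -> 'I_k}) : ffun_word f \in words k n.
Proof.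
rewrite mem_words size_map size_enum_ord eqxx /=.
by apply/allP => _ /mapP[i _ ->]; apply: ltn_ord.
Qed.

Lemma ffun_word_surj k n w : w \in words k n ->
  exists f : {ffun 'I_n -> 'I_k}, w = ffun_word f.
Proof.
rewrite mem_words => /andP[/eqP sw /allP wk].
have wi (i : 'I_n) : nth 0 w i < k by apply/wk/mem_nth; rewrite sw.
exists [ffun i => Ordinal (wi i)]; apply: (@eq_from_nth _ 0).
  by rewrite size_map size_enum_ord.
by rewrite sw => i Hi; rewrite (nth_ffun_word _ (Ordinal Hi)) ffunE.
Qed.

Lemma ffun_word_inj k n : injective (@ffun_word k n).
Proof.
move=> f g e; apply/ffunP => i; have := congr1 (fun w => nth 0 w i) e.
by rewrite !nth_ffun_word => /val_inj.
Qed.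

Lemma card_ffun_words k n (P : pred (seq nat)) :
  #|[pred f : {ffun 'I_n -> 'I_k} | P (ffun_word f)]| = count P (words k n).
Proof.
rewrite -size_filter cardE -(size_map (@ffun_word k n)); apply: perm_size.
apply: uniq_perm.
- by rewrite (map_inj_uniq (@ffun_word_inj k n)) enum_uniq.
- by rewrite filter_uniq // uniq_words.
move=> w; rewrite mem_filter; apply/mapP/andP => [[f]|[Pw /ffun_word_surj[f e]]].
  by rewrite mem_enum inE => Pf ->; rewrite ffun_word_mem.
by exists f => //; rewrite mem_enum inE -e.
Qed.

(* A graph on four vertices is coded by the list of its adjacencies
   01, 02, 03, 12, 13, 23 *)
Definition adj (c : seq bool) (i j : nat) : bool :=
  match i, j with
  | 0, 1 | 1, 0 => nth false c 0
  | 0, 2 | 2, 0 => nth false c 1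
  | 0, 3 | 3, 0 => nth false c 2
  | 1, 2 | 2, 1 => nth false c 3
  | 1, 3 | 3, 1 => nth false c 4
  | 2, 3 | 3, 2 => nth false c 5
  | _, _ => false
  end.

Definition o4 (i : nat) : 'I_4 := inord i.

Definition code (g : rel 'I_4) : seq bool :=
  [:: g (o4 0) (o4 1); g (o4 0) (o4 2); g (o4 0) (o4 3);
      g (o4 1) (o4 2); g (o4 1) (o4 3); g (o4 2) (o4 3)].

Lemma adj_code (g : rel 'I_4) : symmetric g -> irreflexive g ->
  forall i j : 'I_4, g i j = adj (code g) i j.
Proof.
move=> gs gi i j; rewrite -[i]inord_val -[j]inord_val.
case: i j => [[|[|[|[|i]]]] // Hi] [[|[|[|[|j]]]] // Hj] /=;
  rewrite ?gi ?inordK //= ; first [by [] | by rewrite gs].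
Qed.

Definition r4 := iota 0 4.
Definition pairs4 := [seq (i, j) | i <- r4, j <- r4].
Definition all4 (P : nat -> nat -> bool) := all (fun ij => P ij.1 ij.2) pairs4.
Definition has4 (P : nat -> nat -> bool) := has (fun ij => P ij.1 ij.2) pairs4.

Lemma mem_pairs4 (ij : nat * nat) : (ij \in pairs4) = (ij.1 < 4) && (ij.2 < 4).
Proof.
apply/allpairsP/andP => [[[i j] /= [ir jr ->]]|[i4 j4]] /=.
  by rewrite !mem_iota in ir jr.
by exists ij; rewrite !mem_iota; split=> //; case: ij {i4 j4}.
Qed.

Lemma all4P (P : nat -> nat -> bool) : reflect (forall i j : 'I_4, P i j) (all4 P).
Proof.
apply: (iffP allP) => [H i j|H [i j]]; first by apply: (H (val i, val j)); rewrite mem_pairs4 /= !ltn_ord.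
by rewrite mem_pairs4 /= => /andP[i4 j4]; apply: (H (Ordinal i4) (Ordinal j4)).
Qed.

Lemma has4P (P : nat -> nat -> bool) :
  reflect (exists i j : 'I_4, P i j) (has4 P).
Proof.
apply: (iffP hasP) => [[[i j]]|[i [j Pij]]].
  by rewrite mem_pairs4 /= => /andP[i4 j4] Pij; exists (Ordinal i4), (Ordinal j4).
by exists (val i, val j) => //; rewrite mem_pairs4 /= !ltn_ord.
Qed.

Definition perms4 := [seq p <- words 4 4 | uniq p].

Lemma perms4P p : p \in perms4 -> exists s : 'I_4 -> 'I_4,
  injective s /\ forall i : 'I_4, nth 0 p i = s i.
Proof.
rewrite mem_filter => /andP[up]; rewrite mem_words => /andP[/eqP sp /allP p4].
have H (i : 'I_4) : nth 0 p i < 4 by apply/p4/mem_nth; rewrite sp.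
exists (fun i => Ordinal (H i)); split=> // i j /(congr1 val) /= /eqP.
by rewrite nth_uniq ?sp // => /eqP /val_inj.
Qed.

Definition codes := [seq [seq x == 1 | x <- w] | w <- words 2 6].

Lemma code_mem g : code g \in codes.
Proof.
rewrite /code; move: (g _ _) (g _ _) (g _ _) (g _ _) (g _ _) (g _ _).
by do 6!case; vm_compute.
Qed.

Definition all_pairs (T : eqType) (R : rel T) (l : seq T) := all (fun x => all (R x) l) l.

Lemma all_pairsP (T : eqType) (R : rel T) l : all_pairs R l ->
  forall x y, x \in l -> y \in l -> R x y.
Proof. by move=> /allP H x y /H/allP Hx /Hx. Qed.

Definition iso_code (c d : seq bool) :=
  has (fun p => all4 (fun i j => adj c i j == adj d (nth 0 p i) (nth 0 p j))) perms4.

(* independent pairs of vertex sets, coded as functions to {0, 1, 2} *)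
Definition separated (c : seq bool) (w : seq nat) :=
  all4 (fun i j => adj c i j ==> ~~ ((nth 0 w i == 1) && (nth 0 w j == 2))).

Definition separated_count c := count (separated c) (words 3 4).

(** Checked on all pairs of the 64 labelled graphs; the counts are tabulated first. *)
Lemma separated_count_iso g h :
  separated_count (code g) = separated_count (code h) -> iso_code (code g) (code h).
Proof.
pose f c := (c, separated_count c).
have H : all_pairs (fun x y => if x.2 == y.2 then iso_code x.1 y.1 else true)
  (map f codes) by vm_compute.
move=> e; have := all_pairsP H (map_f f (code_mem g)) (map_f f (code_mem h)).
by rewrite {1 2}/f [(_, _).2]/= [X in if _ == X then _ else _]/= e eqxx.
Qed.

Definition splits (c : seq bool) (X : seq nat) :=
  has4 (fun i j => adj c i j && (nth 0 X i != nth 0 X j)).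

Definition nonconst (X : seq nat) := has4 (fun i j => nth 0 X i != nth 0 X j).

Definition conn_code c := all (fun X => nonconst X ==> splits c X) (words 2 4).

(* some cut of the graph consists of the single edge ij *)
Definition bridge_code c := has (fun X => has4 (fun i j =>
  [&& adj c i j, nth 0 X i != nth 0 X j &
   all4 (fun i' j' => adj c i' j' && (nth 0 X i' != nth 0 X j') ==>
     (((i', j') == (i, j)) || ((i', j') == (j, i))))])) (words 2 4).

Definition two_cut_code c := all (fun X => nonconst X ==> has4 (fun i j =>
  [&& adj c i j, nth 0 X i != nth 0 X j &
   has4 (fun i' j' => [&& adj c i' j', nth 0 X i' != nth 0 X j',
     (i', j') != (i, j) & (i', j') != (j, i)])])) (words 2 4).

Definition strict_sub_code c d := has (fun p =>
  all4 (fun i j => adj c i j ==> adj d (nth 0 p i) (nth 0 p j)) &&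
  has4 (fun i j => ~~ adj c i j && adj d (nth 0 p i) (nth 0 p j))) perms4.

Definition path_code := [:: true; false; false; true; false; true].
Definition star_code := [:: true; true; true; false; false; false].
Definition tree_code c := iso_code c path_code || iso_code c star_code.

(** Of the six connected graphs on four vertices, the 4-cycle is incomparable with the star and with
    the triangle carrying a pendant edge. These two pairs are separated by having a bridge. *)
Lemma connected_code_cases g h : conn_code (code g) -> conn_code (code h) ->
  if iso_code (code g) (code h) then true
  else if tree_code (code g) && tree_code (code h) then true
  else if strict_sub_code (code g) (code h) then true
  else if strict_sub_code (code h) (code g) then true
  else if bridge_code (code g) then two_cut_code (code h)
  else bridge_code (code h) && two_cut_code (code g).
Proof.
move=> cg ch.
have H : all_pairs (fun c d =>
  if iso_code c d then true
  else if tree_code c && tree_code d then true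
  else if strict_sub_code c d then true
  else if strict_sub_code d c then true
  else if bridge_code c then two_cut_code d
  else bridge_code d && two_cut_code c) (filter conn_code codes) by vm_compute.
by apply: (all_pairsP H); rewrite mem_filter code_mem andbT.
Qed.

(** * Right-angled groups *)

Definition const_cox (g : rel 'I_4) (gs : symmetric g) (gi : irreflexive g)
  (n : nat) (n2 : 2 <= n) : coxgraph :=
  @CoxGraph 'I_4 g (fun _ _ => n) gs gi (fun _ _ => erefl) (fun _ _ _ => n2).

Lemma const_coxP (E : coxgraph) (n : nat) (n2 : 2 <= n) : #|cv E| = 4 ->
  (forall i j : cv E, cedge i j -> clab i j = n) ->
  exists g (gs : symmetric g) (gi : irreflexive g) (k : cv E -> cv (const_cox gs gi n2)),
    cox_iso k.
Proof.
move=> E4 En.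
pose f (i : cv E) : 'I_4 := cast_ord E4 (enum_rank i).
pose f' (i : 'I_4) : cv E := enum_val (cast_ord (esym E4) i).
have fK : cancel f f' by move=> i; rewrite /f /f' cast_ordK enum_rankK.
have f'K : cancel f' f by move=> i; rewrite /f /f' enum_valK cast_ordKV.
pose g i j := cedge (f' i) (f' j).
have gs : symmetric g by move=> i j; apply: cedge_sym.
have gi : irreflexive g by move=> i; apply: cedge_irr.
exists g, gs, gi, f; split; first by exists f'.
  by move=> i j; rewrite /= /g !fK.
by move=> i j /En ->.
Qed.

Lemma iso_codeP (g h : rel 'I_4) (gs : symmetric g) (gi : irreflexive g)
  (hs : symmetric h) (hi : irreflexive h) (n : nat) (n2 : 2 <= n) :
  iso_code (code g) (code h) ->
  exists k : cv (const_cox gs gi n2) -> cv (const_cox hs hi n2), cox_iso k.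
Proof.
case/hasP=> p /perms4P[s [s_inj sE]] /all4P H; exists s; split=> //.
  exact: injF_bij.
move=> i j /=; rewrite (adj_code gs gi) (adj_code hs hi).
by rewrite -!sE (eqP (H i j)).
Qed.

Lemma cox_iso_group_iso (D E : coxgraph) (k : cv D -> cv E) (W WG : group) :
  cox_iso k -> is_coxeter_group_of D W -> is_coxeter_group_of E WG -> group_iso W WG.
Proof.
move=> Hk HW HWG; apply: coxeter_group_uniq (cox_iso_coxeter Hk HW) HWG.
Qed.

Section Quotient.
Variables (D : coxgraph) (c : cv D -> 'I_4) (P : pred nat).

Definition quo_rel (i j : 'I_4) : bool := (i != j) &&
  [exists u, exists v, [&& c u == i, c v == j & edges_with P u v]].

Lemma quo_sym : symmetric quo_rel.
Proof.
move=> i j; rewrite /quo_rel eq_sym; congr (_ && _).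
by apply/existsP/existsP => -[u /existsP[v /and3P[a b e]]]; exists v; apply/existsP;
  exists u; rewrite a b edges_with_sym.
Qed.

Lemma quo_irr : irreflexive quo_rel.
Proof. by move=> i; rewrite /quo_rel eqxx. Qed.

Lemma quo_relP i j : quo_rel i j -> exists u v, [/\ c u = i, c v = j, cedge u v & P (clab u v)].
Proof.
case/andP=> _ /existsP[u /existsP[v /and3P[/eqP a /eqP b /andP[e p]]]].
by exists u, v.
Qed.

Lemma quo_rel_edge u v : cedge u v -> P (clab u v) -> c u <> c v -> quo_rel (c u) (c v).
Proof.
move=> uv p /eqP n; rewrite /quo_rel n; apply/existsP; exists u; apply/existsP.
by exists v; rewrite !eqxx /edges_with uv.
Qed.

End Quotient.

(** Across an odd label the product of the two entries has odd order and 2-power order, hence is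
    trivial. *)
Lemma two_group_pull (D : coxgraph) (c : cv D -> 'I_4) (Q : finGroupType) (a : nat)
  (t : {ffun cv D -> Q}) : (forall u v, c u = c v <-> connect (edges_with odd) u v) ->
  (forall x : Q, (x ^+ (2 ^ a) = 1)%g) -> cox_tuple t ->
  forall u v, c u = c v -> t u = t v.
Proof.
move=> cP Qa /cox_tupleP[t2 tX] u v /cP; apply: invariant_connect.
apply/invariant_funP => w x /andP[wx o]; apply: inv_prod_eq1 => //.
apply: (expg_coprime_eq1 _ (tX _ _ wx) (Qa _)).
by rewrite coprimeXr // coprimen2.
Qed.

Section Liftable.
Variables (D : coxgraph) (c : cv D -> 'I_4).
Hypotheses (c_surj : forall i, exists v, c v = i)
  (cP : forall u v, c u = c v <-> connect (edges_with odd) u v).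

Let red (x : 'Z_4) : 'Z_2 := (x%:R)%R.
Let h := dih_map red.
Let redB x y : (red (x - y) = red x - red y)%R.
Proof. exact: (@Zp_reduceB 4 2). Qed.
Let hM := dih_mapM redB.
Let g := quo_rel c (fun m => ~~ (4 %| m)).

Let Q4 : forall x : dihedral 'Z_4, (x ^+ (2 ^ 2) = 1)%g := @dihedral_2group 1.

Let lab_even u v : cedge u v -> c u <> c v -> odd (clab u v) = false.
Proof.
move=> uv nc; apply/negP => o; apply: nc; apply/cP/connect1.
by rewrite /edges_with uv.
Qed.

Let h2 (x : 'I_3) : dihedral 'Z_2 :=
  if x == 0 :> nat then 1%g else Ref (if x == 1 :> nat then 0%R else 1%R).
Let h4 (x : 'I_3) : dihedral 'Z_4 :=
  if x == 0 :> nat then 1%g else Ref (if x == 1 :> nat then 0%R else 1%R).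

Let h24 x : h (h4 x) = h2 x.
Proof. by case: x => [[|[|[|x]]] Hx] //; congr (_, _); apply: val_inj. Qed.

Let h2_inj : injective h2.
Proof.
by move=> [[|[|[|x]]] // Hx] [[|[|[|y]]] // Hy] //= _; apply: val_inj.
Qed.

(** Involutions of the dihedral group of order 8 reduce to 1, [Ref 0] or [Ref 1]. Two reflections of
    different reductions have a product of order 4, which a label congruent to 2 mod 4 forbids,
    while the other relations between classes hold for any choice. Liftable tuples are thus pairs of
    vertex sets without edges of [g] between them. *)
Lemma card_liftable_separated :
  #|[pred phi : {ffun cv D -> dihedral 'Z_2} |
      [exists t : {ffun cv D -> dihedral 'Z_4}, cox_tuple t && (fcomp h t == phi)]]| =
  separated_count (code g).
Proof.
have gs := @quo_sym D c (fun m => ~~ (4 %| m)).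
have gi := @quo_irr D c (fun m => ~~ (4 %| m)).
pose F (f : {ffun 'I_4 -> 'I_3}) : {ffun cv D -> dihedral 'Z_2} :=
  [ffun v => h2 (f (c v))].
have F_inj : injective F.
  move=> f f' /ffunP e; apply/ffunP => i; have [v <-] := c_surj i.
  by apply: h2_inj; have := e v; rewrite !ffunE.
have sepP (f : {ffun 'I_4 -> 'I_3}) : reflect
    (forall i j, g i j -> ~ (f i = 1 :> nat /\ f j = 2 :> nat))
    (separated (code g) (ffun_word f)).
  apply: (iffP (all4P _)) => H i j.
    move=> gij [e1 e2]; have := H i j; rewrite -adj_code // gij /=.
    by rewrite !nth_ffun_word e1 e2.
  rewrite -adj_code //; apply/implyP => gij; rewrite !nth_ffun_word.
  by apply/negP => /andP[/eqP e1 /eqP e2]; apply: (H _ _ gij).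
rewrite /separated_count -card_ffun_words -(card_imset _ F_inj).
apply: eq_card => phi; apply/existsP/imsetP.
  case=> t /andP[Ht /eqP <-].
  have [t' tE] := pull_exists (t := t) c_surj (two_group_pull cP Q4 Ht).
  have /cox_tupleP[t2 tX] := Ht.
  pose f : {ffun 'I_4 -> 'I_3} := [ffun i => inord
    (if (t' i).2 then (if odd (t' i).1 then 2 else 1) else 0)].
  exists f; last first.
    apply/ffunP => v; rewrite !ffunE; have := t2 v; rewrite tE !ffunE.
    case: (t' (c v)) => a [] /=.
      move=> _; rewrite /h2; case: (boolP (odd a)) => o; rewrite inordK //=;
        congr (_, _); apply: val_inj; rewrite /= val_Zp_nat // modn2 /=;
        by rewrite ?o ?(negPf o).
    rewrite -[(a, false)]/(Rot a) RotD => /eqP; rewrite Rot_eq1 => /eqP e.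
    rewrite /h2 inordK //=; congr (_, _); apply: val_inj => /=.
    by rewrite /red; move: a e => [[|[|[|[|a]]]] Ha].
  rewrite inE; apply/sepP => i j gij.
  have [u [v [cu cv uv n4]]] := quo_relP gij.
  have nij : c u <> c v by rewrite cu cv => e; rewrite e [g _ _]gi in gij.
  rewrite !ffunE; have := tX _ _ uv; rewrite tE !ffunE cu cv.
  case: (t' i) => a []; last by rewrite inordK //= => _ [].
  case: (t' j) => b []; last by move=> _ [_]; rewrite /= inordK.
  rewrite -[(a, true)]/(Ref a) -[(b, true)]/(Ref b) RefB RotX => /eqP.
  rewrite Rot_eq1 Zp_mulrn_eq0 //= => d4.
  have ab : ~~ odd (val (a - b)%R).
    apply/negP => o; move: n4; rewrite -(@Gauss_dvdr 4 (val (a - b)%R)) ?d4 //.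
    by rewrite (coprimeXl 2 (m := 2)) // coprime2n.
  move: ab; move: a b {d4} => [[|[|[|[|a]]]] Ha] [[|[|[|[|b]]]] Hb] //= _;
    by rewrite !inordK // => -[].
case=> f; rewrite inE => /sepP Hf ->; exists [ffun v => h4 (f (c v))].
apply/andP; split; last by apply/eqP/ffunP => v; rewrite !ffunE h24.
have h4_2 x : (h4 x * h4 x = 1)%g.
  by rewrite /h4; case: ifP => _; rewrite ?Ref2 ?mulg1.
apply/cox_tupleP; split=> [v|u v uv]; rewrite !ffunE; first exact: h4_2.
case: (c u =P c v) => [->|nc]; first by rewrite h4_2 expg1n.
have [/dvdnP[q ->]|n4] := boolP (4 %| clab u v).
  by rewrite mulnC expgM [X in (X ^+ _)%g](Q4 _) expg1n.
have := odd_double_half (clab u v); rewrite lab_even // add0n -mul2n => <-.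
rewrite expgM [X in (X ^+ _)%g](_ : _ = 1%g) ?expg1n // expgS expg1.
have := Hf _ _ (quo_rel_edge uv n4 nc).
have := Hf _ _ (quo_rel_edge (D := D) (c := c) (u := v) (v := u) _ _ (not_eq_sym nc)).
rewrite cedge_sym clab_sym => /(_ uv n4).
move: (f (c u)) (f (c v)) => [[|[|[|x]]] // Hx] [[|[|[|y]]] // Hy] /= N1 N2;
  rewrite /h4 /= ?mulg1 ?mul1g ?Ref2 ?mulg1 //; by [case: N1 | case: N2].
Qed.
End Liftable.

Lemma rigid_two (D E : coxgraph) (W WG : group) :
  is_coxeter_group_of D W -> is_coxeter_group_of E WG -> profinite_iso W WG ->
  #|cv E| = 4 -> (forall i j : cv E, cedge i j -> clab i j = 2) ->
  group_iso W WG.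
Proof.
move=> HW HWG piso E4 E2.
have [te] := profinite_tuple_equiv HW HWG piso.
have [c [c_surj cP]] := odd_classes te E4 E2 erefl.
set g := quo_rel c (fun m => ~~ (4 %| m)).
have gs : symmetric g := @quo_sym D c _; have gi : irreflexive g := @quo_irr D c _.
have [g0 [g0s [g0i [k0 k0iso]]]] := const_coxP (leqnn 2) E4 E2.
have HWG0 := cox_iso_coxeter k0iso HWG.
have [te0] := profinite_tuple_equiv HW HWG0 piso.
have codeE : code (quo_rel (D := const_cox g0s g0i (leqnn 2)) id (fun m => ~~ (4 %| m)))
    = code g0.
  have e i j : quo_rel (D := const_cox g0s g0i (leqnn 2)) id (fun m => ~~ (4 %| m)) i j
      = g0 i j.
    apply/idP/idP => [/quo_relP[u [v [<- <- //]]]|gij].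
    by apply: (quo_rel_edge (D := const_cox g0s g0i (leqnn 2)) (c := id)) => // e;
      rewrite e g0i in gij.
  by rewrite /code !e.
have g0g : iso_code (code g0) (code g).
  apply: separated_count_iso; rewrite -codeE.
  rewrite -(card_liftable_separated (D := const_cox g0s g0i (leqnn 2)) (c := id)).
  - rewrite -(card_liftable_separated c_surj cP); apply/esym.
    apply: (card_liftable te0); apply: dih_mapM; exact: (@Zp_reduceB 4 2).
  - by move=> i; exists i.
  move=> u v; split=> [->|]; first exact: connect0.
  by case/connectP=> -[|w p] //= /andP[/andP[]].
have [k1 k1iso] := iso_codeP g0s g0i gs gi (leqnn 2) g0g.
have HWG1 := cox_iso_coxeter k1iso HWG0.
have [te1] := profinite_tuple_equiv HW HWG1 piso.
pose G := const_cox gs gi (leqnn 2).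
have lab_even u v : cedge u v -> c u <> c v -> odd (clab u v) = false.
  move=> uv nc; apply/negP => o; apply: nc; apply/cP/connect1.
  by rewrite /edges_with uv.
suff kiso : @cox_iso D G c by apply: cox_iso_group_iso kiso HW HWG1.
apply: (collapse_iso te1 (n := 2)) => // u v uv.
case: (c u =P c v) => [->|nc]; [by left|right].
rewrite dvdn2 lab_even //; split=> //.
(* Only labels divisible by 4 between classes not adjacent in [g] remain to be excluded. *)
have [n4|] := boolP (4 %| clab u v); last by move=> n4; apply: quo_rel_edge uv n4 nc.
apply: contraT => nguv.
set m := clab u v; have m2 : 1 < m := clab_ge2 uv.
have mE : m = m.-1.+1 by rewrite prednK // ltnW.
(* Its rotation by 1 has order 2^m > m, so the label [m] cannot kill it. *)
set Q : finGroupType := dihedral 'Z_(2 ^ m.-1.+1).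
have Qm : forall x : Q, (x ^+ (2 ^ m.-1.+1) = 1)%g := @dihedral_2group m.-1.
have M1 : 1 < 2 ^ m.-1.+1 by rewrite -(expn0 2) ltn_exp2l.
pose t : {ffun cv G -> Q} :=
  [ffun i => if i == c u then Ref 1%R else if i == c v then Ref 0%R else 1%g].
have ncE : (c v == c u) = false by apply/eqP => /esym.
have Ht : cox_tuple t.
  apply/cox_tupleP; split=> [i|i j /= gij]; rewrite !ffunE.
    by case: ifP => _; [|case: ifP => _]; rewrite ?Ref2 ?mulg1.
  rewrite expgS expg1.
  case: (i =P c u) gij => [->|_]; case: (j =P c u) => [->|_].
  - by rewrite gi.
  - case: (j =P c v) => [->|_] gij; first by rewrite [cedge _ _]gij in nguv.
    by rewrite mulg1 Ref2.
  - case: (i =P c v) => [->|_] gij; first by rewrite [cedge _ _]gs [g _ _]gij in nguv.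
    by rewrite mul1g Ref2.
  case: (i =P c v) => [->|_]; case: (j =P c v) => [->|_].
  - by rewrite gi.
  - by rewrite mulg1 Ref2.
  - by rewrite mul1g Ref2.
  by rewrite !mulg1.
have /cox_tupleP[_ /(_ _ _ uv)] : cox_tuple (pull c t).
  apply: (pull_surjective (E := G)) Ht => //; first exact: card_tuples.
  move=> s Hs; have [s' e] := pull_exists c_surj (two_group_pull cP Qm Hs).
  exists s'; last exact: e.
  have /cox_tupleP[s2 sX] := Hs.
  have s'2 i : (s' i * s' i = 1)%g.
    by have [w <-] := c_surj i; have := s2 w; rewrite e !ffunE.
  apply/cox_tupleP; split=> // i j gij.
  have [w [x [cw cx wx n4']]] := quo_relP gij.
  have nwx : c w <> c x by rewrite cw cx => ij; rewrite /= ij [g _ _]gi in gij.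
  have := sX _ _ wx; rewrite e !ffunE cw cx => /eqP; rewrite -order_dvdn => o1.
  have /eqP := Qm (s' i * s' j)%g; rewrite -order_dvdn => o2.
  (* An edge of [g] comes from a label that is twice an odd number, so in a 2-group it imposes
     exactly exponent 2. *)
  apply/eqP; rewrite -order_dvdn; apply: dvdn_trans (_ : gcdn (clab w x) (2 ^ m.-1.+1) %| 2).
    by rewrite dvdn_gcd o1.
  have ox := odd_double_half (clab w x); rewrite lab_even // add0n -mul2n in ox.
  have {}n4' : ~~ (2 %| (clab w x)./2).
    by move: n4'; rewrite -{1}ox (@dvdn_pmul2l 2 2 _ isT).
  rewrite -ox expnS -muln_gcdr -[X in _ %| X]muln1 dvdn_pmul2l // dvdn1.
  by rewrite -/(coprime _ _) coprimeXr // coprimen2 -[odd _]negbK -dvdn2.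
rewrite !ffunE eqxx ncE eqxx RefB subr0 RotX => /eqP.
rewrite Rot_eq1 Zp_nat_eq0 // => /(dvdn_leq (ltnW m2)).
by rewrite -mE leqNgt ltn_expl.
Qed.

(** * Odd labels: dihedral quotients *)

(** Equivalently, [D] is nonempty and connected by its odd labels. It forces a tuple in any group
    with a sign to have constant sign. *)
Definition parity_rigid (D : coxgraph) :=
  0 < #|cv D| /\ forall t : {ffun cv D -> parity}, cox_tuple t -> forall u v, t u = t v.

Lemma card_parity_tuples (D : coxgraph) :
  #|[pred t : {ffun cv D -> parity} | cox_tuple t]| =
  #|invariant_fun (@edges_with D odd) parity|.
Proof. by apply: eq_card => t; rewrite !inE parity_tuple. Qed.

Lemma parity_rigidP (D : coxgraph) :
  #|[pred t : {ffun cv D -> parity} | cox_tuple t]| = 2 -> parity_rigid D.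
Proof.
rewrite card_parity_tuples => c2; split.
  rewrite lt0n; apply/eqP => V0.
  have := subset_leq_card (subset_predT (invariant_fun (@edges_with D odd) parity)).
  by rewrite c2 cardT -cardE card_ffun V0 expn0.
move=> t; rewrite parity_tuple => Ht; apply: invariant_const Ht => //.
  by rewrite card_bool.
by rewrite card_bool.
Qed.

Section ConnectedOdd.
Variables (E : coxgraph) (n : nat).
Hypotheses (E0 : 0 < #|cv E|) (Ec : connected_cox E)
  (En : forall i j : cv E, cedge i j -> clab i j = n).

Lemma card_invariant_const_edges (P : pred nat) (A : finType) :
  #|invariant_fun (@edges_with E P) A| = if P n then #|A| else #|A| ^ #|cv E|.
Proof.
case: ifP => Pn.
  apply: card_invariant_connected => // u v; rewrite (eq_connect (e' := @cedge E)) //.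
  by move=> i j; rewrite /edges_with; case: (boolP (cedge i j)) => //= /En ->.
apply: card_invariant_pred0 => u v; apply/negbTE/negP => /andP[/En ->].
by rewrite Pn.
Qed.

Lemma card_parity_connected : odd n ->
  #|[pred t : {ffun cv E -> parity} | cox_tuple t]| = 2.
Proof. by move=> on; rewrite card_parity_tuples card_invariant_const_edges on card_bool. Qed.

End ConnectedOdd.

Section DihedralLift.
Variables (D : coxgraph) (p k : nat).
Hypotheses (rD : parity_rigid D) (p_pr : prime p) (p_odd : odd p).

Let N := p ^ k.+1.
Let p1 : 1 < p := prime_gt1 p_pr.
Let N1 : 1 < N.
Proof. by rewrite /N -(expn0 p) ltn_exp2l. Qed.
Let pN : p %| N. Proof. by rewrite /N expnS dvdn_mulr. Qed.
Let oN : odd N. Proof. by rewrite /N oddX p_odd orbT. Qed.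

Definition Zred (x : 'Z_N) : 'Z_p := (x%:R)%R.

Lemma ZredB x y : Zred (x - y)%R = (Zred x - Zred y)%R.
Proof. exact: Zp_reduceB. Qed.

Lemma dihedral_odd_rot M (b : 'Z_M) : 1 < M -> odd M ->
  (Rot b * Rot b = 1)%g -> b = 0%R.
Proof.
move=> M1 Mo; rewrite RotD -mulr2n => /eqP.
rewrite Rot_eq1 Zp_mulrn_eq0 // Gauss_dvdl ?coprimen2 // => Mb.
by apply/eqP; rewrite -[b]mulr1n Zp_mulrn_eq0 // muln1.
Qed.

(** A tuple without reflections is trivial since [N] is odd: this is the successor. For reflections,
    an angle difference killed by a label not divisible by [N] = p^(k+1) vanishes mod [p]; the other
    labels leave the reduction free. *)
Lemma card_dihedral_liftable :
  #|[pred phi : {ffun cv D -> dihedral 'Z_p} |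
    [exists t : {ffun cv D -> dihedral 'Z_N}, cox_tuple t && (fcomp (dih_map Zred) t == phi)]]|
  = #|invariant_fun (@edges_with D (fun m => ~~ (N %| m))) 'Z_p|.+1.
Proof.
have [V0 rig] := rD; have /card_gt0P[v0 _] := V0.
pose F (a : {ffun cv D -> 'Z_p}) : {ffun cv D -> dihedral 'Z_p} := [ffun v => Ref (a v)].
have F_inj : injective F.
  by move=> a b /ffunP e; apply/ffunP => v; have := e v; rewrite !ffunE => -[].
pose one : {ffun cv D -> dihedral 'Z_p} := [ffun=> 1%g].
set I := invariant_fun _ _.
have -> : #|I|.+1 = #|[predU1 one & [set F a | a in I]]|.
  rewrite cardU1 card_imset // [one \in _](_ : _ = false) //.
  by apply/negbTE/negP => /imsetP[a _ /ffunP/(_ v0)]; rewrite !ffunE.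
apply: eq_card => phi; rewrite [RHS]inE; apply/existsP/orP.
  case=> t /andP[Ht /eqP <-]; have /cox_tupleP[t2 tX] := Ht.
  have sgn v : (t v).2 = (t v0).2.
    have /rig/(_ v v0) := cox_tuple_fcomp (@dih_signM 'Z_N) Ht.
    by rewrite !ffunE.
  case: (boolP (t v0).2) => s0; [right|left].
    have tR v : t v = Ref (t v).1 by apply: dih_signT; rewrite /dih_sign sgn.
    apply/imsetP; exists [ffun v => Zred (t v).1]; last first.
      by apply/ffunP => v; rewrite !ffunE {1}tR.
    apply/invariant_funP => u v /andP[uv Nm]; rewrite !ffunE.
    apply/eqP; rewrite -subr_eq0 -ZredB.
    have := tX _ _ uv; rewrite (tR u) (tR v) RefB RotX => /eqP.
    rewrite Rot_eq1 Zp_mulrn_eq0 // => d; rewrite /Zred Zp_nat_eq0 //.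
    move: d Nm; set x : 'Z_N := (_ - _)%R => d; apply: contraR => px.
    by rewrite -(@Gauss_dvdr N x) // coprimeXl // prime_coprime.
  apply/eqP/ffunP => v; rewrite !ffunE.
  have tR : t v = Rot (t v).1.
    by apply: dih_signF; rewrite /dih_sign sgn; apply: negbTE.
  have := t2 v; rewrite tR => /dihedral_odd_rot -> //.
case=> [/eqP ->|/imsetP[a /invariant_funP Ha ->]].
  exists [ffun=> 1%g]; apply/andP; split.
    by apply/cox_tupleP; split=> [v|u v _]; rewrite !ffunE ?mulg1 // expg1n.
  by apply/eqP/ffunP => v; rewrite !ffunE.
(* Lifting by fixed representatives makes entries that are equal mod [p] equal in ['Z_N]. *)
exists [ffun v => Ref ((a v)%:R)%R]; apply/andP; split; last first.
  apply/eqP/ffunP => v; rewrite !ffunE /dih_map /=; congr (_, _).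
  apply: val_inj; rewrite /Zred /= !val_Zp_nat // modn_dvdm //.
  by rewrite modn_small // -[X in _ < X](Zp_cast p1).
apply/cox_tupleP; split=> [v|u v uv]; rewrite !ffunE ?Ref2 // RefB RotX.
apply/eqP; rewrite Rot_eq1 Zp_mulrn_eq0 //.
have [Nm|Nm] := boolP (N %| clab u v); first exact: dvdn_mull.
by rewrite (Ha u v) ?subrr ?dvdn0 // /edges_with uv.
Qed.

End DihedralLift.

Section OddClasses.
Variables (D E : coxgraph) (te : tuple_equiv D E) (n : nat).
Hypotheses (E4 : #|cv E| = 4) (Ec : connected_cox E)
  (En : forall i j : cv E, cedge i j -> clab i j = n) (n_odd : odd n).

Lemma rigidE : parity_rigid E.
Proof. by apply: parity_rigidP; apply: card_parity_connected n_odd => //; rewrite E4. Qed.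

Lemma rigidD : parity_rigid D.
Proof.
apply: parity_rigidP; rewrite (card_tuples te).
by apply: card_parity_connected n_odd => //; rewrite E4.
Qed.

Lemma card_prime_power_invariant p k : prime p -> odd p ->
  #|invariant_fun (@edges_with D (fun m => ~~ (p ^ k.+1 %| m))) 'Z_p| =
  if p ^ k.+1 %| n then p ^ 4 else p.
Proof.
move=> p_pr p_odd; apply: succn_inj.
rewrite -(card_dihedral_liftable k rigidD) //.
rewrite (card_liftable te); last by apply: dih_mapM; apply: ZredB.
rewrite (card_dihedral_liftable k rigidE) // (card_invariant_const_edges _ Ec En) ?E4 //.
by rewrite card_ord Zp_cast ?prime_gt1 //; case: (_ %| n).
Qed.

(** For every p^k dividing [n] with k >= 1 the invariant functions number p^4, so the same four
    classes result. Beyond the exact power only the constants remain, so the classes become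
    connected. *)
Lemma prime_classes p : prime p -> p %| n -> exists c : cv D -> 'I_4,
  [/\ (forall i, exists v, c v = i),
      (forall u v, c u = c v <-> connect (edges_with (fun m => ~~ (p %| m))) u v),
      (forall k u v, p ^ k %| n -> cedge u v -> ~~ (p ^ k %| clab u v) -> c u = c v) &
      (forall k, ~~ (p ^ k.+1 %| n) ->
         conn_code (code (quo_rel c (fun m => ~~ (p ^ k.+1 %| m)))))].
Proof.
move=> p_pr pn; have p_odd : odd p.
  by apply: contraTT pn => ep; apply/negP => /(dvdn_odd)/(_ n_odd); rewrite (negPf ep).
have p1 := prime_gt1 p_pr.
have card1 := card_prime_power_invariant 0 p_pr p_odd.
have [c [c_surj cP]] : exists c : cv D -> 'I_4, (forall i, exists v, c v = i) /\
    (forall u v, c u = c v <-> connect (edges_with (fun m => ~~ (p ^ 1 %| m))) u v).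
  apply: class_map; first exact: edges_with_sym.
  move: card1; rewrite expn1 pn (card_invariant_fun (@edges_with_sym _ _)) card_ord Zp_cast //.
  by move/eqP; rewrite eqn_exp2l // => /eqP.
have Z01 : (1 : 'Z_p)%R <> 0%R by move/eqP; rewrite (Zp_nat_eq0 1) // dvdn1; case: (p) p1 => [|[]].
exists c; split=> //.
- case=> [|k] u v pkn uv; first by rewrite dvd1n.
  move=> pkm.
  pose a := [ffun x => if c x == c u then 1%R else 0%R : 'Z_p].
  have : a \in invariant_fun (@edges_with D (fun m => ~~ (p ^ k.+1 %| m))) 'Z_p.
    rewrite -(invariant_subset_eq (e := edges_with (fun m => ~~ (p ^ 1 %| m)))).
    - exact: (invariant_class (fun i => if i == c u then 1%R else 0%R : 'Z_p) cP).
    - move=> x y /andP[xy pm]; rewrite /edges_with xy; apply: contra pm.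
      by apply: dvdn_trans; rewrite dvdn_exp2l.
    by rewrite card1 card_prime_power_invariant // pkn expn1 pn.
  move/invariant_funP/(_ u v); rewrite /edges_with uv pkm !ffunE eqxx => /(_ isT).
  by case: eqP => // _ /Z01.
move=> k pkn; apply/allP => X; rewrite mem_words => /andP[/eqP sX /allP X2].
rewrite /nonconst /splits; apply/implyP => /has4P[i [j Xij]].
apply: contraT => /has4P noX.
pose a := [ffun x => (nth 0%N X (c x))%:R%R : 'Z_p].
have Xinj x y : x < 4 -> y < 4 ->
    ((nth 0%N X x)%:R = (nth 0%N X y)%:R :> 'Z_p)%R -> nth 0 X x = nth 0 X y.
  move=> x4 y4; have lt2 z : z < 4 -> nth 0 X z < 2.
    by move=> z4; apply: X2; rewrite mem_nth ?sX.
  move: (lt2 x x4) (lt2 y y4).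
  move: (nth 0 X x) (nth 0 X y) => [|[|a1]] [|[|b1]] //.
have Ha : a \in invariant_fun (@edges_with D (fun m => ~~ (p ^ k.+1 %| m))) 'Z_p.
  apply/invariant_funP => u v /andP[uv pm]; rewrite !ffunE.
  case: (c u =P c v) => [->//|nc]; congr (_%:R)%R; apply/eqP; apply: contraT => nX.
  case: noX; exists (c u), (c v); rewrite nX andbT.
  rewrite -(adj_code (@quo_sym D c _) (@quo_irr D c _)).
  exact: quo_rel_edge.
have cA : #|invariant_fun (@edges_with D (fun m => ~~ (p ^ k.+1 %| m))) 'Z_p| = #|{: 'Z_p}|.
  by rewrite card_prime_power_invariant // (negPf pkn) card_ord Zp_cast.
have [u cu] := c_surj i; have [v cv] := c_surj j.
have Zp1 : 1 < #|{: 'Z_p}| by rewrite card_ord Zp_cast.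
have := invariant_const Zp1 cA Ha u v.
by rewrite !ffunE cu cv => /Xinj e; rewrite e ?eqxx ?ltn_ord in Xij.
Qed.

End OddClasses.

(** * Odd labels: comparison of two primes *)

Section ShearGroup.
Variables (Z R : finZmodType).
Local Open Scope ring_scope.

(* The transformations (x, y) |-> (d x, f x + y) of Z x R, or (d x, f x - y)
   if d is a reflection *)
Definition shear : Type := (dihedral Z * {ffun Z -> R})%type.
HB.instance Definition _ := Finite.on shear.

Definition dih_act (d : dihedral Z) (x : Z) : Z := if d.2 then d.1 - x else d.1 + x.
Definition dih_sgn (d : dihedral Z) (y : R) : R := if d.2 then - y else y.

Lemma dih_actM d e x : dih_act (d * e)%g x = dih_act d (dih_act e x).
Proof.
by case: d e => a [] [b []]; rewrite /dih_act /mulg /= ?opprD ?opprK addrA.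
Qed.
Lemma dih_sgnM d e x : dih_sgn (d * e)%g x = dih_sgn d (dih_sgn e x).
Proof. by case: d e => a [] [b []]; rewrite /dih_sgn /mulg /= ?opprK. Qed.
Lemma dih_sgnD d x y : dih_sgn d (x + y) = dih_sgn d x + dih_sgn d y.
Proof. by case: d => a []; rewrite /dih_sgn /= ?opprD. Qed.

Definition shear_mul (s t : shear) : shear :=
  ((s.1 * t.1)%g, [ffun x => s.2 (dih_act t.1 x) + dih_sgn s.1 (t.2 x)]).
Definition shear_one : shear := (1%g, [ffun=> 0]).
Definition shear_inv (s : shear) : shear :=
  ((s.1^-1)%g, [ffun x => - dih_sgn (s.1^-1)%g (s.2 (dih_act (s.1^-1)%g x))]).

Lemma shear_mulA : associative shear_mul.
Proof.
move=> s t u; rewrite /shear_mul /= mulgA; congr (_, _); apply/ffunP => x.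
by rewrite !ffunE /= dih_sgnD addrA dih_actM dih_sgnM.
Qed.
Lemma shear_mul1 : left_id shear_one shear_mul.
Proof.
move=> [d f]; rewrite /shear_mul /= mul1g; congr (_, _); apply/ffunP => x.
by rewrite !ffunE add0r.
Qed.
Lemma shear_mulV : left_inverse shear_one shear_inv shear_mul.
Proof.
move=> [d f]; rewrite /shear_mul /shear_inv /= mulVg; congr (_, _).
apply/ffunP => x; rewrite !ffunE -dih_actM mulVg.
have -> : dih_act 1%g x = x by rewrite /dih_act /= add0r.
by rewrite addNr.
Qed.
HB.instance Definition _ := Finite_isGroup.Build shear shear_mulA shear_mul1 shear_mulV.

Definition shear_base (s : shear) : dihedral Z := s.1.
Lemma shear_baseM : {morph shear_base : x y / (x * y)%g}.
Proof. by []. Qed.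

Definition shear_sign (s : shear) : parity := dih_sign s.1.
Definition mirror (a : Z) (f : {ffun Z -> R}) : shear := (Ref a, f).

Lemma mirror2 a f : (mirror a f * mirror a f = 1)%g <-> (forall x, f (a - x) = f x).
Proof.
rewrite /mulg /= /shear_mul /= Ref2; split=> [[/ffunP e] x|e].
  by have := e x; rewrite !ffunE /dih_act /dih_sgn /= => /eqP; rewrite subr_eq0 => /eqP.
by congr (_, _); apply/ffunP => x; rewrite !ffunE /dih_act /dih_sgn /= e subrr.
Qed.

Lemma mirror_mul a f b g : (mirror a f * mirror b g)%g =
  (Rot (a - b), [ffun x => f (b - x) - g x]).
Proof. by []. Qed.

Lemma rot_shearX (d : Z) (z : {ffun Z -> R}) m : (((Rot d, z) : shear) ^+ m)%g =
  (Rot (d *+ m), [ffun x => \sum_(k < m) z (x + d *+ k)]).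
Proof.
elim: m => [|m IH].
  by congr (_, _); apply/ffunP => x; rewrite !ffunE big_ord0.
rewrite expgS IH /mulg /= /shear_mul /= RotD mulrS; congr (_, _).
apply/ffunP => x; rewrite !ffunE big_ord_recr [RHS]addrC /dih_act /=.
by congr (_ + _); rewrite addrC.
Qed.

Lemma base_Rot_shear (s : shear) : shear_sign s = false -> s = (Rot s.1.1, s.2).
Proof. by case: s => [[a []] f]. Qed.
Lemma base_Ref_shear (s : shear) : shear_sign s = true -> s = mirror s.1.1 s.2.
Proof. by case: s => [[a []] f]. Qed.

End ShearGroup.

Section ShearPrime.
Variables (p : nat) (R : finZmodType).
Hypotheses (p_pr : prime p) (p_odd : odd p).
Local Open Scope ring_scope.
Let p1 : (1 < p)%N := prime_gt1 p_pr.

Lemma sum_progression (z : 'Z_p -> R) (x d : 'Z_p) : d != 0 ->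
  \sum_(k < p) z (x + d *+ k) = \sum_y z y.
Proof.
move=> d0; have dp (k : nat) : (d *+ k == 0) = (p %| k)%N.
  rewrite Zp_mulrn_eq0 // Euclid_dvdM // -[(p %| d)%N]Zp_nat_eq0 // natr_Zp.
  by rewrite (negPf d0).
pose h (k : 'I_p) : 'Z_p := x + d *+ k.
have h_inj : injective h.
  have H (k l : 'I_p) : (k <= l)%N -> h k = h l -> k = l.
    move=> kl /addrI e; have : d *+ (l - k) == 0 by rewrite mulrnBr // e subrr.
    rewrite dp => /dvdnP[q lk]; apply: val_inj => /=.
    have : (l - k < p)%N by apply: leq_ltn_trans (leq_subr _ _) _.
    rewrite lk; case: q lk => [|q] lk; last by rewrite mulSn ltnNge leq_addr.
    by move=> _; apply/eqP; rewrite eqn_leq kl -subn_eq0 lk.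
  move=> k l e; case/orP: (leq_total k l) => kl; first exact: H.
  by apply: esym; apply: H.
have /(@inj_card_bij _ _ _ h_inj) h_bij : (#|'Z_p| <= #|'I_p|)%N.
  by rewrite !card_ord Zp_cast.
by rewrite [RHS](reindex h) //; apply: onW_bij.
Qed.

Lemma mirror_pair_eq (a : 'Z_p) (f g : {ffun 'Z_p -> R}) m : (forall x, f (a - x) = f x) ->
  ((mirror a f * mirror a g) ^+ m == 1 :> shear 'Z_p R)%g =
  [forall x, (f x - g x) *+ m == 0].
Proof.
move=> fa; rewrite mirror_mul subrr rot_shearX mul0rn; apply/eqP/forallP.
  case=> /ffunP e x; have := e x; rewrite !ffunE.
  under eq_bigr do rewrite mul0rn addr0 ffunE fa.
  by rewrite sumr_const card_ord => ->.
move=> e; congr (_, _); apply/ffunP => x; rewrite !ffunE.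
under eq_bigr do rewrite mul0rn addr0 ffunE fa.
by rewrite sumr_const card_ord; apply/eqP.
Qed.

(** The axis part of the product is a nontrivial rotation; its orbit is all of Z/p, so the p-th
    power translates every fibre by the difference of the two sums. *)
Lemma mirror_pair_neq (a b : 'Z_p) (f g : {ffun 'Z_p -> R}) m : a != b ->
  ((mirror a f * mirror b g) ^+ m == 1 :> shear 'Z_p R)%g =
  (p %| m)%N && ((\sum_x f x - \sum_x g x) *+ (m %/ p) == 0).
Proof.
move=> ab; have d0 : a - b != 0 by rewrite subr_eq0.
have [/dvdnP[q ->]|npm] /= := boolP (p %| m)%N; last first.
  apply/negbTE; apply: contra npm => /eqP; rewrite mirror_mul rot_shearX => -[e _].
  have := e; move/eqP; rewrite Zp_mulrn_eq0 // Euclid_dvdM //.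
  by rewrite -[(p %| (a - b)%R)%N]Zp_nat_eq0 // natr_Zp (negPf d0).
rewrite mulnK ?prime_gt0 // mulnC expgM mirror_mul rot_shearX.
have -> : (a - b) *+ p = 0 by apply/eqP; rewrite Zp_mulrn_eq0 // dvdn_mull.
rewrite rot_shearX mul0rn.
have sE x : \sum_(k < p) [ffun x => f (b - x) - g x] (x + (a - b) *+ k) =
    \sum_x f x - \sum_x g x.
  rewrite (sum_progression [ffun x => f (b - x) - g x]) //.
  under eq_bigr do rewrite ffunE.
  rewrite big_split sumrN /=; congr (_ - _).
  rewrite (reindex (fun x => b - x)) /=; first by under eq_bigr do rewrite subKr.
  by apply: onW_bij; exists (fun y => b - y) => y; rewrite subKr.
have tE x : \sum_(k < q) [ffun x => \sum_(k < p) [ffun x => f (b - x) - g x]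
    (x + (a - b) *+ k)] (x + 0 *+ k) = (\sum_x f x - \sum_x g x) *+ q.
  under eq_bigr do rewrite ffunE sE.
  by rewrite sumr_const card_ord.
apply/eqP/eqP => [[/ffunP/(_ 0)]|e]; first by rewrite !ffunE tE.
by congr (_, _); apply/ffunP => x; rewrite !ffunE tE.
Qed.

Definition half (a : 'Z_p) : 'Z_p := a *+ (p.+1)./2.

Lemma halfD a : half a + half a = a.
Proof.
rewrite -mulr2n -mulrnA muln2 -{2}[a]mulr1n; apply/eqP; rewrite -subr_eq0 -mulrnBr.
  by rewrite halfK /= p_odd subn0 subn1 Zp_mulrn_eq0 // dvdn_mull.
by rewrite halfK /= p_odd subn0.
Qed.

Definition even_fun (f : {ffun 'Z_p -> R}) := [forall x, f (- x) == f x].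
Definition evenf : finType := {f : {ffun 'Z_p -> R} | even_fun f}.

(** x |-> a - x fixes [half a]. Moving this point to 0 parametrises the involutions with axis [a] by
    even functions, independently of [a]. *)
Definition recenter (a : 'Z_p) (f : {ffun 'Z_p -> R}) : {ffun 'Z_p -> R} :=
  [ffun x => f (x - half a)].
Definition uncenter (a : 'Z_p) (f : {ffun 'Z_p -> R}) : {ffun 'Z_p -> R} :=
  [ffun x => f (x + half a)].

Lemma recenterK a : cancel (recenter a) (uncenter a).
Proof. by move=> f; apply/ffunP => x; rewrite !ffunE addrK. Qed.
Lemma uncenterK a : cancel (uncenter a) (recenter a).
Proof. by move=> f; apply/ffunP => x; rewrite !ffunE subrK. Qed.

Lemma recenter_sym a (f : {ffun 'Z_p -> R}) : even_fun f -> forall x, recenter a f (a - x) = recenter a f x.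
Proof.
move=> /forallP ef x; rewrite !ffunE -(eqP (ef (x - half a))); congr (f _).
by rewrite -{1}(halfD a) addrAC addrK opprB.
Qed.

Lemma uncenter_even a (f : {ffun 'Z_p -> R}) :
  (forall x, f (a - x) = f x) -> even_fun (uncenter a f).
Proof.
move=> fa; apply/forallP => x; rewrite !ffunE -[X in _ == X]fa; apply/eqP; congr (f _).
by rewrite -{2}(halfD a) opprD addrACA subrr addr0 addrC.
Qed.

Lemma sum_recenter a (f : {ffun 'Z_p -> R}) : \sum_x recenter a f x = \sum_x f x.
Proof.
rewrite [RHS](reindex (fun x => x - half a)) /=; first by under eq_bigr do rewrite ffunE.
by apply: onW_bij; exists (fun x => x + half a) => x; rewrite ?addrK ?subrK.
Qed.

Definition delta (y : R) : {ffun 'Z_p -> R} := [ffun x => if x == 0 then y else 0].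

Lemma delta_even y : even_fun (delta y).
Proof. by apply/forallP => x; rewrite !ffunE oppr_eq0. Qed.

Lemma sum_delta y : \sum_x delta y x = y.
Proof.
rewrite (bigD1 0) //= ffunE eqxx big1 ?addr0 // => x /negPf x0.
by rewrite ffunE x0.
Qed.

Lemma even_funD (f g : {ffun 'Z_p -> R}) : even_fun f -> even_fun g -> even_fun [ffun x => f x + g x].
Proof.
by move=> /forallP ef /forallP eg; apply/forallP => x; rewrite !ffunE (eqP (ef x)) (eqP (eg x)).
Qed.

Lemma even_funB (f g : {ffun 'Z_p -> R}) : even_fun f -> even_fun g -> even_fun [ffun x => f x - g x].
Proof.
by move=> /forallP ef /forallP eg; apply/forallP => x; rewrite !ffunE (eqP (ef x)) (eqP (eg x)).
Qed.

Definition ref0 (a : 'Z_p) (f : evenf) : shear 'Z_p R := mirror a (recenter a (val f)).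

Lemma ref0_inv a f : (ref0 a f * ref0 a f = 1)%g.
Proof. by apply/mirror2/recenter_sym/(valP f). Qed.

Lemma ref0_pair_eq a f g m : ((ref0 a f * ref0 a g) ^+ m == 1)%g =
  [forall x, (val f x - val g x) *+ m == 0].
Proof.
rewrite mirror_pair_eq; last exact: recenter_sym (valP f).
apply/forallP/forallP => H x.
  by have := H (x + half a); rewrite !ffunE addrK.
by rewrite !ffunE; apply: H.
Qed.

Lemma ref0_pair_neq a b f g m : a != b -> ((ref0 a f * ref0 b g) ^+ m == 1)%g =
  (p %| m)%N && ((\sum_x val f x - \sum_x val g x) *+ (m %/ p) == 0).
Proof. by move=> ab; rewrite mirror_pair_neq // !sum_recenter. Qed.

Lemma ref0_inj a : injective (ref0 a).
Proof.
move=> f g [e]; apply: val_inj; have := congr1 (uncenter a) e.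
by rewrite !recenterK.
Qed.

Lemma refE (s : shear 'Z_p R) : (s * s = 1)%g -> shear_sign s = true ->
  exists f, s = ref0 s.1.1 f.
Proof.
move=> s2 /base_Ref_shear e; rewrite e in s2.
exists (exist (fun f => is_true (even_fun f)) _ (uncenter_even ((mirror2 _ _).1 s2))).
by rewrite {1}e /ref0 /= uncenterK.
Qed.

End ShearPrime.

Lemma cox_tuple_one (D : coxgraph) (Q : finGroupType) :
  cox_tuple ([ffun=> 1%g] : {ffun cv D -> Q}).
Proof. by apply/cox_tupleP; split=> [v|u v _]; rewrite !ffunE ?mulg1 // expg1n. Qed.

Lemma tmap_one (D E : coxgraph) (te : tuple_equiv D E) (Q : finGroupType) :
  tmap te ([ffun=> 1%g] : {ffun cv D -> Q}) = [ffun=> 1%g].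
Proof.
have hM : {morph (fun _ : Q => 1%g : Q) : x y / (x * y)%g} by move=> x y; rewrite mulg1.
transitivity (tmap te [ffun v => (fun _ : Q => 1%g : Q) (([ffun=> 1%g] : {ffun cv D -> Q}) v)]).
  by congr tmap; apply/ffunP => v; rewrite !ffunE.
rewrite (tmap_nat te hM (cox_tuple_one D Q)).
by apply/ffunP => v; rewrite !ffunE.
Qed.

(** A sign tuple on the rigid [E] is constant, and the trivial one corresponds to the trivial
    one. *)
Lemma tmap_sign (D E : coxgraph) (te : tuple_equiv D E) (Q : finGroupType)
  (s : Q -> parity) (t : {ffun cv D -> Q}) : {morph s : x y / (x * y)%g} ->
  parity_rigid E -> cox_tuple t -> (exists v, s (t v) = true) ->
  forall i, s (tmap te t i) = true.
Proof.
move=> sM [_ rE] Ht [v sv] i.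
have Hs := cox_tuple_fcomp sM (tmapP te Ht).
case E1 : (s (tmap te t i)) => //.
have e : fcomp s (tmap te t) = [ffun=> 1%g].
  by apply/ffunP => j; rewrite (rE _ Hs j i) !ffunE E1.
have : tmap te (fcomp s t) = tmap te [ffun=> 1%g].
  by rewrite tmap_one -e /fcomp tmap_nat.
move/(tmap_inj _ _) => /(_ (cox_tuple_fcomp sM Ht) (cox_tuple_one _ _)).
by move/ffunP/(_ v); rewrite !ffunE sv.
Qed.

Section Cross.
Variables (D E : coxgraph) (te : tuple_equiv D E) (n p r : nat).
Hypotheses (E4 : #|cv E| = 4) (Ec : connected_cox E)
  (En : forall i j : cv E, cedge i j -> clab i j = n) (n_odd : odd n)
  (p_pr : prime p) (r_pr : prime r) (pr : p != r) (pn : p %| n) (rn : r %| n).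
Variable (c : cv D -> 'I_4).
Hypothesis (cP : forall u v, cedge u v -> ~~ (p %| clab u v) -> c u = c v).
Local Open Scope ring_scope.

Let p_odd : odd p.
Proof.
by apply: contraTT pn => ep; apply/negP => /(dvdn_odd)/(_ n_odd); rewrite (negPf ep).
Qed.
Let r_odd : odd r.
Proof.
by apply: contraTT rn => ep; apply/negP => /(dvdn_odd)/(_ n_odd); rewrite (negPf ep).
Qed.
Let p1 := prime_gt1 p_pr.
Let r1 := prime_gt1 r_pr.

Let R : finZmodType := 'Z_r.
Let Ev : finType := evenf p R.
Let Ev0 : finType := {f : {ffun 'Z_p -> R} | even_fun f && (\sum_x f x == 0)}.

Let Rmul (x : R) m : (r %| m)%N -> x *+ m = 0.
Proof. by move=> rm; apply/eqP; rewrite Zp_mulrn_eq0 // dvdn_mull. Qed.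

Let zero0 : Ev0.
Proof.
exists [ffun=> 0]; apply/andP; split; first by apply/forallP => x; rewrite !ffunE.
by rewrite big1 // => x _; rewrite ffunE.
Defined.

(** Point masses 1 at 1 and -1 balanced by -2 at 0, where the value is nonzero as [r] is odd. *)
Let bump0 : {w : Ev0 | w != zero0}.
Proof.
pose f : {ffun 'Z_p -> R} := [ffun x => (if x == 1 then 1 else 0) +
  (if x == - 1 then 1 else 0) - (if x == 0 then 2%:R else 0)].
have f_ev : even_fun f.
  apply/forallP => x; rewrite !ffunE oppr_eq0 eqr_oppLR eqr_opp.
  by rewrite (addrC (if x == -1 then _ else _)).
have sum1 (a : 'Z_p) (y : R) : \sum_x (if x == a then y else 0) = y.
  by rewrite -big_mkcond big_pred1_eq.
have f_s : \sum_x f x == 0.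
  under eq_bigr do rewrite ffunE.
  by rewrite big_split sumrN big_split /= !sum1 subrr.
have fP : even_fun f && (\sum_x f x == 0) by rewrite f_ev.
exists (exist (fun f => is_true (even_fun f && (\sum_x f x == 0))) f fP).
apply/eqP => /(congr1 val) /= /ffunP/(_ 0); rewrite !ffunE eqxx.
have Z10 : (0 == 1 :> 'Z_p) = false by rewrite eq_sym (Zp_nat_eq0 1) // dvdn1 gtn_eqF.
have Z1N : (0 == - 1 :> 'Z_p) = false by rewrite eq_sym oppr_eq0 eq_sym.
rewrite Z10 Z1N addr0 add0r => /eqP; rewrite oppr_eq0 Zp_nat_eq0 //.
by rewrite dvdn_prime2 // => /eqP r2; move: r_odd; rewrite r2.
Qed.

Let card_Ev : (#|Ev| <= #|R| * #|Ev0|)%N.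
Proof.
pose g (f : Ev) := [ffun x => val f x - delta p (\sum_y val f y) x].
have gP f : even_fun (g f) && (\sum_x g f x == 0).
  rewrite even_funB ?(valP f) ?delta_even //=.
  under eq_bigr do rewrite ffunE.
  by rewrite big_split sumrN /= sum_delta subrr.
pose G (f : Ev) : R * Ev0 := (\sum_y val f y,
  exist (fun f => is_true (even_fun f && (\sum_x f x == 0))) (g f) (gP f)).
rewrite -card_prod; apply: (leq_card G) => f f' [e1 e2].
apply: val_inj; apply/ffunP => x; have /ffunP/(_ x) := e2.
by rewrite !ffunE e1 => /addIr.
Qed.

(* In a lift of a dihedral tuple for E to the shear group the relations hold
   automatically, because n and n / p are divisible by r; hence a lift for D
   cannot be subject to more than the r-classes require. *)
Lemma edge_cross u v : cedge u v -> ~~ (r %| clab u v)%N -> c u = c v.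
Proof.
move=> uv rm; set i := c u.
have rigE := rigidE E4 Ec En n_odd; have rigD := rigidD te E4 Ec En n_odd.
pose a : {ffun cv D -> 'Z_p} := [ffun x => if c x == i then 1 else 0].
have aP x y : a x = a y -> (c x == i) = (c y == i).
  rewrite !ffunE; have Z10 : (1 == 0 :> 'Z_p) = false.
    by rewrite (Zp_nat_eq0 1) // dvdn1 gtn_eqF.
  by case: (c x == i); case: (c y == i) => // /eqP; rewrite ?Z10 // eq_sym Z10.
pose phi : {ffun cv D -> dihedral 'Z_p} := [ffun x => Ref (a x)].
have cedgeP x y : cedge x y -> a x != a y -> (p %| clab x y)%N.
  move=> xy; apply: contraR => pm.
  by rewrite !ffunE (cP xy pm).
have Hphi : cox_tuple phi.
  apply/cox_tupleP; split=> [x|x y xy]; rewrite !ffunE ?Ref2 //.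
  rewrite -[in Ref _](ffunE (fun x => if c x == i then 1 else 0)).
  rewrite -[in X in (_ * X)%g](ffunE (fun x => if c x == i then 1 else 0)) -/a.
  rewrite RefB RotX; apply/eqP; rewrite Rot_eq1.
  have [->|/cedgeP pm] := eqVneq (a x) (a y); first by rewrite subrr mul0rn.
  by rewrite Zp_mulrn_eq0 // dvdn_mull // pm.
have Hlifts := card_lifts te (@shear_baseM 'Z_p R) Hphi.
pose e_r : rel (cv D) := edges_with (fun m => ~~ (r %| m)%N).
(* Across different axes only the sums of the two functions are compared, so the part of sum zero is
   constrained only by the edges of [e_r] within one axis. *)
pose e' : rel (cv D) := fun x y => e_r x y && (a x == a y).
have e_rs : symmetric e_r := @edges_with_sym _ _.
have e's : symmetric e' by move=> x y; rewrite /e' e_rs eq_sym.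
have cR : #|R| = r by rewrite card_ord Zp_cast.
have card_r : #|invariant_fun e_r R| = (#|R| ^ 4)%N.
  have := card_prime_power_invariant te E4 Ec En n_odd 0 r_pr r_odd.
  by rewrite expn1 rn cR.
have ncomp4 : n_comp e_r predT = 4.
  by move/eqP: card_r; rewrite card_invariant_fun // eqn_exp2l ?cR // => /eqP.
have upper : (#|[pred t : {ffun cv E -> shear 'Z_p R} |
    cox_tuple t & fcomp (@shear_base _ _) t == tmap te phi]| <= #|Ev| ^ 4)%N.
  rewrite -E4 -card_ffun.
  have sgn t j : cox_tuple t && (fcomp (@shear_base _ _) t == tmap te phi) ->
      exists f : Ev, t j = ref0 (tmap te phi j).1 f.
    case/andP=> /cox_tupleP[t2 _] /eqP/ffunP/(_ j); rewrite ffunE => e.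
    have s1 : shear_sign (t j) = true.
      rewrite /shear_sign -[(t j).1]/(shear_base (t j)) e.
      apply: (tmap_sign te (@dih_signM 'Z_p) rigE Hphi).
      by exists u; rewrite ffunE.
    have [f ef] := refE p_pr p_odd (t2 j) s1; exists f.
    by rewrite {1}ef -e.
  pose z : Ev := exist (fun f => is_true (even_fun f)) _ (delta_even p (0 : R)).
  pose G (t : {ffun cv E -> shear 'Z_p R}) : {ffun cv E -> Ev} :=
    [ffun j => insubd z (uncenter (t j).1.1 (t j).2)].
  apply: (leq_card_inj_on (f := G)) => // t t' Ht Ht' /ffunP e.
  apply/ffunP => j; have := e j; rewrite !ffunE.
  have [f ->] := sgn t j Ht; have [f' ->] := sgn t' j Ht'.
  by rewrite /= !recenterK !valKd => ->.
(* Sum and sum-zero part are chosen independently. With |Ev| <= |R| |Ev0| and [upper], this leaves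
   at most |Ev0|^4 functions invariant under [e'], the number for [e_r]. *)
have lower : (#|invariant_fun e_r R| * #|invariant_fun e' Ev0| <=
   #|[pred t : {ffun cv D -> shear 'Z_p R} |
    cox_tuple t & fcomp (@shear_base _ _) t == phi]|)%N.
  pose mk (rho : R) (f : Ev0) : {ffun 'Z_p -> R} := [ffun x => val f x + delta p rho x].
  have mkP rho f : even_fun (mk rho f).
    by apply: even_funD; rewrite ?delta_even //; have /andP[] := valP f.
  have mk_sum rho f : \sum_x mk rho f x = rho.
    under eq_bigr do rewrite ffunE.
    by rewrite big_split sum_delta; have /andP[_ /eqP ->] := valP f; rewrite /= add0r.
  pose mkE rho f : Ev := exist (fun f => is_true (even_fun f)) _ (mkP rho f).
  pose G (x : {ffun cv D -> R} * {ffun cv D -> Ev0}) : {ffun cv D -> shear 'Z_p R} :=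
    [ffun w => ref0 (a w) (mkE (x.1 w) (x.2 w))].
  rewrite -cardX; apply: (leq_card_inj_on (f := G)) => [[rho psi]|].
    rewrite inE /= => /andP[/invariant_funP Hr /invariant_funP Hp].
    apply/andP; split; last by apply/eqP/ffunP => w; rewrite !ffunE.
    apply/cox_tupleP; split=> [w|w x wx].
      by rewrite [G _ _]ffunE ref0_inv.
    rewrite ![G _ _]ffunE /=; apply/eqP.
    have [aw|aw] := eqVneq (a w) (a x).
      rewrite aw ref0_pair_eq //; apply/forallP => y.
      have [rwx|rwx] := boolP (r %| clab w x)%N; first by rewrite Rmul.
      have wx' : e_r w x by rewrite /e_r /edges_with wx.
      rewrite (Hr w x) // (Hp w x) ?subrr ?mul0rn //.
      by rewrite /e' wx' aw eqxx.
    rewrite ref0_pair_neq // cedgeP //= !mk_sum.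
    have [rwx|rwx] := boolP (r %| clab w x)%N.
      rewrite Rmul //; have := rwx; rewrite -{1}(divnK (cedgeP _ _ wx aw)).
      by rewrite Gauss_dvdl // prime_coprime // dvdn_prime2 // eq_sym.
    by rewrite (Hr w x) ?subrr ?mul0rn // /e_r /edges_with wx.
  move=> [rho psi] [rho' psi'] _ _ /ffunP e.
  have E2 w : rho w = rho' w /\ psi w = psi' w.
    have := e w; rewrite !ffunE => /ref0_inj/(congr1 val) /= em.
    have er : rho w = rho' w by rewrite -(mk_sum (rho w) (psi w)) em mk_sum.
    split=> //; apply: val_inj; apply/ffunP => x; have /ffunP/(_ x) := em.
    by rewrite !ffunE er => /addIr.
  by congr (_, _); apply/ffunP => w; have [] := E2 w.
have le1 : (#|invariant_fun e' Ev0| <= #|invariant_fun e_r Ev0|)%N.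
  rewrite (card_invariant_fun e_rs) ncomp4 -(leq_pmul2l (m := #|R| ^ 4)).
    rewrite -{1}card_r; apply: leq_trans lower _; rewrite Hlifts.
    by apply: leq_trans upper _; rewrite -expnMn leq_exp2r.
  by rewrite expn_gt0 cR prime_gt0.
have e'r x y : e' x y -> e_r x y by case/andP.
have eqI : #|invariant_fun e' Ev0| = #|invariant_fun e_r Ev0|.
  apply/eqP; rewrite eqn_leq le1; apply/subset_leq_card/subsetP => f /invariant_funP Hf.
  by apply/invariant_funP => x y /e'r; apply: Hf.
have [w w0] := bump0.
pose psi : {ffun cv D -> Ev0} := [ffun x => if c x == i then w else zero0].
have : psi \in invariant_fun e_r Ev0.
  rewrite -(invariant_subset_eq e'r eqI); apply/invariant_funP => x y /andP[_ /eqP/aP].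
  by rewrite !ffunE => ->.
move/invariant_funP/(_ u v); rewrite /e_r /edges_with uv rm !ffunE eqxx => /(_ isT).
case: eqP => [->//|_] e; by rewrite e eqxx in w0.
Qed.

End Cross.

(** * Odd labels: the graph of classes *)

(** The elements of sign [false] have exponent dividing p^k; this covers the dihedral, shear and
    matrix groups alike. *)
Definition p_by_two (p k : nat) (Q : finGroupType) (s : Q -> parity) :=
  {morph s : x y / (x * y)%g} /\ forall x, s x = false -> (x ^+ (p ^ k) = 1)%g.

Lemma p_by_two_prod p k (Q : finGroupType) (s : Q -> parity) (x y : Q) :
  p_by_two p k s -> s x = s y -> ((x * y) ^+ (p ^ k) = 1)%g.
Proof. by case=> sM H e; apply: H; rewrite sM e parityM addbb. Qed.

Lemma p_order_dvd (p k b : nat) (Q : finGroupType) (x : Q) (m m' : nat) :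
  prime p -> (x ^+ (p ^ k) = 1)%g -> (x ^+ m = 1)%g -> ~~ (p ^ b.+1 %| m) ->
  p ^ b %| m' -> (x ^+ m' = 1)%g.
Proof.
move=> p_pr /eqP; rewrite -order_dvdn => /(dvdn_pfactor _ _ p_pr)[j _ ej].
move=> /eqP; rewrite -order_dvdn ej => jm npm bm.
apply/eqP; rewrite -order_dvdn ej; apply: dvdn_trans bm; rewrite dvdn_exp2l // -ltnS ltnNge.
by apply: contra npm => bj; apply: dvdn_trans jm; rewrite dvdn_exp2l.
Qed.

Lemma conn_code_connected (g : rel 'I_4) (gs : symmetric g) (gi : irreflexive g)
  n (n2 : 2 <= n) : conn_code (code g) -> connected_cox (const_cox gs gi n2).
Proof.
move=> /allP cg i j; apply: contraT => nij.
pose f : {ffun 'I_4 -> 'I_2} := [ffun k => if connect g i k then ord0 else ord_max].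
have := cg _ (ffun_word_mem f); rewrite /nonconst /splits => /implyP H.
have /has4P[k [l]] : has4 (fun k l => adj (code g) k l &&
    (nth 0 (ffun_word f) k != nth 0 (ffun_word f) l)).
  apply: H; apply/has4P; exists i, j; rewrite !nth_ffun_word !ffunE connect0.
  by rewrite (negPf nij).
rewrite -adj_code // !nth_ffun_word !ffunE => /andP[kl].
by rewrite (same_connect_r (sym_connect_sym gs) (connect1 kl)) eqxx.
Qed.

Section Descent.
Variables (D : coxgraph) (n p b : nat) (c : cv D -> 'I_4).
Hypotheses (rD : parity_rigid D) (p_pr : prime p) (n_odd : odd n) (n2 : 2 <= n)
  (c_surj : forall i, exists u, c u = i)
  (cP : forall u v, c u = c v <-> connect (edges_with (fun m => ~~ (p %| m))) u v)
  (cb : forall u v, cedge u v -> ~~ (p ^ b %| clab u v) -> c u = c v)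
  (bn : p ^ b %| n) (bn1 : ~~ (p ^ b.+1 %| n)).

Let g := quo_rel c (fun m => ~~ (p ^ b.+1 %| m)).
Let G := const_cox (@quo_sym D c (fun m => ~~ (p ^ b.+1 %| m)))
                   (@quo_irr D c (fun m => ~~ (p ^ b.+1 %| m))) n2.
Hypothesis gc : conn_code (code g).

Lemma rigid_quo : parity_rigid G.
Proof.
apply: parity_rigidP; apply: (@card_parity_connected _ n) => //.
  by rewrite card_ord.
exact: conn_code_connected.
Qed.

Lemma p_by_two_class k (Q : finGroupType) (s : Q -> parity) (t : {ffun cv D -> Q}) :
  p_by_two p k s -> cox_tuple t -> forall u v, c u = c v -> t u = t v.
Proof.
move=> Qs Ht u v /cP; apply: invariant_connect; apply/invariant_funP => x y /andP[xy pm].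
have /cox_tupleP[t2 tX] := Ht; apply: inv_prod_eq1 => //.
have := rD.2 _ (cox_tuple_fcomp Qs.1 Ht) x y; rewrite !ffunE => e.
apply: (expg_coprime_eq1 _ (tX _ _ xy) (p_by_two_prod Qs e)).
by rewrite coprime_sym coprimeXl // prime_coprime.
Qed.

(** An edge of the quotient graph comes from a label not divisible by p^(b+1), which leaves order at
    most p^b, a divisor of [n]. No bound on the exponent [k] enters, so this also serves the matrix
    groups. *)
Lemma descend k (Q : finGroupType) (s : Q -> parity) (t : {ffun cv D -> Q}) :
  p_by_two p k s -> cox_tuple t ->
  exists2 t' : {ffun cv G -> Q}, cox_tuple t' & t = pull c t'.
Proof.
move=> Qs Ht; have [t' e] := pull_exists c_surj (p_by_two_class Qs Ht).
exists t'; last exact: e.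
have /cox_tupleP[t2 tX] := Ht.
apply/cox_tupleP; split=> [i|i j gij].
  by have [u <-] := c_surj i; have := t2 u; rewrite e !ffunE.
have [u [v [<- <- uv pm]]] := quo_relP gij.
have := tX _ _ uv; have := rD.2 _ (cox_tuple_fcomp Qs.1 Ht) u v.
rewrite e !ffunE => /(p_by_two_prod Qs) xk xm.
exact: p_order_dvd p_pr xk xm pm bn.
Qed.

(** Here the exponent p^(b+1) matters: it makes the labels divisible by p^(b+1) automatic, whether
    or not their classes are adjacent in the quotient graph. *)
Lemma ascend (Q : finGroupType) (s : Q -> parity) (t : {ffun cv G -> Q}) :
  p_by_two p b.+1 s -> cox_tuple t -> cox_tuple (pull c t).
Proof.
move=> Qs Ht; have /cox_tupleP[t2 tX] := Ht.
apply/cox_tupleP; split=> [u|u v uv]; rewrite !ffunE; first exact: t2.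
case: (c u =P c v) => [->|nc]; first by rewrite t2 expg1n.
have := rigid_quo.2 _ (cox_tuple_fcomp Qs.1 Ht) (c u) (c v); rewrite !ffunE.
move=> /(p_by_two_prod Qs) xk.
have [/dvdnP[q ->]|pm] := boolP (p ^ b.+1 %| clab u v).
  by rewrite mulnC expgM xk expg1n.
apply: p_order_dvd p_pr xk (tX _ _ _) bn1 _; first exact: quo_rel_edge uv pm nc.
by apply: contraT => /(cb uv).
Qed.

Lemma pull_c_inj (Q : finGroupType) : injective (pull c : {ffun cv G -> Q} -> _).
Proof.
move=> t1 t2 /ffunP e; apply/ffunP => i; have [u <-] := c_surj i.
by have := e u; rewrite !ffunE.
Qed.

Lemma card_descend (Q : finGroupType) (s : Q -> parity) : p_by_two p b.+1 s ->
  #|[pred t : {ffun cv D -> Q} | cox_tuple t]| =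
  #|[pred t : {ffun cv G -> Q} | cox_tuple t]|.
Proof.
move=> Qs; rewrite -[RHS](card_imset _ (@pull_c_inj Q)); apply: eq_card => t.
apply/idP/imsetP => [/(descend Qs)[t' Ht' ->]|[t' Ht' ->]]; first by exists t'.
exact: (ascend Qs Ht').
Qed.

Lemma card_lifts_descend (Q Q' : finGroupType) (s : Q -> parity) (h : Q -> Q')
  (phi : {ffun cv G -> Q'}) : p_by_two p b.+1 s ->
  #|[pred t : {ffun cv D -> Q} | cox_tuple t & fcomp h t == pull c phi]| =
  #|[pred t : {ffun cv G -> Q} | cox_tuple t & fcomp h t == phi]|.
Proof.
move=> Qs; rewrite -[RHS](card_imset _ (@pull_c_inj Q)); apply: eq_card => t.
have e (t' : {ffun cv G -> Q}) : fcomp h (pull c t') = pull c (fcomp h t').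
  by apply/ffunP => u; rewrite !ffunE.
apply/andP/imsetP => [[/(descend Qs)[t' Ht' ->]]|[t' /andP[Ht' /eqP <-] ->]].
  rewrite e => /eqP/pull_c_inj e'; exists t' => //.
  by rewrite inE; apply/andP; rewrite e'.
by split; [exact: (ascend Qs Ht') | rewrite e].
Qed.

End Descent.

Section ShearCount.
Variables (n p b : nat).
Hypotheses (p_pr : prime p) (n_odd : odd n) (n2 : 2 <= n)
  (bn : p ^ b.+1 %| n) (bn1 : ~~ (p ^ b.+2 %| n)).
Local Open Scope ring_scope.

Let pn : (p %| n)%N.
Proof. by apply: dvdn_trans bn; rewrite expnS dvdn_mulr. Qed.
Let p_odd : odd p.
Proof.
by apply: contraTT pn => ep; apply/negP => /(dvdn_odd)/(_ n_odd); rewrite (negPf ep).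
Qed.
Let p1 := prime_gt1 p_pr.
Let N := (p ^ b.+1)%N.
Let N1 : (1 < N)%N.
Proof. by rewrite /N -(expn0 p) ltn_exp2l. Qed.
Let R : finZmodType := 'Z_N.
Let Q : finGroupType := shear 'Z_p R.
Let Ev : finType := evenf p R.

Let n_p : (1%R : 'Z_N) *+ (n %/ p) != 0.
Proof.
rewrite Zp_nat_eq0 //; apply: contra bn1 => d.
by rewrite -(divnK pn) expnSr dvdn_mul.
Qed.

Lemma shear_p_by_two : p_by_two p b.+2 (@shear_sign 'Z_p R).
Proof.
split=> // x /base_Rot_shear ->.
rewrite expnS expgM !rot_shearX.
have -> : x.1.1 *+ p = 0 by apply/eqP; rewrite Zp_mulrn_eq0 // dvdn_mull.
rewrite mul0rn; congr (_, _); apply/ffunP => y; rewrite !ffunE.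
under eq_bigr do rewrite mul0rn addr0.
by rewrite sumr_const card_ord; apply/eqP; rewrite Zp_mulrn_eq0 // dvdn_mull.
Qed.

Lemma dihedral_p_by_two : p_by_two p b.+2 (@dih_sign 'Z_p).
Proof.
split=> // x /dih_signF ->; rewrite RotX; apply/eqP; rewrite Rot_eq1 Zp_mulrn_eq0 //.
by rewrite dvdn_mull // expnS dvdn_mulr.
Qed.

(** Since p^b is the exact power of [p] in n/p, this says that the sums agree mod [p]. *)
Let cond (f f' : Ev) := (\sum_x val f x - \sum_x val f' x) *+ (n %/ p) == 0.

Let cond_sym f f' : cond f f' = cond f' f.
Proof. by rewrite /cond -opprB mulNrn oppr_eq0. Qed.

Let ev (y : R) : Ev := exist (fun f => is_true (even_fun f)) _ (delta_even p y).

Let cond_ev y y' : cond (ev y) (ev y') = ((y - y') *+ (n %/ p) == 0).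
Proof. by rewrite /cond /= !sum_delta. Qed.

Let pair_ok (a : 'Z_p) (f f' : Ev) : ((ref0 a f * ref0 a f') ^+ n = 1)%g.
Proof.
apply/eqP; rewrite ref0_pair_eq //; apply/forallP => x.
by rewrite Zp_mulrn_eq0 // dvdn_mull.
Qed.

Let pair_neq (a a' : 'Z_p) (f f' : Ev) : a != a' ->
  ((ref0 a f * ref0 a' f') ^+ n == 1)%g = cond f f'.
Proof. by move=> aa; rewrite ref0_pair_neq // pn. Qed.

Section Graph.
Variables (g : rel 'I_4) (gs : symmetric g) (gi : irreflexive g).
Let G := const_cox gs gi n2.

Definition dih_lift (a : {ffun 'I_4 -> 'Z_p}) : {ffun cv G -> dihedral 'Z_p} :=
  [ffun i => Ref (a i)].

Lemma dih_liftP a : cox_tuple (dih_lift a).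
Proof.
apply/cox_tupleP; split=> [i|i j _]; rewrite !ffunE ?Ref2 // RefB RotX.
by apply/eqP; rewrite Rot_eq1 Zp_mulrn_eq0 // dvdn_mull.
Qed.

Let good (a : {ffun 'I_4 -> 'Z_p}) : {pred {ffun 'I_4 -> Ev}} := [pred F : {ffun 'I_4 -> Ev} |
  [forall i, forall j, g i j && (a i != a j) ==> cond (F i) (F j)]].

Lemma card_lifts_good a :
  #|[pred t : {ffun cv G -> Q} | cox_tuple t & fcomp (@shear_base _ _) t == dih_lift a]|
  = #|good a|.
Proof.
pose H (F : {ffun 'I_4 -> Ev}) : {ffun cv G -> Q} := [ffun i => ref0 (a i) (F i)].
have H_inj : injective H.
  by move=> F F' /ffunP e; apply/ffunP => i; have := e i; rewrite !ffunE => /ref0_inj.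
rewrite -(card_imset _ H_inj); apply: eq_card => t; apply/andP/imsetP.
  case=> /cox_tupleP[t2 tX] /eqP/ffunP e.
  have /fin_all_exists[F tF] i : exists f : Ev, t i = ref0 (a i) f.
    have s1 : shear_sign (t i) = true.
      by have := e i; rewrite !ffunE /shear_sign -[(t i).1]/(shear_base (t i)) => ->.
    have [f ef] := refE p_pr p_odd (t2 i) s1; exists f.
    by rewrite ef; have := e i; rewrite !ffunE /shear_base => ->.
  exists [ffun i => F i]; last by apply/ffunP => i; rewrite !ffunE tF.
  rewrite inE; apply/forallP => i; apply/forallP => j; apply/implyP => /andP[gij aij].
  by rewrite !ffunE -(pair_neq _ _ aij) -!tF tX.
case=> F; rewrite inE => /forallP HF ->; split; last first.
  by apply/eqP/ffunP => i; rewrite !ffunE.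
apply/cox_tupleP; split=> [i|i j gij]; rewrite !ffunE; first by rewrite ref0_inv.
have [->|aij] := eqVneq (a i) (a j); first exact: pair_ok.
apply/eqP; rewrite pair_neq //.
by have /forallP/(_ j)/implyP := HF i; rewrite [g _ _]gij aij; apply.
Qed.

End Graph.

Let w (i j : 'I_4) := #|[pred F : {ffun 'I_4 -> Ev} | cond (F i) (F j)]|.

Let w_le i j i' j' : i != j -> i' != j' -> (w i j <= w i' j')%N.
Proof.
move=> ij ij'.
pose bb := tperm i' i j'; pose tau x := tperm bb j (tperm i' i x).
have tau_inj : injective tau by move=> x y /perm_inj/perm_inj.
have taui : tau i' = i.
  rewrite /tau tpermL tpermD //; last by rewrite eq_sym.
  by rewrite /bb; apply: contraNneq ij' => e; apply/eqP; apply: (@perm_inj _ (tperm i' i)); rewrite e tpermL.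
have tauj : tau j' = j by rewrite /tau -/bb tpermL.
have [tau' tauK tau'K] := injF_bij tau_inj.
apply: (leq_card_inj_on (f := fun F : {ffun 'I_4 -> Ev} => [ffun x => F (tau x)])).
  by move=> F; rewrite !inE !ffunE taui tauj.
move=> F F' _ _ /ffunP e; apply/ffunP => x; rewrite -(tau'K x).
by have := e (tau' x); rewrite !ffunE.
Qed.

Let w_eq i j i' j' : i != j -> i' != j' -> w i j = w i' j'.
Proof. by move=> ij ij'; apply/eqP; rewrite eqn_leq !w_le. Qed.

Let o0 : 'I_4 := ord0.
Let o1 : 'I_4 := ord_max.

Lemma bridge_lifts (g : rel 'I_4) (gs : symmetric g) (gi : irreflexive g) :
  bridge_code (code g) -> exists a : {ffun 'I_4 -> 'Z_p},
  #|[pred t : {ffun cv (const_cox gs gi n2) -> Q} |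
     cox_tuple t & fcomp (@shear_base _ _) t == dih_lift gs gi a]| = w o0 o1.
Proof.
case/hasP=> _ /ffun_word_surj[f ->] /has4P[i [j /and3P[gij fij /all4P H]]].
rewrite -adj_code // in gij; rewrite !nth_ffun_word in fij.
pose a : {ffun 'I_4 -> 'Z_p} := [ffun k => (f k)%:R].
have aE k l : (a k != a l) = (f k != f l :> nat).
  rewrite !ffunE; congr negb.
  have Z10 : (1 == 0 :> 'Z_p) = false by rewrite (Zp_nat_eq0 1) // dvdn1 gtn_eqF.
  case: (f k) (f l) => [[|[|?]] //] _ [[|[|?]] //] _ /=; by rewrite ?eqxx // eq_sym Z10.
have ij : i != j by apply: contraTneq gij => ->; rewrite gi.
exists a; rewrite card_lifts_good (w_eq (i := o0) (j := o1) _ ij) //.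
apply: eq_card => F; rewrite !inE; apply/forallP/idP => [HF|cF k].
  have /forallP/(_ j)/implyP := HF i; apply; by rewrite gij aE.
apply/forallP => l; apply/implyP => /andP[gkl]; rewrite aE => fkl.
have := H k l; rewrite -adj_code // !nth_ffun_word gkl fkl /=.
case/orP=> /eqP[/val_inj -> /val_inj ->] //; by rewrite cond_sym.
Qed.

(** Constant axes impose no condition and give more than [w] lifts; nonconstant axes impose at least
    two different conditions and give fewer. *)
Lemma two_cut_lifts (g : rel 'I_4) (gs : symmetric g) (gi : irreflexive g) :
  two_cut_code (code g) -> forall a : {ffun 'I_4 -> 'Z_p},
  #|[pred t : {ffun cv (const_cox gs gi n2) -> Q} |
     cox_tuple t & fcomp (@shear_base _ _) t == dih_lift gs gi a]| <> w o0 o1.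
Proof.
move=> /allP tc a; rewrite card_lifts_good.
pose f : {ffun 'I_4 -> 'I_2} := [ffun k => if a k == a o0 then ord0 else ord_max].
have fE k l : f k != f l :> nat -> a k != a l.
  by apply: contra => /eqP e; rewrite !ffunE e.
have := tc _ (ffun_word_mem f); case: (boolP (nonconst _)) => /= [_|nc _].
  case/has4P=> i [j /and3P[gij fij /has4P[i' [j' /and4P[gij' fij' n1 n2']]]]].
  rewrite -!adj_code // in gij gij'; rewrite !nth_ffun_word in fij fij'.
  have ij : i != j by apply: contraTneq gij => ->; rewrite gi.
  have ij' : i' != j' by apply: contraTneq gij' => ->; rewrite gi.
  apply/eqP; rewrite (w_eq (i := o0) (j := o1) _ ij) // neq_ltn; apply/orP; left.
  apply: proper_card; apply/properP; split.
    apply/subsetP => F; rewrite !inE => /forallP/(_ i)/forallP/(_ j)/implyP; apply.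
    by rewrite gij fE.
  (* Giving sum 1 to this vertex and 0 to all others violates the condition on the second edge but
     not that on the first. *)
  have [x [xi xj xij]] : exists x, [/\ x != i, x != j & (x == i') (+) (x == j')].
    have [/andP[a1 a2]|] := boolP ((i' != i) && (i' != j)).
      by exists i'; rewrite eqxx (negPf ij').
    rewrite negb_and !negbK => h1; exists j'; rewrite eqxx [_ == i']eq_sym (negPf ij').
    split=> //; case/orP: h1 => /eqP e; apply/negP => /eqP e'.
    - by rewrite e e' eqxx in ij'.
    - by rewrite e e' eqxx in n2'.
    - by rewrite e e' eqxx in n1.
    by rewrite e e' eqxx in ij'.
  exists [ffun k => ev (if k == x then 1 else 0)].
    by rewrite inE !ffunE ![_ == x]eq_sym (negPf xi) (negPf xj) cond_ev subrr mul0rn.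
  rewrite inE; apply/negP => /forallP/(_ i')/forallP/(_ j')/implyP.
  rewrite gij' fE //= => /(_ isT); rewrite !ffunE cond_ev ![_ == x]eq_sym.
  move: xij; case: (x == i'); case: (x == j') => //= _.
    by rewrite subr0; apply/negP.
  by rewrite sub0r mulNrn oppr_eq0; apply/negP.
apply/eqP; rewrite neq_ltn; apply/orP; right; apply: proper_card; apply/properP; split.
  apply/subsetP => F _; rewrite inE; apply/forallP => k; apply/forallP => l.
  have e m : a m = a o0.
    apply/eqP; apply: contraR nc => am; apply/has4P; exists m, o0.
    by rewrite !nth_ffun_word !ffunE eqxx (negPf am).
  by rewrite !e eqxx andbF.
exists [ffun k => ev (if k == o0 then 1 else 0)].
  rewrite inE; apply/forallP => k; apply/forallP => l.
  have e m : a m = a o0.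
    apply/eqP; apply: contraR nc => am; apply/has4P; exists m, o0.
    by rewrite !nth_ffun_word !ffunE eqxx (negPf am).
  by rewrite !e eqxx andbF.
rewrite inE !ffunE cond_ev /= subr0; exact: n_p.
Qed.

Lemma strict_sub_card (g h : rel 'I_4) (gs : symmetric g) (gi : irreflexive g)
  (hs : symmetric h) (hi : irreflexive h) : strict_sub_code (code g) (code h) ->
  (#|[pred t : {ffun cv (const_cox hs hi n2) -> Q} | cox_tuple t]| <
   #|[pred t : {ffun cv (const_cox gs gi n2) -> Q} | cox_tuple t]|)%N.
Proof.
case/hasP=> q /perms4P[s [s_inj sE]] /andP[/all4P sub /has4P[i [j /andP[ngij hij]]]].
rewrite -adj_code // in ngij; rewrite !sE -adj_code // in hij.
have gh k l : g k l -> h (s k) (s l).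
  by have := sub k l; rewrite !sE -!adj_code // => /implyP.
have ij : j != i by apply: contraTneq hij => ->; rewrite hi.
have [s' sK s'K] := injF_bij s_inj.
pose P (t : {ffun cv (const_cox hs hi n2) -> Q}) : {ffun cv (const_cox gs gi n2) -> Q} :=
  [ffun k : 'I_4 => t (s k)].
have P_inj : injective P.
  move=> t t' /ffunP e; apply/ffunP => k; rewrite -(s'K k).
  by have := e (s' k); rewrite !ffunE.
rewrite -(card_imset _ P_inj); apply: proper_card; apply/properP; split.
  apply/subsetP => _ /imsetP[t /cox_tupleP[t2 tX] ->]; apply/cox_tupleP.
  split=> [k|k l gkl]; rewrite !ffunE; first exact: t2.
  by rewrite (tX (s k) (s l)) //; apply: gh.
have Z10 : (1 == 0 :> 'Z_p) = false by rewrite (Zp_nat_eq0 1) // dvdn1 gtn_eqF.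
(* Only [i] has axis 1 and only [j] has sum 1, so [i], [j] is the one pair that differs in both. *)
pose t : {ffun cv (const_cox gs gi n2) -> Q} := [ffun k : 'I_4 =>
  ref0 (if k == i then 1 else 0) (ev (if k == j then 1 else 0))].
exists t.
  apply/cox_tupleP; split=> [k|k l gkl]; rewrite !ffunE; first by rewrite ref0_inv.
  have [e|nkl] := eqVneq (if k == i then 1 else 0 : 'Z_p) (if l == i then 1 else 0).
    by rewrite e pair_ok.
  apply/eqP; rewrite pair_neq // cond_ev; move: gkl nkl.
  case: (k =P i) => [->|_]; case: (l =P i) => [->|_]; rewrite ?eqxx //= => gkl _.
    case: (l =P j) gkl => [->|_] gkl; first by rewrite [g _ _]gkl in ngij.
    by rewrite [i == j]eq_sym (negPf ij) subrr mul0rn.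
  case: (k =P j) gkl => [->|_] gkl; first by rewrite gs [g _ _]gkl in ngij.
  by rewrite [i == j]eq_sym (negPf ij) subrr mul0rn.
apply/negP => /imsetP[t' /cox_tupleP[_ tX] /ffunP e].
have := tX _ _ hij; have := e i; have := e j; rewrite !ffunE => <- <-.
rewrite !eqxx (negPf ij) [i == j]eq_sym (negPf ij) => /eqP; rewrite pair_neq.
  by rewrite cond_ev sub0r mulNrn oppr_eq0; apply/negP.
by rewrite Z10.
Qed.

End ShearCount.

(** * Odd labels: unipotent matrices *)

Section Triangular.
Variables (p K : nat).
Hypotheses (p_pr : prime p) (p_odd : odd p).
Local Open Scope ring_scope.
Local Notation M := 'M['F_p]_K.+2.

Definition upper (d : nat) (A : M) := [forall i : 'I_K.+2, forall j : 'I_K.+2,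
  (j < i + d)%N ==> (A i j == 0)].

Lemma upperP d (A : M) : reflect (forall i j : 'I_K.+2, (j < i + d)%N -> A i j = 0) (upper d A).
Proof.
apply: (iffP forallP) => [H i j ij|H i].
  by have /forallP/(_ j)/implyP/(_ ij)/eqP := H i.
by apply/forallP => j; apply/implyP => /H ->.
Qed.

Lemma upperM d e (A B : M) : upper d A -> upper e B -> upper (d + e) (A * B).
Proof.
move=> /upperP HA /upperP HB; apply/upperP => i j ij.
rewrite -mulmxE mxE big1 // => k _.
have [ki|ik] := ltnP k (i + d); first by rewrite HA // mul0r.
by rewrite HB ?mulr0 // (leq_trans ij) // addnA leq_add2r.
Qed.

Lemma upper_top (A : M) : upper K.+2 A -> A = 0.
Proof.
move=> /upperP H; apply/matrixP => i j; rewrite mxE H //.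
by apply: leq_trans (ltn_ord j) _; rewrite leq_addl.
Qed.

Lemma upperX d (A : M) k : upper d A -> upper (k * d) (A ^+ k).
Proof.
move=> HA; elim: k => [|k IH]; last by rewrite exprS mulSn; apply: upperM.
by rewrite expr0; apply/upperP => i j; rewrite addn0 mxE => ji; rewrite -val_eqE gtn_eqF.
Qed.

Lemma upper_leq d e (A : M) : (e <= d)%N -> upper d A -> upper e A.
Proof.
move=> ed /upperP H; apply/upperP => i j ij; apply: H.
by apply: leq_trans ij _; rewrite leq_add2l.
Qed.

Lemma upper_diagM (A B : M) i : upper 0 A -> upper 0 B -> (A * B) i i = A i i * B i i.
Proof.
move=> /upperP HA /upperP HB; rewrite -mulmxE mxE (bigD1 i) //= big1 ?addr0 // => k ki.
have [lt|le] := ltnP k i; first by rewrite HA ?addn0 // mul0r.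
rewrite HB ?mulr0 // addn0 ltn_neqAle le andbT.
by rewrite eq_sym; apply: ki.
Qed.

Let sgn (e : bool) (i : nat) : 'F_p := (-1) ^+ (e && odd i).

(** Upper triangular with diagonal 1, 1, 1, ... or 1, -1, 1, ...: the unipotent group extended by
    one involution, with the sign readable at index 1. *)
Definition alternating (A : M) := upper 0 A &&
  [exists e : bool, forall i : 'I_K.+2, A i i == sgn e i].

Lemma alternatingP (A : M) : reflect (upper 0 A /\ exists e, forall i, A i i = sgn e i)
  (alternating A).
Proof.
apply: (iffP andP) => -[uA].
  by case/existsP=> e /forallP H; split=> //; exists e => i; apply/eqP.
by case=> e H; split=> //; apply/existsP; exists e; apply/forallP => i; rewrite H.
Qed.

Lemma alternatingM (A B : M) : alternating A -> alternating B -> alternating (A * B).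
Proof.
move=> /alternatingP[uA [e He]] /alternatingP[uB [e' He']]; apply/alternatingP; split.
  exact: (@upperM 0 0).
exists (e (+) e') => i; rewrite upper_diagM // He He' /sgn -signr_addb.
by case: (odd i); rewrite ?andbT ?andbF.
Qed.

Lemma alternating1 : alternating (1 : M).
Proof.
apply/alternatingP; split.
  by apply/upperP => i j; rewrite addn0 mxE => ji; rewrite -val_eqE gtn_eqF.
by exists false => i; rewrite mxE eqxx.
Qed.

Definition alt_set : {set {unit M}} := [set u | alternating (val u)].

Lemma alt_group_set : group_set alt_set.
Proof.
apply/group_setP; split=> [|u v]; first by rewrite inE alternating1.
by rewrite !inE; apply: alternatingM.
Qed.

Definition alt_group := fingroup.Group alt_group_set.
Definition altQ : finGroupType := subg_of alt_group.

Let o1 : 'I_K.+2 := inord 1.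

Definition alt_sign (x : altQ) : parity := val (val x) o1 o1 == -1.

Let m1 : (1 == -1 :> 'F_p) = false.
Proof.
apply/negbTE; rewrite -subr_eq0 opprK -mulr2n.
rewrite -(dvdn_pcharf (pchar_Fp p_pr)) dvdn_prime2 //.
by apply: contraTneq p_odd => ->.
Qed.

Let altE (x : altQ) : upper 0 (val (val x)) /\
  forall i, val (val x) i i = sgn (alt_sign x) i.
Proof.
have : val x \in alt_set := valP x.
rewrite inE => /alternatingP[uA [e He]]; split=> // i; rewrite He; congr (sgn _ _).
rewrite /alt_sign He /sgn /o1 inordK //= andbT.
by case: e {He}; rewrite ?eqxx ?m1.
Qed.

Let valM_ (x y : altQ) : val (val (x * y)%g) = val (val x) * val (val y).
Proof. by []. Qed.

Let valX_ (x : altQ) k : val (val (x ^+ k)%g) = val (val x) ^+ k.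
Proof. by elim: k => [|k IH] //; rewrite expgS valM_ IH exprS. Qed.

Lemma alt_signM : {morph alt_sign : x y / (x * y)%g}.
Proof.
move=> x y; have [ux ex] := altE x; have [uy ey] := altE y.
rewrite {1}/alt_sign valM_ upper_diagM // ex ey /sgn -signr_addb inordK //= !andbT.
by rewrite parityM; case: (_ (+) _); rewrite ?eqxx ?m1.
Qed.

Let pM : p \in [pchar M].
Proof.
rewrite inE p_pr /=; apply/eqP; rewrite -scaler_nat.
have /andP[_ /eqP ->] := pchar_Fp p_pr; exact: scale0r.
Qed.

Lemma unipotentX (A : M) k : (1 + A) ^+ (p ^ k) = 1 + A ^+ (p ^ k).
Proof.
elim: k => [|k IH]; first by rewrite expn0 !expr1.
rewrite expnSr exprM IH -(pFrobenius_autE pM) pFrobenius_autD_comm.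
  by rewrite !pFrobenius_autE expr1n -exprM.
exact: commr_sym (commr1 _).
Qed.

Lemma alt_p_by_two : p_by_two p K.+2 alt_sign.
Proof.
split; first exact: alt_signM.
move=> x sx; have [ux ex] := altE x; apply: val_inj; apply: val_inj; rewrite valX_ /=.
rewrite -[val (val x)](subrK 1) addrC unipotentX.
suff -> : (val (val x) - 1) ^+ (p ^ K.+2) = 0 by rewrite addr0.
apply: upper_top; apply: (@upper_leq (p ^ K.+2 * 1)).
  by rewrite muln1 ltnW // ltn_expl // prime_gt1.
apply: upperX; apply/upperP => i j; rewrite addn1 ltnS leq_eqVlt => /orP[/eqP/val_inj ->|ji].
  by rewrite !mxE eqxx ex sx subrr.
rewrite !mxE -val_eqE gtn_eqF // subr0.
by have /upperP := ux; apply; rewrite addn0.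
Qed.

(** The superdiagonal is split into odd rows [Xm] and even rows [Ym], so that each part squares to
    zero; conjugation by [Om] negates both. *)
Let Om : M := \matrix_(i, j) ((i == j)%:R * sgn true i).
Let Xm : M := \matrix_(i, j) ((j == i.+1 :> nat) && odd i)%:R.
Let Ym : M := \matrix_(i, j) ((j == i.+1 :> nat) && ~~ odd i)%:R.

Let step_sq (P : bool -> bool) (Z : M) : (forall b, P b -> ~~ P (~~ b)) ->
  (forall i j, Z i j = ((j == i.+1 :> nat) && P (odd i))%:R) -> Z * Z = 0.
Proof.
move=> HP HZ; apply/matrixP => i j; rewrite -mulmxE !mxE big1 // => k _.
rewrite !HZ; case: eqP => [->|_] /=; last by rewrite mul0r.
case: (boolP (P (odd i))) => [/HP/negPf Pi|_]; last by rewrite mul0r.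
by rewrite Pi andbF mulr0.
Qed.

Let XX : Xm * Xm = 0.
Proof. by apply: (@step_sq id) => [[]|i j] //; rewrite mxE. Qed.
Let YY : Ym * Ym = 0.
Proof. by apply: (@step_sq negb) => [[]|i j] //; rewrite mxE. Qed.

Let OmL (Z : M) i j : (Om * Z) i j = sgn true i * Z i j.
Proof.
rewrite -mulmxE mxE (bigD1 i) //= big1 ?addr0 => [|k /negPf ki].
  by rewrite mxE eqxx mul1r.
by rewrite mxE eq_sym ki !mul0r.
Qed.
Let OmR (Z : M) i j : (Z * Om) i j = Z i j * sgn true j.
Proof.
rewrite -mulmxE mxE (bigD1 j) //= big1 ?addr0 => [|k /negPf kj].
  by rewrite [Om _ _]mxE eqxx mul1r.
by rewrite [Om _ _]mxE kj mul0r mulr0.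
Qed.

Let OO : Om * Om = 1.
Proof.
apply/matrixP => i j; rewrite OmL !mxE; case: eqP => [->|_]; last by rewrite mul0r mulr0.
by rewrite mul1r /sgn -signr_addb addbb.
Qed.

Let anti (P : bool -> bool) (Z : M) :
  (forall i j, Z i j = ((j == i.+1 :> nat) && P (odd i))%:R) -> Z * Om = - (Om * Z).
Proof.
move=> HZ; apply/matrixP => i j; rewrite OmR [in RHS]mxE OmL HZ.
case: eqP => [->|_] /=; last by rewrite mul0r mulr0 oppr0.
by rewrite /sgn /= mulrC -mulNr; case: (odd i); rewrite /= ?expr0 ?expr1 ?opprK.
Qed.

Let XO : Xm * Om = - (Om * Xm).
Proof. by apply: (@anti id) => i j; rewrite mxE. Qed.
Let YO : Ym * Om = - (Om * Ym).
Proof. by apply: (@anti negb) => i j; rewrite mxE. Qed.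

Let twist2 (Z : M) : Z * Om = - (Om * Z) -> Z * Z = 0 ->
  (Om * (1 + Z)) * (Om * (1 + Z)) = 1.
Proof.
move=> ZO ZZ; rewrite mulrA -[Om * (1 + Z) * Om]mulrA mulrDl mul1r ZO.
rewrite mulrDr OO mulrN mulrA OO mul1r mulrDl mul1r mulrDr mulr1 mulNr ZZ oppr0 addr0.
by rewrite -addrA subrr addr0.
Qed.

Let unit_of (A : M) : A * A = 1 -> A \is a GRing.unit.
Proof. by move=> e; apply/unitrP; exists A. Qed.

Let memQ (A : M) (AA : A * A = 1) (HA : alternating A) :
  FinRing.Unit (unit_of AA) \in alt_group.
Proof. by rewrite inE. Qed.

Let mkQ (A : M) (AA : A * A = 1) (HA : alternating A) : altQ := Subg (memQ AA HA).

Let upperO : alternating Om.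
Proof.
apply/alternatingP; split.
  apply/upperP => i j; rewrite addn0 !mxE => ji.
  by rewrite -val_eqE gtn_eqF // mul0r.
by exists true => i; rewrite mxE eqxx mul1r.
Qed.

Let upper1Z (P : bool -> bool) (Z : M) :
  (forall i j, Z i j = ((j == i.+1 :> nat) && P (odd i))%:R) -> alternating (Om * (1 + Z)).
Proof.
move=> HZ; apply: alternatingM; first exact: upperO.
have ltS (i j : 'I_K.+2) : (j <= i)%N -> Z i j = 0.
  by move=> ji; rewrite HZ ltn_eqF.
apply/alternatingP; split.
  apply/upperP => i j; rewrite addn0 => ji; rewrite !mxE ltS ?addr0 1?ltnW //.
  by rewrite -val_eqE gtn_eqF.
by exists false => i; rewrite !mxE ltS // addr0 eqxx.
Qed.

(** With O = [Om], A = [Om] (1 + [Xm]), B = [Om] (1 + [Ym]), the products OA = 1 + [Xm] and OB = 1 +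
    [Ym] have p-th power 1, while AB = (1 - [Xm])(1 + [Ym]) is unipotent with a full
    superdiagonal. *)
Lemma long_product : exists O A B : altQ,
  [/\ (O * O = 1)%g, (A * A = 1)%g, (B * B = 1)%g,
      ((O * A) ^+ p = 1)%g & ((O * B) ^+ p = 1)%g] /\
  forall m, (0 < m <= K)%N -> ((A * B) ^+ m != 1)%g.
Proof.
have uX : alternating (Om * (1 + Xm)) by apply: (@upper1Z id) => i j; rewrite mxE.
have uY : alternating (Om * (1 + Ym)) by apply: (@upper1Z negb) => i j; rewrite mxE.
pose O := mkQ OO upperO; pose A := mkQ (twist2 XO XX) uX; pose B := mkQ (twist2 YO YY) uY.
have p_half (Z : M) : Z * Z = 0 -> (1 + Z) ^+ p = 1.
  move=> ZZ; have := unipotentX Z 1; rewrite expn1 => ->.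
  have Zk k : (1 < k)%N -> Z ^+ k = 0.
    by case: k => [|[|k]] // _; rewrite !exprS mulrA ZZ mul0r.
  by rewrite Zk ?addr0 // prime_gt1.
exists O, A, B; split.
  have ext (x y : altQ) : val (val x) = val (val y) -> x = y by move=> /val_inj/val_inj.
  split; apply: ext; rewrite ?valX_ valM_.
  - exact: OO.
  - exact: twist2.
  - exact: twist2.
  - by rewrite mulrA OO mul1r p_half.
  - by rewrite mulrA OO mul1r p_half.
pose N : M := - Xm + Ym - Xm * Ym.
have ABN : Om * (1 + Xm) * (Om * (1 + Ym)) = 1 + N.
  rewrite mulrA -[Om * (1 + Xm) * Om]mulrA mulrDl mul1r XO mulrDr OO mulrN mulrA OO mul1r.
  by rewrite mulrDl mul1r mulrDr mulr1 mulNr /N !addrA [1 + Ym - Xm]addrAC.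
have XmE i j : Xm i j = ((j == i.+1 :> nat) && odd i)%:R by rewrite mxE.
have YmE i j : Ym i j = ((j == i.+1 :> nat) && ~~ odd i)%:R by rewrite mxE.
have NE i j : N i j = - Xm i j + Ym i j - (Xm * Ym) i j.
  by rewrite /N [LHS]mxE [(- Xm + Ym) i j]mxE [(- Xm) i j]mxE [(- (Xm * Ym)) i j]mxE.
have XYu : upper 2 (Xm * Ym).
  apply: (@upperM 1 1); apply/upperP => i j; rewrite addn1 ltnS mxE => ji;
    by rewrite ltn_eqF.
have uN : upper 1 N.
  apply/upperP => i j ij; have ji : (j <= i)%N by rewrite addn1 ltnS in ij.
  rewrite NE XmE YmE ltn_eqF //= oppr0 add0r.
  by rewrite (upperP _ _ XYu) ?oppr0 ?addr0 // addn2 ltnS (leq_trans ji) // leqnSn.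
have Nsup (i j : 'I_K.+2) : j = i.+1 :> nat -> N i j != 0.
  move=> ji; rewrite NE XmE YmE ji eqxx /=.
  rewrite (upperP _ _ XYu) ?ji ?addn2 // subr0.
  by case: (odd i); rewrite /= ?addr0 ?oppr0 ?add0r ?oppr_eq0 oner_neq0.
(* This entry is the product of the first [j] superdiagonal entries of [N], the only path from 0 to
   [j] in [j] steps. *)
have Ntop j : (j < K.+2)%N -> (N ^+ j) ord0 (inord j) != 0.
  elim: j => [|j IH] jK.
    rewrite expr0 (_ : inord 0 = ord0) ?mxE ?eqxx ?oner_neq0 //.
    by apply: val_inj; rewrite /= inordK.
  rewrite exprSr -mulmxE mxE (bigD1 (inord j)) //= big1 ?addr0 => [|k kj].
    by rewrite mulf_neq0 ?IH ?Nsup ?inordK // ltnW.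
  have uj := upperX j uN; rewrite muln1 in uj.
  have [kj'|jk] := ltnP k j; first by rewrite (upperP _ _ uj) ?mul0r.
  rewrite (upperP _ _ uN) ?mulr0 // inordK // addn1 ltnS ltn_neqAle jk andbT.
  by apply: contra kj => /eqP e; rewrite -val_eqE /= inordK ?e // ltnW.
move=> m /andP[m0 mK]; apply/negP => /eqP ABm.
have AB0 : alt_sign (A * B)%g = false.
  have s1 (Z : M) (P : bool -> bool) ZZ uZ :
      (forall i j, Z i j = ((j == i.+1 :> nat) && P (odd i))%:R) ->
      alt_sign (@mkQ (Om * (1 + Z)) ZZ uZ) = true.
    move=> HZ; rewrite /alt_sign /= OmL 2!mxE eqxx HZ ltn_eqF // addr0 mulr1.
    by rewrite /sgn inordK // eqxx.
  rewrite alt_signM (s1 _ id) => [|i j]; last by rewrite mxE.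
  by rewrite (s1 _ negb) => [|i j]; last by rewrite mxE.
have /eqP := alt_p_by_two.2 _ AB0; rewrite -order_dvdn => /(dvdn_pfactor _ _ p_pr)[e _ oe].
have em : (p ^ e <= m)%N.
  by rewrite -oe dvdn_leq // order_dvdn ABm.
(* The order is a power p^e, and (1 + N)^(p^e) = 1 + N^(p^e) in characteristic [p], so p^e <= K
   contradicts [Ntop]. *)
have := expg_order (A * B)%g; rewrite oe => /(congr1 (fun x : altQ => val (val x))).
rewrite valX_ valM_ /= ABN unipotentX => /(congr1 (fun x => x - 1)).
rewrite addrAC subrr add0r => N0.
have := Ntop (p ^ e)%N; rewrite N0 mxE eqxx.
have -> : (p ^ e < K.+2)%N by rewrite ltnS (leq_trans em) // (leq_trans mK).
by move/(_ isT).
Qed.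

End Triangular.

(** * Odd labels: diagram twists *)

Section Conjugation.
Variable G : group.
Implicit Types g x y : G.

Definition gconj g x : G := gmul g (gmul x (ginv g)).

Lemma gconjM g x y : gconj g (gmul x y) = gmul (gconj g x) (gconj g y).
Proof. by rewrite /gconj -!gmulA gmulKg. Qed.

Lemma gconj1 g : gconj g (gone G) = gone G.
Proof. by rewrite /gconj gmul1g gmulgV. Qed.

Lemma gconjX g x k : gconj g (gpow x k) = gpow (gconj g x) k.
Proof. by elim: k => [|k IH] /=; rewrite ?gconj1 // gconjM IH. Qed.

Lemma gconjK g x : gconj (ginv g) (gconj g x) = x.
Proof. by rewrite /gconj ginvK -!gmulA gmulVg gmulg1 gmulKg. Qed.

Lemma gconjKV g x : gconj g (gconj (ginv g) x) = x.
Proof. by rewrite -{1}(ginvK g) gconjK. Qed.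

Lemma ginv_invol x : gmul x x = gone G -> ginv x = x.
Proof. by move/ginv_uniq. Qed.

Lemma gpow_swap x y n : gmul x x = gone G -> gpow (gmul x y) n = gone G ->
  gpow (gmul y x) n = gone G.
Proof.
move=> x2 e; rewrite -(gconj1 x) -e gconjX; congr gpow.
by rewrite /gconj ginv_invol // -gmulA gmulA x2 gmul1g.
Qed.

Lemma gpowD x a b : gpow x (a + b) = gmul (gpow x a) (gpow x b).
Proof. by elim: a => [|a IH] /=; rewrite ?gmul1g // IH gmulA. Qed.

Lemma odd_dihedral_conj x y n : odd n -> gmul x x = gone G -> gmul y y = gone G ->
  gpow (gmul x y) n = gone G -> gconj (gpow (gmul x y) n.+1./2) y = x.
Proof.
move=> on x2 y2 xyn.
have flip k : gmul y (ginv (gpow (gmul x y) k)) = gmul (gpow (gmul x y) k) y.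
  have e : gconj y (gmul x y) = ginv (gmul x y).
    rewrite ginvMg !ginv_invol // /gconj ginv_invol //.
    by rewrite -(gmulA x) y2 gmulg1.
  have e' : ginv (gpow (gmul x y) k) = gconj y (gpow (gmul x y) k).
    rewrite gconjX e; apply/esym/ginv_uniq.
    elim: k => [|k IH] /=; first exact: gmul1g.
    have -> : gmul (gmul x y) (gpow (gmul x y) k) = gmul (gpow (gmul x y) k) (gmul x y).
      have := gpowD (gmul x y) k 1; rewrite addn1 /= gmulg1 => <- //.
    by rewrite -gmulA (gmulA (gmul x y)) gmulgV gmul1g.
  by rewrite e' /gconj ginv_invol // gmulA y2 gmul1g.
rewrite /gconj flip gmulA -gpowD addnn halfK /= on subn0.
by rewrite /= xyn gmulg1 -gmulA y2 gmulg1.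
Qed.

End Conjugation.

Lemma is_hom_gconj (G H : group) (f : G -> H) g x : is_hom f ->
  f (gconj g x) = gconj (f g) (f x).
Proof. by move=> Hf; rewrite /gconj !Hf is_homV. Qed.

Lemma ord4_ind (P : 'I_4 -> Prop) :
  P (o4 0) -> P (o4 1) -> P (o4 2) -> P (o4 3) -> forall i, P i.
Proof.
move=> P0 P1 P2 P3 i; rewrite -(inord_val i).
by case: i => [[|[|[|[|i]]]] Hi].
Qed.

Definition code_rel (c : seq bool) : rel 'I_4 := fun i j => adj c i j.

Lemma code_rel_sym c : symmetric (code_rel c).
Proof. by move=> [[|[|[|[|i]]]] Hi] [[|[|[|[|j]]]] Hj]. Qed.
Lemma code_rel_irr c : irreflexive (code_rel c).
Proof. by move=> [[|[|[|[|i]]]] Hi]. Qed.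

Definition code_cox c n (n2 : 2 <= n) :=
  const_cox (code_rel_sym c) (code_rel_irr c) n2.

Lemma code_relK c : size c = 6 -> code (code_rel c) = c.
Proof.
by case: c => [|? [|? [|? [|? [|? [|? [|? ?]]]]]]] //; rewrite /code /code_rel /= !inordK.
Qed.

Section Trees.
Variables (n : nat) (n2 : 2 <= n).

Lemma path_rels (G : group) (t : 'I_4 -> G) :
  @cox_rels (code_cox path_code n2) G t <->
  (forall i, gmul (t i) (t i) = gone G) /\
  [/\ gpow (gmul (t (o4 0)) (t (o4 1))) n = gone G,
      gpow (gmul (t (o4 1)) (t (o4 2))) n = gone G &
      gpow (gmul (t (o4 2)) (t (o4 3))) n = gone G].
Proof.
split=> [[t2 tX]|[t2 [e1 e2 e3]]].
  by split=> //; split; apply: tX; rewrite /= /code_rel !inordK.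
by split=> //; apply: ord4_ind; apply: ord4_ind; rewrite /= /code_rel !inordK // => _;
  first [exact: e1 | exact: e2 | exact: e3 | exact: gpow_swap e1 |
         exact: gpow_swap e2 | exact: gpow_swap e3].
Qed.

Lemma star_rels (G : group) (t : 'I_4 -> G) :
  @cox_rels (code_cox star_code n2) G t <->
  (forall i, gmul (t i) (t i) = gone G) /\
  [/\ gpow (gmul (t (o4 0)) (t (o4 1))) n = gone G,
      gpow (gmul (t (o4 0)) (t (o4 2))) n = gone G &
      gpow (gmul (t (o4 0)) (t (o4 3))) n = gone G].
Proof.
split=> [[t2 tX]|[t2 [e1 e2 e3]]].
  by split=> //; split; apply: tX; rewrite /= /code_rel !inordK.
by split=> //; apply: ord4_ind; apply: ord4_ind; rewrite /= /code_rel !inordK // => _;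
  first [exact: e1 | exact: e2 | exact: e3 | exact: gpow_swap e1 |
         exact: gpow_swap e2 | exact: gpow_swap e3].
Qed.

Let rot (G : group) (x y : G) := gpow (gmul x y) n.+1./2.

(* Diagram twist: conjugating the end vertex of a path moves it next to the
   conjugate neighbour. *)
Let path_to_star (G : group) (t : 'I_4 -> G) : 'I_4 -> G := fun i =>
  nth (gone G) [:: t (o4 1); t (o4 0); t (o4 2);
    gconj (rot (t (o4 1)) (t (o4 2))) (t (o4 3))] i.
Let star_to_path (G : group) (t : 'I_4 -> G) : 'I_4 -> G := fun i =>
  nth (gone G) [:: t (o4 1); t (o4 0); t (o4 2);
    gconj (ginv (rot (t (o4 0)) (t (o4 2)))) (t (o4 3))] i.

Hypothesis n_odd : odd n.

Lemma path_to_starP (G : group) (t : 'I_4 -> G) :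
  @cox_rels (code_cox path_code n2) G t ->
  @cox_rels (code_cox star_code n2) G (path_to_star t).
Proof.
case/path_rels=> t2 [e1 e2 e3]; apply/star_rels; split.
  by apply: ord4_ind; rewrite /path_to_star inordK //= -?gconjM ?t2 ?gconj1.
rewrite /path_to_star !inordK //=; split=> //; first exact: gpow_swap e1.
rewrite -{1}(odd_dihedral_conj n_odd (t2 _) (t2 _) e2) -gconjM -gconjX.
by rewrite e3 gconj1.
Qed.

Lemma star_to_pathP (G : group) (t : 'I_4 -> G) :
  @cox_rels (code_cox star_code n2) G t ->
  @cox_rels (code_cox path_code n2) G (star_to_path t).
Proof.
case/star_rels=> t2 [e1 e2 e3]; apply/path_rels; split.
  by apply: ord4_ind; rewrite /star_to_path inordK //= -?gconjM ?t2 ?gconj1.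
rewrite /star_to_path !inordK //=; split=> //; first exact: gpow_swap e1.
set h := rot _ _; have e : gconj h (t (o4 2)) = t (o4 0).
  exact: odd_dihedral_conj.
by rewrite -[X in gmul X _](gconjK h) e -gconjM -gconjX e3 gconj1.
Qed.

Let path_to_starK (G : group) (t : 'I_4 -> G) v : star_to_path (path_to_star t) v = t v.
Proof.
by move: v; apply: ord4_ind; rewrite /star_to_path inordK //= /path_to_star !inordK //= gconjK.
Qed.

Let star_to_pathK (G : group) (t : 'I_4 -> G) v : path_to_star (star_to_path t) v = t v.
Proof.
by move: v; apply: ord4_ind; rewrite /path_to_star inordK //= /star_to_path !inordK //= gconjKV.
Qed.

Lemma path_star_change :
  @tuple_change (code_cox path_code n2) (code_cox star_code n2)
    (@path_to_star) (@star_to_path).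
Proof.
split=> [G t|G t|G t _ v|G t _ v|G H f t Hf _]; [exact: path_to_starP |
  exact: star_to_pathP | exact: path_to_starK | exact: star_to_pathK |].
apply: ord4_ind; rewrite /path_to_star !inordK //= is_hom_gconj //.
by rewrite /rot (is_homX _ _ Hf) Hf.
Qed.

Lemma star_path_change :
  @tuple_change (code_cox star_code n2) (code_cox path_code n2)
    (@star_to_path) (@path_to_star).
Proof.
split=> [G t|G t|G t _ v|G t _ v|G H f t Hf _]; [exact: star_to_pathP |
  exact: path_to_starP | exact: star_to_pathK | exact: path_to_starK |].
apply: ord4_ind; rewrite /star_to_path !inordK //= is_hom_gconj //.
by rewrite (is_homV _ Hf) /rot (is_homX _ _ Hf) Hf.
Qed.

Lemma tree_coxeter (g h : rel 'I_4) (gs : symmetric g) (gi : irreflexive g)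
  (hs : symmetric h) (hi : irreflexive h) (G : group) :
  tree_code (code g) -> tree_code (code h) ->
  is_coxeter_group_of (const_cox gs gi n2) G -> is_coxeter_group_of (const_cox hs hi n2) G.
Proof.
have iso_to (f : rel 'I_4) (fs : symmetric f) (fi : irreflexive f) c : size c = 6 ->
    iso_code (code f) c -> exists k : cv (const_cox fs fi n2) -> cv (code_cox c n2), cox_iso k.
  move=> sc ic; apply: (iso_codeP fs fi (code_rel_sym c) (code_rel_irr c) n2).
  by rewrite code_relK.
move=> tg th HG.
have HP : is_coxeter_group_of (code_cox path_code n2) G.
  case/orP: tg => /iso_to-/(_ gs gi erefl)[k kiso].
    exact: cox_iso_coxeter kiso HG.
  exact: tuple_change_coxeter star_path_change (cox_iso_coxeter kiso HG).
case/orP: th => /iso_to-/(_ hs hi erefl)[k /cox_iso_inv[k' kiso]].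
  exact: cox_iso_coxeter kiso HP.
exact: cox_iso_coxeter kiso (tuple_change_coxeter path_star_change HP).
Qed.

End Trees.

(** * The odd case assembled, and the theorem *)

Lemma connected_conn_code (g : rel 'I_4) (gs : symmetric g) (gi : irreflexive g)
  n (n2 : 2 <= n) : connected_cox (const_cox gs gi n2) -> conn_code (code g).
Proof.
move=> gc; apply/allP => _ /ffun_word_surj[f ->]; rewrite /nonconst /splits.
apply/implyP => /has4P[i [j]]; rewrite !nth_ffun_word => fij.
apply: contraT => /has4P H.
have Hf : f \in invariant_fun g 'I_2.
  apply/invariant_funP => k l gkl; apply: val_inj; apply/eqP; apply: contraT => fkl.
  by case: H; exists k, l; rewrite -adj_code // gkl !nth_ffun_word.
by rewrite (invariant_connect Hf (gc i j)) eqxx in fij.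
Qed.

Lemma cox_iso_connected (D E : coxgraph) (k : cv D -> cv E) :
  cox_iso k -> connected_cox D -> connected_cox E.
Proof.
case=> [[k' kK k'K] ke _] Dc i j; rewrite -(k'K i) -(k'K j).
have /connectP[q] := Dc (k' i) (k' j); elim: q (k' i) => [|w q IH] u /=.
  by move=> _ ->; apply: connect0.
case/andP=> uw /IH H /H; apply: connect_trans; apply: connect1; by rewrite ke.
Qed.

Lemma rigid_odd (D E : coxgraph) (W WG : group) (n : nat) :
  is_coxeter_group_of D W -> is_coxeter_group_of E WG -> profinite_iso W WG ->
  #|cv E| = 4 -> connected_cox E -> (forall i j : cv E, cedge i j -> clab i j = n) ->
  2 <= n -> odd n -> group_iso W WG.
Proof.
move=> HW HWG piso E4 Ec En n2 n_odd.
have [te] := profinite_tuple_equiv HW HWG piso.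
have rD := rigidD te E4 Ec En n_odd.
have [p p_pr pn] : exists2 p, prime p & p %| n.
  by exists (pdiv n); rewrite ?pdiv_prime ?pdiv_dvd.
have n0 : 0 < n := ltnW n2.
have p_odd : odd p.
  by apply: contraTT pn => ep; apply/negP => /(dvdn_odd)/(_ n_odd); rewrite (negPf ep).
have : 0 < logn p n by rewrite logn_gt0 mem_primes p_pr n0.
case bE : (logn p n) => [//|b] _.
have bn : p ^ b.+1 %| n by rewrite pfactor_dvdn // bE.
have bn1 : ~~ (p ^ b.+2 %| n) by rewrite pfactor_dvdn // bE ltnn.
have [c [c_surj cP ck cc]] := prime_classes te E4 Ec En n_odd p_pr pn.
set g := quo_rel c (fun m => ~~ (p ^ b.+2 %| m)).
pose gs : symmetric g := @quo_sym D c _; pose gi : irreflexive g := @quo_irr D c _.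
have gc : conn_code (code g) := cc b.+1 bn1.
have cb u v : cedge u v -> ~~ (p ^ b.+1 %| clab u v) -> c u = c v by apply: ck.
pose G := const_cox gs gi n2.
have [g0 [g0s [g0i [k0 k0iso]]]] := const_coxP n2 E4 En.
pose G0 := const_cox g0s g0i n2.
have HWG0 := cox_iso_coxeter k0iso HWG.
have [te0] := profinite_tuple_equiv HW HWG0 piso.
have g0c : conn_code (code g0).
  by apply: (connected_conn_code (n2 := n2)); apply: cox_iso_connected k0iso Ec.
have r0 : parity_rigid G0.
  apply: parity_rigidP; apply: (@card_parity_connected _ n) => //; last exact: conn_code_connected.
  by rewrite card_ord.
set R : finZmodType := 'Z_(p ^ b.+1).
have Qs := shear_p_by_two b p_pr.
have cardG : #|[pred t : {ffun cv G -> shear 'Z_p R} | cox_tuple t]| =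
    #|[pred t : {ffun cv G0 -> shear 'Z_p R} | cox_tuple t]|.
  by rewrite -(card_descend rD p_pr n_odd n2 c_surj cP cb bn bn1 gc Qs) (card_tuples te0).
(* [down] and [up] together say that the quotient graph and the graph of W_Gamma realise the same
   numbers of lifts of reflection tuples. The passage goes through [D]. *)
have down (a : {ffun 'I_4 -> 'Z_p}) : exists a' : {ffun 'I_4 -> 'Z_p},
   #|[pred t : {ffun cv G -> shear 'Z_p R} |
     cox_tuple t & fcomp (@shear_base _ _) t == dih_lift n2 gs gi a]| =
   #|[pred t : {ffun cv G0 -> shear 'Z_p R} |
     cox_tuple t & fcomp (@shear_base _ _) t == dih_lift n2 g0s g0i a']|.
  have Ha := dih_liftP p_pr n2 bn gs gi a.
  have Hpsi := ascend p_pr n_odd cb bn1 gc (dihedral_p_by_two b p_pr) Ha.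
  pose phi := tmap te0 (pull c (dih_lift n2 gs gi a)).
  have sphi i : dih_sign (phi i) = true.
    apply: (tmap_sign te0 (@dih_signM 'Z_p) r0 Hpsi).
    by have [u _] := c_surj ord0; exists u; rewrite !ffunE.
  exists [ffun i => (phi i).1].
  rewrite -(card_lifts_descend rD p_pr n_odd c_surj cP cb bn bn1 gc _ _ Qs).
  rewrite (card_lifts te0 (@shear_baseM 'Z_p R) Hpsi); apply: eq_card => t.
  rewrite !inE; congr (_ && (_ == _)); apply/ffunP => i; rewrite !ffunE.
  exact: dih_signT.
have up (a : {ffun 'I_4 -> 'Z_p}) : exists a' : {ffun 'I_4 -> 'Z_p},
   #|[pred t : {ffun cv G0 -> shear 'Z_p R} |
     cox_tuple t & fcomp (@shear_base _ _) t == dih_lift n2 g0s g0i a]| =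
   #|[pred t : {ffun cv G -> shear 'Z_p R} |
     cox_tuple t & fcomp (@shear_base _ _) t == dih_lift n2 gs gi a']|.
  have Ha := dih_liftP p_pr n2 bn g0s g0i a.
  have Hpsi := tinvP te0 Ha.
  have [phi Hphi ephi] :=
    descend rD p_pr n2 c_surj cP bn (dihedral_p_by_two b p_pr) Hpsi.
  have sphi i : dih_sign (phi i) = true.
    have [u <-] := c_surj i.
    have := tmap_sign (tuple_equiv_sym te0) (@dih_signM 'Z_p) rD Ha _ u.
    rewrite [tmap _ _]ephi ffunE; apply.
    by exists ord0; rewrite ffunE.
  exists [ffun i => (phi i).1].
  rewrite (card_lifts (tuple_equiv_sym te0) (@shear_baseM 'Z_p R) Ha).
  rewrite [tmap _ _]ephi.
  rewrite (card_lifts_descend rD p_pr n_odd c_surj cP cb bn bn1 gc _ _ Qs).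
  apply: eq_card => t; rewrite !inE; congr (_ && (_ == _)).
  by apply/ffunP => i; rewrite !ffunE; apply: dih_signT.
have HWG1 : is_coxeter_group_of G WG.
  have := connected_code_cases g0c gc.
  case: ifP => [/(iso_codeP g0s g0i gs gi n2)[k kiso] _|_].
    exact: cox_iso_coxeter kiso HWG0.
  case: ifP => [/andP[t0 t1] _|_]; first exact: tree_coxeter HWG0.
  case: ifP => [/(strict_sub_card p_pr n_odd n2 bn bn1 g0s g0i gs gi)|_].
    by rewrite cardG ltnn.
  case: ifP => [/(strict_sub_card p_pr n_odd n2 bn bn1 gs gi g0s g0i)|_].
    by rewrite cardG ltnn.
  case: ifP => [br tc|_ /andP[br tc]].
    have [a ea] := bridge_lifts p_pr n_odd n2 bn g0s g0i br.
    have [a' ea'] := up a.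
    exfalso; apply: (@two_cut_lifts n p b p_pr n_odd n2 bn bn1 _ gs gi tc a').
    by rewrite -ea' ea.
  have [a ea] := bridge_lifts p_pr n_odd n2 bn gs gi br.
  have [a' ea'] := down a.
  exfalso; apply: (@two_cut_lifts n p b p_pr n_odd n2 bn bn1 _ g0s g0i tc a').
  by rewrite -ea' ea.
have [te1] := profinite_tuple_equiv HW HWG1 piso.
suff kiso : @cox_iso D G c by apply: cox_iso_group_iso kiso HW HWG1.
apply: (collapse_iso te1 (n := n)) => // u v uv.
case: (c u =P c v) => [->|nc]; [by left|right].
have m2 := clab_ge2 uv.
split; last first.
  apply/dvdn_partP => // r; rewrite mem_primes => /and3P[r_pr _ rn].
  rewrite p_part; apply: contraT => nrm.
  have [rp|rp] := eqVneq p r.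
    case: nc; rewrite -rp in nrm.
    exact: (ck _ _ _ (pfactor_dvdnn p n) uv nrm).
  have [cr [_ crP crk _]] := prime_classes te E4 Ec En n_odd r_pr rn.
  have := crk _ _ _ (pfactor_dvdnn _ _) uv nrm; move/crP => uvr.
  (* The classes for [r] refine those for [p], so a label missing the full power of [r] would keep
     the edge inside a [p]-class. *)
  have Hc : [ffun x => c x] \in invariant_fun (edges_with (fun m => ~~ (r %| m))) 'I_4.
    apply/invariant_funP => x y /andP[xy rm]; rewrite !ffunE.
    apply: (edge_cross te E4 Ec En n_odd p_pr r_pr rp pn rn _ xy rm).
    move=> x' y' xy' pm; apply/cP/connect1; by rewrite /edges_with xy'.
  by have := invariant_connect Hc uvr; rewrite !ffunE.
apply: contraT => nguv.
set m := clab u v.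
(* Placing [A] and [B] at the two nonadjacent classes and [O] elsewhere satisfies every relation of
   the quotient graph, as AB is the only product of order not dividing [n] that could occur; the
   label [m] would have to kill it. *)
have [O [A [B [[O2 A2 B2 OA OB] ABm]]]] := long_product m p_pr p_odd.
have Qalt := alt_p_by_two m p_pr p_odd.
have swap (x y : altQ p m) : (x * x = 1)%g -> (y * y = 1)%g -> ((x * y) ^+ n = 1)%g ->
    ((y * x) ^+ n = 1)%g.
  move=> x2 y2 e; have -> : (y * x = (x * y)^-1)%g.
    by apply: (mulgI (x * y)%g); rewrite mulgV mulgA -(mulgA x) y2 mulg1.
  by rewrite expgVn e invg1.
have toN (x : altQ p m) : (x ^+ p = 1)%g -> (x ^+ n = 1)%g.
  by move=> e; case/dvdnP: pn => q ->; rewrite mulnC expgM e expg1n.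
pose t : {ffun cv G -> altQ p m} :=
  [ffun i => if i == c u then A else if i == c v then B else O].
have ncE : (c v == c u) = false by apply/eqP => /esym.
have Ht : cox_tuple t.
  apply/cox_tupleP; split=> [i|i j /= gij]; rewrite !ffunE.
    by case: ifP => _; [|case: ifP].
  case: (i =P c u) gij => [->|_]; case: (j =P c u) => [->|_].
  - by rewrite gi.
  - case: (j =P c v) => [->|_] gij; first by rewrite [cedge _ _]gij in nguv.
    by apply: swap => //; apply: toN.
  - case: (i =P c v) => [->|_] gij; first by rewrite [cedge _ _]gs [g _ _]gij in nguv.
    exact: toN.
  case: (i =P c v) => [->|_]; case: (j =P c v) => [->|_].
  - by rewrite gi.
  - by move=> _; apply: swap => //; apply: toN.
  - by move=> _; apply: toN.
  by rewrite O2 expg1n.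
have /cox_tupleP[_ /(_ _ _ uv)] : cox_tuple (pull c t).
  apply: (pull_surjective (E := G)) Ht => //; first exact: card_tuples.
  by move=> s Hs; apply: (descend rD p_pr n2 c_surj cP bn Qalt Hs).
rewrite !ffunE eqxx ncE eqxx => e; have := ABm m.
by rewrite leqnn ltnW // e eqxx => /(_ isT).
Qed.

Theorem theorem9p18 (Gam : coxgraph) (n : nat) :
  #|cv Gam| = 4 ->
  connected_cox Gam ->
  (forall v w : cv Gam, cedge v w -> clab v w = n) ->
  2 <= n ->
  ~ (exists k, 1 <= k /\ n = 4 * k + 2) ->
  forall WG : group, is_coxeter_group_of Gam WG ->
  forall W : group, coxeter_group W ->
  profinite_iso W WG -> group_iso W WG.
Proof.
move=> V4 Gc Gn n2 nk WG HWG W [D HW] piso.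
case: (boolP (odd n)) => [n_odd|n_even].
  exact: rigid_odd HW HWG piso V4 Gc Gn n2 n_odd.
have [n4|n4] := boolP (4 %| n).
  have [te] := profinite_tuple_equiv HW HWG piso.
  have [k kiso] := four_iso te V4 Gn (ltnW n2) n4.
  exact: cox_iso_group_iso kiso HW HWG.
(* The remaining residue is 2 mod 4, and the hypothesis on [n] leaves only quotient 0. *)
have e2 : n = 2.
  have e := divn_eq n 4; have r4 : n %% 4 < 4 by rewrite ltn_mod.
  move: n4 n_even; rewrite e dvdn_addr ?dvdn_mull // oddD oddM andbF /=.
  case: (n %% 4) r4 e => [|[|[|[|r]]]] // _ e _ _.
  case: (n %/ 4) e => [|q] e //.
  by case: nk; exists q.+1; split=> //; rewrite {1}e mulnC.
apply: rigid_two HW HWG piso V4 _.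
by move=> i j /Gn ->.
Qed.
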